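(* Let $\Gamma$ be a graph such that $d(A(\Gamma))\geq 2$. Then $\Gamma$ is $2$-vertex-connected if and only if the right-angled Artin group $A(\Gamma)$ has a proper ear decomposition.
   Context: Basics. All graphs are finite, undirected and simple; $V(\Gamma)$, $E(\Gamma)$ are the vertex and edge sets. The right-angled Artin group (RAAG) with underlying graph $\Gamma$ is $A(\Gamma) = \langle v \in V(\Gamma) \mid [v,w]=1 \text{ whenever } \{v,w\}\in E(\Gamma)\rangle$. A graph is called $k$-vertex-connected if removing at most $k-1$ vertices does not disconnect it, while removing $k$ (specific) vertices does. $C(x)$ is the centralizer of $x$, $\langle\langle \cdot \rangle\rangle$ the normal closure, $d(G)$ the minimal number of generators of $G$; $P_n$ and $C_n$ are the path and the cycle on $n$ vertices. An ear is a graph consisting of a single path or a single cycle; every ear has more than one vertex. The endpoints of a path are its two degree $1$ vertices; one distinguished vertex of a cycle is called its endpoint (so a cycle can be thought of as a path whose endpoints are identified); all other vertices are inner. An ear RAAG is $A(\Gamma)$ with $\Gamma$ an ear. Ear decomposition of a graph. An ear decomposition of a graph $\Gamma$ is a finite sequence of ears $\{\Gamma_i\}_{i=1}^m$ contained in $\Gamma$ such that $\Gamma_1$ is a cycle, for every $i>1$ the endpoints of $\Gamma_i$ but none of its inner vertices (if there are any) are contained in $\bigcup_{j=1}^{i-1}\Gamma_j$, and $\Gamma=\bigcup_{i=1}^m\Gamma_i$. It is proper if for every $i>1$ the ear $\Gamma_i$ is a path. Pearl chains. Let $\Gamma$ be an ear. For $\Gamma \ne C_4$, an element $x\in A(\Gamma)$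 satisfies (I) if $x\neq 1$, $C(x)$ is non-abelian and $x$ generates the center of $C(x)$. Elements $x,y$ satisfying (I) are adjacent inner pearls if $[x,y]=1$ and there is $z\in A(\Gamma)$ with $[x,z]=1$, $[y,z]\neq 1$. A triple $(x,y,z)$ satisfies (E) if $y,z$ are adjacent inner pearls, $C(y)=\langle x,y,z\rangle$ and $A(\Gamma)/\langle\langle y\rangle\rangle$ splits as a free product with one factor isomorphic to $\mathbb{Z}$. A triple $(y,x,z)$ with middle element $x$ satisfies (T) if $d(A(\Gamma))\ge 5$, $x,y,z$ satisfy (I), $y,z\in C(x)$ and $y\langle x\rangle, z\langle x\rangle$ generate $C(x)/\langle x\rangle$. A pearl chain of $A(\Gamma)$ is a finite set of elements $\{p_1,\dots,p_n\}$, listed in order, such that: (i) if $\Gamma=P_2$: $n=2$ and neither $p_1\in\mathbb{Z}^2$ nor $p_2\langle p_1\rangle\in \mathbb{Z}^2/\langle p_1\rangle$ is a multiple of another element, i.e. of the form $ku$ with $k$ an integer, $|k|\ge 2$; (ii) if $\Gamma=C_3$: $n=3$, $A(C_3)/\langle p_3\rangle\cong\mathbb{Z}^2$ and $p_1\langle p_3\rangle, p_2\langle p_3\rangle$ satisfy in this quotient the condition of (i); (iii) if $\Gamma=P_3$: $n=3$, $C(p_2)$ is non-abelian, $p_2$ generates its center and $C(p_2)=\langle p_1,p_2,p_3\rangle$; (iv) if $\Gamma=C_4$: $n=4$ and, indices modulo $4$, each $C(p_i)$ is non-abelian, $C(p_i)=\langle p_{i-1},p_i,p_{i+1}\rangle$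 and $A(C_4)/\langle\langle p_i\rangle\rangle$ is a RAAG with $d(A(C_4))=d(A(C_4)/\langle\langle p_i\rangle\rangle)+1$; (v) if $\Gamma$ is any other path: $(p_1,p_2,p_3)$ and $(p_n,p_{n-1},p_{n-2})$ satisfy (E), and $(p_{i-1},p_i,p_{i+1})$ satisfies (T) for $3\le i\le n-2$; (vi) if $\Gamma$ is any other cycle: $(p_{i-1},p_i,p_{i+1})$ satisfies (T) for all $i$, indices modulo $n$. Elements of a pearl chain are called pearls. A pearl chain is a set of generators arising from the vertices of $\Gamma$, so each pearl $p_j$ corresponds to a vertex of $\Gamma$, the order being that of the vertices along the ear; for a path, $p_1$ and $p_n$ correspond to the endpoints. An ear RAAG together with a pearl chain is a decorated ear RAAG. Ear decompositions of RAAGs. Consider decorated ear RAAGs $(A(\Gamma_i),\{p_{i,1},\dots,p_{i,n_i}\})$, $1\le i\le m$, and the iterated amalgamated product $G_m$ given by $G_1=A(\Gamma_1)$ and $G_{k+1}=G_k *_{H_k} A(\Gamma_{k+1})$, where $H_k$ is $\{1\}$, $\{p_{k+1,1}=p_{i_1,j_1}\}$ or $\{p_{k+1,1}=p_{i_1,j_1},\ p_{k+1,n_{k+1}}=p_{i_2,j_2}\}$ with $i_1,i_2\le k$, $1\le j_1\le n_{i_1}$, $1\le j_2\le n_{i_2}$, and the elements are identified as listed in $H_k$; correspondingly, vertices of the ears $\Gamma_i$ are identified. An ear decomposition of $A(\Gamma)$ is a specification of such ear RAAGs and of such an iterated amalgamated product representing $A(\Gamma)$ for which the corresponding sequence $\Gamma_1,\dots,\Gamma_m$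 is an ear decomposition, i.e. the first ear is a cycle and the endpoints of each subsequent ear are contained in the previous ears. It is a proper ear decomposition of $A(\Gamma)$ if the corresponding ear decomposition of the graph is proper.
   Formalization: ''2-vertex-connected'' is taken as: more than 2 vertices and removing at most 1 does not disconnect; the clause that some 2 vertices disconnect is dropped, since K_3 (its own proper ear decomposition) would refute the claim. Amalgamated products are read as pushouts. *)

(* Defs.v *)
From HB Require Import structures.
From mathcomp Require Import all_boot all_order all_algebra.
From mathcomp Require Import boolp classical_sets.

Set Implicit Arguments.
Unset Strict Implicit.
Unset Printing Implicit Defensive.

Local Open Scope classical_set_scope.
Local Open Scope quotient_scope.
Local Open Scope group_scope.

Definition isog (G H : groupType) : Prop :=
  exists f : {multiplicative G -> H}, bijective f.

Definition is_subgroup (G : groupType) (H : set G) : Prop :=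
  [/\ H 1, forall x y, H x -> H y -> H (x * y) & forall x, H x -> H x^-1].

Definition is_normal_subgroup (G : groupType) (N : set G) : Prop :=
  is_subgroup N /\ forall x y, N x -> N (x ^ y).

Definition gen (G : groupType) (S : set G) : set G :=
  smallest (@is_subgroup G) S.

Definition normal_closure (G : groupType) (S : set G) : set G :=
  smallest (@is_normal_subgroup G) S.

Lemma normal_closure_normal (G : groupType) (S : set G) :
  is_normal_subgroup (normal_closure S).
Proof.
split; last by move=> x y Nx N [nN sN]; apply: nN.2; apply: Nx.
split=> [N [nN _]|x y Nx Ny N [nN sN]|x Nx N [nN sN]].
- by case: nN => -[].
- by case: (nN) => -[_ nM _] _; apply: nM; [apply: Nx|apply: Ny].
- by case: (nN) => -[_ _ nV] _; apply: nV; apply: Nx.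
Qed.

Section Quotient.
Variables (G : groupType) (S : set G).
Let N := normal_closure S.

Definition ncl_rel : rel G := fun x y => `[< N (x^-1 * y) >].

Lemma ncl_rel_equiv : equiv_class_of ncl_rel.
Proof.
have [[N1 NM NV] _] := normal_closure_normal S.
split=> [x|x y|y x z].
- by apply/asboolP; rewrite mulVg.
- by apply/asboolP/asboolP => /NV; rewrite invgM invgK.
- move=> /asboolP Nxy /asboolP Nyz; apply/asboolP.
  by have := NM _ _ Nxy Nyz; rewrite mulgA mulgK.
Qed.

Canonical ncl_equiv := EquivRelPack ncl_rel_equiv.

(* G/<<S>>, with <<S>> the normal closure *)
Definition quotg := {eq_quot ncl_rel}.

Definition quotg_pi (x : G) : quotg := \pi_quotg x.

HB.instance Definition _ := Choice.copy quotg {eq_quot ncl_rel}.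

Lemma quotg_piP x y : quotg_pi x = quotg_pi y <-> N (x^-1 * y).
Proof.
split=> [/eqP|Nxy]; first by rewrite /quotg_pi eqmodE => /asboolP.
by apply/eqP; rewrite /quotg_pi eqmodE; apply/asboolP.
Qed.

Lemma quotg_reprK (x : quotg) : quotg_pi (repr x) = x.
Proof. exact: reprK. Qed.

Definition quotg_mul (x y : quotg) : quotg := quotg_pi (repr x * repr y).
Definition quotg_inv (x : quotg) : quotg := quotg_pi (repr x)^-1.

Lemma quotg_piM x y : quotg_mul (quotg_pi x) (quotg_pi y) = quotg_pi (x * y).
Proof.
have [[N1 NM NV] NJ] := normal_closure_normal S.
apply/quotg_piP; set x' := repr _; set y' := repr _.
have /quotg_piP Nx : quotg_pi x' = quotg_pi x by exact: quotg_reprK.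
have /quotg_piP Ny : quotg_pi y' = quotg_pi y by exact: quotg_reprK.
have := NM _ _ Ny (NJ _ y Nx).
by rewrite /conjg invgM !mulgA mulgK.
Qed.

Lemma quotg_piV x : quotg_inv (quotg_pi x) = quotg_pi x^-1.
Proof.
have [[N1 NM NV] NJ] := normal_closure_normal S.
apply/quotg_piP; set x' := repr _.
have /quotg_piP Nx : quotg_pi x = quotg_pi x' by symmetry; exact: quotg_reprK.
by have := NJ _ x^-1 Nx; rewrite /conjg invgK !mulgA mulgV mul1g invgK.
Qed.

Lemma quotg_mulA : associative quotg_mul.
Proof.
move=> x y z; rewrite -(quotg_reprK x) -(quotg_reprK y) -(quotg_reprK z).
by rewrite !quotg_piM mulgA.
Qed.

Lemma quotg_mul1 : left_id (quotg_pi 1) quotg_mul.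
Proof. by move=> x; rewrite -(quotg_reprK x) quotg_piM mul1g. Qed.

Lemma quotg_1mul : right_id (quotg_pi 1) quotg_mul.
Proof. by move=> x; rewrite -(quotg_reprK x) quotg_piM mulg1. Qed.

Lemma quotg_mulV : left_inverse (quotg_pi 1) quotg_inv quotg_mul.
Proof. by move=> x; rewrite -(quotg_reprK x) quotg_piV quotg_piM mulVg. Qed.

Lemma quotg_Vmul : right_inverse (quotg_pi 1) quotg_inv quotg_mul.
Proof. by move=> x; rewrite -(quotg_reprK x) quotg_piV quotg_piM mulgV. Qed.

HB.instance Definition _ := isGroup.Build quotg
  quotg_mulA quotg_mul1 quotg_1mul quotg_mulV quotg_Vmul.

End Quotient.

Notation "G // S" := (@quotg G S) (at level 40) : type_scope.

(* In a word, (x, false) stands for the letter x and (x, true) for x^-1. *)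
Inductive free_eq (T : Type) : seq (T * bool) -> seq (T * bool) -> Prop :=
| FreeCancel u x b v : free_eq (u ++ [:: (x, b), (x, ~~ b) & v]) (u ++ v)
| FreeRefl u : free_eq u u
| FreeSym u v : free_eq u v -> free_eq v u
| FreeTrans u v w : free_eq u v -> free_eq v w -> free_eq u w.

Section FreeGroup.
Variable T : choiceType.
Implicit Types u v w : seq (T * bool).

Definition free_rel : rel (seq (T * bool)) := fun u v => `[< free_eq u v >].

Lemma free_rel_equiv : equiv_class_of free_rel.
Proof.
split=> [u|u v|v u w]; first by apply/asboolP/FreeRefl.
- by apply/asboolP/asboolP; apply: FreeSym.
- by move=> /asboolP uv /asboolP vw; apply/asboolP; apply: FreeTrans uv vw.
Qed.

Canonical free_equiv := EquivRelPack free_rel_equiv.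

Definition free_group := {eq_quot free_rel}.

Definition word_class w : free_group := \pi_free_group w.

HB.instance Definition _ := Choice.copy free_group {eq_quot free_rel}.

Lemma word_classP u v : word_class u = word_class v <-> free_eq u v.
Proof.
split=> [/eqP|uv]; first by rewrite /word_class eqmodE => /asboolP.
by apply/eqP; rewrite /word_class eqmodE; apply/asboolP.
Qed.

Lemma word_classK (x : free_group) : word_class (repr x) = x.
Proof. exact: reprK. Qed.

Definition word_inv w : seq (T * bool) := rev [seq (a.1, ~~ a.2) | a <- w].

Lemma free_eq_cat u u' v v' :
  free_eq u u' -> free_eq v v' -> free_eq (u ++ v) (u' ++ v').
Proof.
move=> uu' vv'; apply: (@FreeTrans _ _ (u' ++ v)).
- elim: uu' => [w x b z|w|w z _|w z t _ IH1 _ IH2].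
  + by rewrite -!catA /=; apply: FreeCancel.
  + exact: FreeRefl.
  + exact: FreeSym.
  + exact: FreeTrans IH1 IH2.
- elim: vv' => [w x b z|w|w z _|w z t _ IH1 _ IH2].
  + by rewrite !catA; apply: FreeCancel.
  + exact: FreeRefl.
  + exact: FreeSym.
  + exact: FreeTrans IH1 IH2.
Qed.

Lemma free_eq_inv u v : free_eq u v -> free_eq (word_inv u) (word_inv v).
Proof.
elim=> [w x b z|w|w z _|w z t _ IH1 _ IH2].
- rewrite /word_inv !map_cat !rev_cat /= !rev_cons -!cats1 -!catA /= negbK.
  exact: FreeCancel.
- exact: FreeRefl.
- exact: FreeSym.
- exact: FreeTrans IH1 IH2.
Qed.

Lemma free_eq_mulV w : free_eq (w ++ word_inv w) [::].
Proof.
elim: w => [|[x b] w IH]; first exact: FreeRefl.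
have -> : ((x, b) :: w) ++ word_inv ((x, b) :: w) =
          [:: (x, b)] ++ (w ++ word_inv w) ++ [:: (x, ~~ b)].
  by rewrite /word_inv /= rev_cons -cats1 !catA.
apply: (@FreeTrans _ _ ([:: (x, b)] ++ [::] ++ [:: (x, ~~ b)])).
  apply: free_eq_cat; first exact: FreeRefl.
  by apply: free_eq_cat => //; apply: FreeRefl.
exact: (FreeCancel [::]).
Qed.

Lemma word_invK w : word_inv (word_inv w) = w.
Proof.
rewrite /word_inv map_rev revK -map_comp map_id_in // => -[x b] _ /=.
by rewrite negbK.
Qed.

Definition free_mul (x y : free_group) := word_class (repr x ++ repr y).
Definition free_inv (x : free_group) := word_class (word_inv (repr x)).

Lemma free_mulE u v :
  free_mul (word_class u) (word_class v) = word_class (u ++ v).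
Proof.
by apply/word_classP; apply: free_eq_cat; apply/word_classP/word_classK.
Qed.

Lemma free_invE u : free_inv (word_class u) = word_class (word_inv u).
Proof. by apply/word_classP/free_eq_inv/word_classP/word_classK. Qed.

Lemma free_mulA : associative free_mul.
Proof.
move=> x y z; rewrite -(word_classK x) -(word_classK y) -(word_classK z).
by rewrite !free_mulE catA.
Qed.

Lemma free_mul1 : left_id (word_class [::]) free_mul.
Proof. by move=> x; rewrite -(word_classK x) free_mulE. Qed.

Lemma free_1mul : right_id (word_class [::]) free_mul.
Proof. by move=> x; rewrite -(word_classK x) free_mulE cats0. Qed.

Lemma free_Vmul : right_inverse (word_class [::]) free_inv free_mul.
Proof.
move=> x; rewrite -(word_classK x) free_invE free_mulE.
exact/word_classP/free_eq_mulV.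
Qed.

Lemma free_mulV : left_inverse (word_class [::]) free_inv free_mul.
Proof.
move=> x; rewrite -(word_classK x) free_invE free_mulE -{2}(word_invK (repr x)).
exact/word_classP/free_eq_mulV.
Qed.

HB.instance Definition _ := isGroup.Build free_group
  free_mulA free_mul1 free_1mul free_mulV free_Vmul.

Definition free_gen (x : T) : free_group := word_class [:: (x, false)].

End FreeGroup.

Section FreeProduct.
Variables G H : groupType.

(* the relators turning the two maps into homomorphisms *)
Definition free_prod_rel : set (free_group (G + H)%type) :=
  [set r | exists x y : G, r = free_gen (inl (x * y)) /
                               (free_gen (inl x) * free_gen (inl y))] `|`
  [set r | exists x y : H, r = free_gen (inr (x * y)) /
                               (free_gen (inr x) * free_gen (inr y))].

Definition free_prod : groupType := free_group (G + H)%type // free_prod_rel.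

Definition inj_l (x : G) : free_prod := quotg_pi free_prod_rel (free_gen (inl x)).
Definition inj_r (x : H) : free_prod := quotg_pi free_prod_rel (free_gen (inr x)).

End FreeProduct.

Definition infinite_cyclic : groupType := Algebra.to_multiplicative int.

Definition generated_by (G : groupType) (n : nat) : Prop :=
  exists s : n.-tuple G, gen [set` s] = setT.

(* d(G); the value is the junk 0 when G is not finitely generated *)
Definition d (G : groupType) : nat :=
  xget 0 [set n | generated_by G n /\
                  forall m, generated_by G m -> (n <= m)%N].

Definition abelian_set (G : groupType) (S : set G) : Prop :=
  forall x y, S x -> S y -> commute x y.

Definition center_of (G : groupType) (S : set G) : set G :=
  [set z | S z /\ forall y, S y -> commute z y].

Definition cent_pred (G : groupType) (x : G) : pred G :=
  fun z => x * z == z * x.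

Definition cent (G : groupType) (x : G) : set G := [set z | cent_pred x z].

Section CentralizerGroup.
Variables (G : groupType) (x : G).

(* C(x) as a group in its own right, needed for C(x)/<x> *)
Definition cent_group := {z : G | cent_pred x z}.

HB.instance Definition _ := SubChoice.on cent_group.

Lemma cent_group_closed : group_closed (cent_pred x).
Proof.
split=> [|y z]; first by rewrite unfold_in /cent_pred mulg1 mul1g.
rewrite !unfold_in /cent_pred => /eqP xy /eqP xz; apply/eqP.
by rewrite mulgA xy -!mulgA (commuteV xz).
Qed.

HB.instance Definition _ :=
  SubChoice_isSubGroup.Build G (cent_pred x) cent_group cent_group_closed.

End CentralizerGroup.

Record sgraph := SGraph {
  vertex :> finType;
  adj : rel vertex;
  adj_sym : symmetric adj;
  adj_irr : irreflexive adj }.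

Definition connected_without (Gamma : sgraph) (S : {set Gamma}) : Prop :=
  forall x y, x \notin S -> y \notin S ->
    connect [rel u v | [&& u \notin S, v \notin S & adj u v]] x y.

(* The usual convention for "at least k-connected", as in Whitney's theorem on
   ear decompositions: more than k vertices, and no removal of fewer than k
   vertices disconnects. The connectivity may exceed k. *)
Definition vertex_connected (k : nat) (Gamma : sgraph) : Prop :=
  (k < #|Gamma|)%N /\ forall S : {set Gamma}, (#|S| < k)%N -> connected_without S.

Definition raag_rel (Gamma : sgraph) : set (free_group Gamma) :=
  [set r | exists v w, adj v w /\ r = [~ free_gen v, free_gen w]].

Definition raag (Gamma : sgraph) : groupType := free_group Gamma // @raag_rel Gamma.

Definition is_raag (G : groupType) : Prop := exists Gamma : sgraph, isog G (raag Gamma).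

Variant shape := Path | Cycle.

(* On a cycle, the inequality only matters for n = 1. *)
Definition ear_adj (s : shape) (n : nat) : rel 'I_n := fun i j =>
  match s with
  | Path => (i.+1 == j) || (j.+1 == i)
  | Cycle => (i != j) && ((ordS i == j) || (ordS j == i))
  end.

Lemma ear_adj_sym s n : symmetric (@ear_adj s n).
Proof. by case: s => i j /=; rewrite 1?eq_sym orbC // eq_sym. Qed.

Lemma ear_adj_irr s n : irreflexive (@ear_adj s n).
Proof. by case: s => i /=; rewrite ?eqxx // gtn_eqF. Qed.

(* the path P_n or the cycle C_n, with vertices numbered along the ear *)
Definition ear_graph (s : shape) (n : nat) : sgraph :=
  SGraph (@ear_adj_sym s n) (@ear_adj_irr s n).

Definition ear_size_ok (s : shape) (n : nat) : bool :=
  match s with Path => (2 <= n)%N | Cycle => (3 <= n)%N end.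

(* An ear in a graph is given by its vertices listed along the ear, the list
   of a cycle starting at its endpoint. *)
Definition ear (V : eqType) : Type := (shape * seq V)%type.

Definition is_ear (V : eqType) (e : ear V) : bool :=
  uniq e.2 && ear_size_ok e.1 (size e.2).

Definition is_endpoint (V : eqType) (e : ear V) (v : V) : bool :=
  match e.2 with
  | [::] => false
  | x :: s => (v == x) || (if e.1 is Path then v == last x s else false)
  end.

(* ear decomposition of the graph that is the union of the ears *)
Definition ear_decomposition (V : eqType) (es : seq (ear V)) : Prop :=
  let e_ i := nth (Path, [::]) es i in
  let before i v := exists2 j, (j < i)%N & v \in (e_ j).2 in
  [/\ (0 < size es)%N /\ (e_ 0).1 = Cycle,
      all (@is_ear V) es &
      forall i v, (0 < i < size es)%N -> v \in (e_ i).2 ->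
        before i v <-> is_endpoint (e_ i) v].

Definition is_proper (V : eqType) (es : seq (ear V)) : Prop :=
  forall i, (0 < i < size es)%N -> (nth (Path, [::]) es i).1 = Path.

Definition is_multiple (G : groupType) (p : G) : Prop :=
  exists u k, (2 <= k)%N /\ (p = u ^+ k \/ p = u ^- k).

Definition unimodular_pair (G : groupType) (p q : G) : Prop :=
  ~ is_multiple p /\ ~ is_multiple (quotg_pi [set p] q).

Section Pearls.
Variable G : groupType.
Implicit Types x y z : G.

Definition inner_pearl x : Prop :=
  [/\ x <> 1, ~ abelian_set (cent x) & gen [set x] = center_of (cent x)].

Definition adjacent_inner_pearls x y : Prop :=
  [/\ inner_pearl x, inner_pearl y, [~ x, y] = 1 &
      exists z, [~ x, z] = 1 /\ [~ y, z] <> 1].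

Definition end_triple x y z : Prop :=
  [/\ adjacent_inner_pearls y z,
      cent y = gen [set x; y; z] &
      exists K L : groupType,
        isog L infinite_cyclic /\ isog (G // [set y]) (free_prod K L)].

(* The quotient below is C(x)/<x>: as x is central in C(x), <x> is already
   normal there. *)
Definition inner_triple y x z : Prop :=
  let C := cent_group x in
  let X := [set c : C | val c = x] in
  [/\ (5 <= d G)%N,
      [/\ inner_pearl x, inner_pearl y & inner_pearl z],
      cent x y /\ cent x z &
      gen [set quotg_pi X c | c in [set c : C | val c = y \/ val c = z]]
        = setT].

End Pearls.

(* Pearls are numbered from 0, so that p`_i is p_(i+1) of the usual numbering.
   The length is part of the condition: the pearls are indexed by the vertices
   of the ear. *)
Definition pearl_chain (s : shape) (n : nat)
    (p : n.-tuple (raag (ear_graph s n))) : Prop :=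
  match s, n with
  | Path, 2 => unimodular_pair p`_0 p`_1
  | Cycle, 3 =>
      let pi := quotg_pi [set p`_2] in
      isog (raag (ear_graph s n) // [set p`_2]) (raag (ear_graph Path 2)) /\
      unimodular_pair (pi p`_0) (pi p`_1)
  | Path, 3 =>
      [/\ ~ abelian_set (cent p`_1),
          gen [set p`_1] = center_of (cent p`_1) &
          cent p`_1 = gen [set p`_0; p`_1; p`_2]]
  | Cycle, 4 => forall i : 'I_n,
      let Q := raag (ear_graph s n) // [set tnth p i] in
      [/\ ~ abelian_set (cent (tnth p i)),
          cent (tnth p i) =
            gen [set tnth p (ord_pred i); tnth p i; tnth p (ordS i)],
          is_raag Q &
          d (raag (ear_graph s n)) = (d Q + 1)%N]
  | Path, _ =>
      [/\ end_triple p`_0 p`_1 p`_2,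
          end_triple p`_(n - 1) p`_(n - 2) p`_(n - 3) &
          forall i, (2 <= i <= n - 3)%N ->
            inner_triple p`_(i - 1) p`_i p`_(i + 1)]
  | Cycle, _ => forall i : 'I_n,
      inner_triple (tnth p (ord_pred i)) (tnth p i) (tnth p (ordS i))
  end.

Record decorated_ear := DecoratedEar {
  ear_shape : shape;
  ear_size : nat;
  ear_sizeP : ear_size_ok ear_shape ear_size;
  pearls : ear_size.-tuple (raag (ear_graph ear_shape ear_size));
  pearlsP : pearl_chain pearls }.

Definition ear_raag (E : decorated_ear) : groupType :=
  raag (ear_graph (ear_shape E) (ear_size E)).

(* The possible H_k; (i, j) refers to the j-th pearl of the i-th ear, both
   numbered from 0. Glue1 a identifies the first pearl of the new ear with a,
   and Glue2 a b moreover identifies its last pearl with b. *)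
Variant gluing :=
  | Glue0
  | Glue1 of nat * nat
  | Glue2 of (nat * nat) & (nat * nat).

Definition glued_to (g : gluing) : seq (nat * nat) :=
  match g with Glue0 => [::] | Glue1 a => [:: a] | Glue2 a b => [:: a; b] end.

(* a group G_k together with the images in it of the pearls of all its ears *)
Record pearled_group := PearledGroup {
  pgroup : groupType;
  pimages : seq (seq pgroup) }.

Definition pearl_at (X : pearled_group) (a : nat * nat) : pgroup X :=
  (nth [::] (pimages X) a.1)`_a.2.

(* The amalgamated product is the pushout: identifying two pairs of pearls may
   force new relations in either factor, as when the edge P_2 is glued to two
   nonadjacent vertices. *)
Definition amalgamate (X : pearled_group) (E : decorated_ear) (g : gluing) :
    pearled_group :=
  let F := free_prod (pgroup X) (ear_raag E) in
  let l : pgroup X -> F := @inj_l _ _ in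
  let r : ear_raag E -> F := @inj_r _ _ in
  let p_first := r (pearls E)`_0 in
  let p_last := r (pearls E)`_(ear_size E).-1 in
  let R : set F := match g with
    | Glue0 => set0
    | Glue1 a => [set p_first / l (pearl_at X a)]
    | Glue2 a b => [set p_first / l (pearl_at X a); p_last / l (pearl_at X b)]
    end in
  @PearledGroup (F // R)
    (rcons [seq [seq quotg_pi R (l x) | x <- s] | s <- pimages X]
           [seq quotg_pi R (r x) | x <- pearls E]).

Definition glue_vertices (es : seq (ear (nat * nat)%type))
    (s : shape) (n : nat) (g : gluing) : seq (ear (nat * nat)%type) :=
  let at_ a := nth a (nth (Path, [::]) es a.1).2 a.2 in
  let vs := [seq (size es, j) | j <- iota 0 n] in
  let vs' := match g with
    | Glue0 => vs
    | Glue1 a => set_nth a vs 0 (at_ a)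
    | Glue2 a b => set_nth b (set_nth a vs 0 (at_ a)) n.-1 (at_ b)
    end in
  rcons es (s, vs').

(* the data of an iterated amalgamated product of decorated ear RAAGs *)
Record amalgam := Amalgam {
  first_ear : decorated_ear;
  later_ears : seq (decorated_ear * gluing) }.

Definition amalgam_ears (D : amalgam) : seq decorated_ear :=
  first_ear D :: unzip1 (later_ears D).

Definition amalgam_wf (D : amalgam) : Prop :=
  forall k a, (k < size (later_ears D))%N ->
    a \in glued_to (nth Glue0 (unzip2 (later_ears D)) k) ->
    (a.1 <= k)%N /\
    (a.2 < ear_size (nth (first_ear D) (amalgam_ears D) a.1))%N.

Definition amalgam_group (D : amalgam) : groupType :=
  pgroup (foldl (fun X Eg => amalgamate X Eg.1 Eg.2)
    (@PearledGroup (ear_raag (first_ear D)) [:: val (pearls (first_ear D))])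
    (later_ears D)).

(* The ears of the glued graph; a glued vertex is named by the position at
   which it first occurs. *)
Definition glued_ears (D : amalgam) : seq (ear (nat * nat)%type) :=
  let add es E g := glue_vertices es (ear_shape E) (ear_size E) g in
  foldl (fun es Eg => add es Eg.1 Eg.2)
    (add [::] (first_ear D) Glue0) (later_ears D).

Definition raag_ear_decomposition (Gamma : sgraph) (D : amalgam) : Prop :=
  [/\ amalgam_wf D, isog (amalgam_group D) (raag Gamma) &
      ear_decomposition (glued_ears D)].

Definition proper_raag_ear_decomposition (Gamma : sgraph) (D : amalgam) : Prop :=
  raag_ear_decomposition Gamma D /\ is_proper (glued_ears D).

(* Main.v *)
(** Idea.  For every vertex [v], the group [A(Gamma)] acts on the Cayley tree of
    the free group on the cosets of [A(link v)] (the Bass-Serre tree of the HNN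
    extension with stable letter [v]).  If [x] has no fixed point there, all
    commutators of elements of the centralizer of [x] fix an edge of its axis, so
    they are conjugate into [A(link v)].  In an ear, distinct links share at most
    one vertex (except in [C_3], which is abelian, and in [C_4], which is treated
    apart), so an element with nonabelian centralizer is conjugate to a power of a
    vertex.  It follows that the pearls of any pearl chain generate the ear RAAG
    modulo commutators and squares; by counting, homomorphisms to the group with
    two elements may be prescribed freely on the pearls.

    An amalgam with group [A(Gamma)] thus yields elements of [A(Gamma)], one for
    each vertex of the glued graph, which are free generators modulo 2 and commute
    along edges.  Suppose that removing at most one vertex [s] separates [Gamma]
    into parts [A] and [B].  Commuting elements [g], [h] satisfy
    [g_a h_b = g_b h_a] for the coordinates modulo 2 at [a] in [A], [b] in [B].
    Hence along an edge between two elements not supported on [s], the vanishing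
    of the [A]- and of the [B]-part is preserved, and so are the parts themselves if
    both are nonzero.  At most one element is supported on [s], and the glued graph,
    being a union of ears, stays connected without it; so these data are constant,
    which contradicts generation.

    Conversely, Whitney's ear decomposition of a 2-connected [Gamma], with the
    standard generators as pearls, gives an amalgam with the universal property of
    [A(Gamma)]. *)

From HB Require Import structures.
Require Import Defs.
From mathcomp Require Import boolp classical_sets.
From mathcomp Require Import all_boot zify ssralg ssrint.

Set Implicit Arguments.
Unset Strict Implicit.
Unset Printing Implicit Defensive.

Import GRing.Theory.

Local Open Scope classical_set_scope.
Local Open Scope quotient_scope.
Local Open Scope group_scope.

(** * Homomorphisms and universal properties *)

(** The vertices to which the inner pearls of a long chain are conjugate come with a priori
    unrelated conjugators, so a chain cannot just be replaced by the standard generators.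
    Homomorphisms to [B2] do not see conjugators, and what remains is linear algebra over the field
    with two elements: an ear has as many pearls as vertices, so pearls that span form a basis. The
    second obstacle is that the pushout need not contain its factors, because [Glue2] may force new
    relations. Amalgams are therefore studied only through homomorphisms out of them ([free_for],
    [amalgam_inv]), with a target that is left variable: [B2] for arbitrary pearl chains, every
    group for chains of vertices. The tree of [v] is made concrete by embedding the group in a
    semidirect product with the free group on the cosets of A(link v); an axis then is a sequence of
    prefixes of reduced words. The relation between coordinates of commuting elements comes from
    unitriangular 3 x 3 matrices modulo 2. Properness enters through the two distinct endpoints of a
    path: if one of them is removed, the ear still hangs on the other. *)

Section Morphisms.
Variables G H : groupType.

Definition mk_hom (f : G -> H) (fM : {morph f : x y / x * y}) :
  {multiplicative G -> H} := HB.pack f (isMultiplicative.Build G H f fM).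

Lemma hom1 (f : {multiplicative G -> H}) : f 1 = 1.
Proof. by apply: (@mulgI _ (f 1)); rewrite -gmulfM !mulg1. Qed.

Lemma homV (f : {multiplicative G -> H}) x : f x^-1 = (f x)^-1.
Proof. by apply: (@mulgI _ (f x)); rewrite -gmulfM !mulgV hom1. Qed.

Lemma homX (f : {multiplicative G -> H}) x n : f (x ^+ n) = f x ^+ n.
Proof. by elim: n => [|n IH]; rewrite ?expg0 ?hom1 // !expgS gmulfM IH. Qed.

Lemma homJ (f : {multiplicative G -> H}) x y : f (x ^ y) = f x ^ f y.
Proof. by rewrite !conjgE !gmulfM homV. Qed.

Lemma homR (f : {multiplicative G -> H}) x y : f [~ x, y] = [~ f x, f y].
Proof. by rewrite !commgEl gmulfM homV homJ. Qed.

Lemma hom_commute (f : {multiplicative G -> H}) x y :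
  commute x y -> commute (f x) (f y).
Proof. by move=> xy; rewrite /commute -!gmulfM xy. Qed.

End Morphisms.
Section Subgroups.
Variables G H : groupType.
Implicit Types (S T : set G) (x y z : G).

Lemma sub_gen S : S `<=` gen S.
Proof. by move=> x Sx K [_]; apply. Qed.

Lemma gen_subgroup S : is_subgroup (gen S).
Proof.
split=> [K [[]]|x y Sx Sy K sK|x Sx K sK] //.
- by have [[_ KM _] _] := sK; apply: KM; [apply: Sx|apply: Sy].
- by have [[_ _ KV] _] := sK; apply: KV; apply: Sx.
Qed.

Lemma gen_min S (K : set G) : is_subgroup K -> S `<=` K -> gen S `<=` K.
Proof. by move=> sK SK x; apply; split. Qed.

Lemma genS S T : S `<=` T -> gen S `<=` gen T.
Proof. by move=> ST; apply: gen_min (gen_subgroup T) _ => x /ST; apply: sub_gen. Qed.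

Lemma subgroupX (K : set G) x n : is_subgroup K -> K x -> K (x ^+ n).
Proof.
by move=> [K1 KM _] Kx; elim: n => [|n IH]; rewrite ?expg0 // expgS; apply: KM.
Qed.

Lemma cent_subgroup x : is_subgroup (cent x).
Proof.
split=> [|y z|y]; rewrite /cent/= /cent_pred; first by rewrite mulg1 mul1g.
- by move=> /eqP xy /eqP xz; apply/eqP; apply: commuteM.
- by move=> /eqP xy; apply/eqP; apply: commuteV.
Qed.

Lemma centP x y : cent x y <-> commute x y.
Proof. by rewrite /cent /= /cent_pred; split=> [/eqP|/eqP]. Qed.

Lemma ker_subgroup (f : {multiplicative G -> H}) :
  is_subgroup [set x | f x = 1].
Proof.
split=> [|x y /= fx fy|x /= fx] /=; rewrite ?hom1 //.
  by rewrite gmulfM fx fy mulg1.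
by rewrite homV fx invg1.
Qed.

Lemma preim_subgroup (f : {multiplicative G -> H}) (K : set H) :
  is_subgroup K -> is_subgroup [set x | K (f x)].
Proof.
move=> [K1 KM KV]; split=> [|x y /= fx fy|x /= fx] /=; rewrite ?hom1 //.
  by rewrite gmulfM; apply: KM.
by rewrite homV; apply: KV.
Qed.

Lemma equalizer_subgroup (f g : {multiplicative G -> H}) :
  is_subgroup [set x | f x = g x].
Proof.
split=> [|x y /= fx fy|x /= fx] /=; rewrite ?hom1 //.
  by rewrite !gmulfM fx fy.
by rewrite !homV fx.
Qed.

Lemma gen_hom_ext S (f g : {multiplicative G -> H}) :
  (forall x, S x -> f x = g x) -> forall x, gen S x -> f x = g x.
Proof. by move=> fg; apply: gen_min => //; apply: equalizer_subgroup. Qed.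

Lemma gen_ker S (f : {multiplicative G -> H}) :
  (forall x, S x -> f x = 1) -> forall x, gen S x -> f x = 1.
Proof. by move=> fg; apply: gen_min => //; apply: ker_subgroup. Qed.

Lemma gen_commute S T :
  (forall x y, S x -> T y -> commute x y) ->
  forall x y, gen S x -> gen T y -> commute x y.
Proof.
move=> ST x y Sx; move: y; apply: gen_min => [|y Ty].
  have [h1 hM hV] := cent_subgroup x.
  by split=> [|a b|a]; rewrite -!centP; auto.
apply: commute_sym; move: x Sx; apply: gen_min => [|x Sx].
  have [h1 hM hV] := cent_subgroup y.
  by split=> [|a b|a]; rewrite -!centP; auto.
exact/commute_sym/ST.
Qed.

End Subgroups.

Lemma gen_image (G H : groupType) (S : set G) (f : {multiplicative G -> H}) x :
  gen S x -> gen (f @` S) (f x).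
Proof.
apply: (@gen_min _ S [set x | gen (f @` S) (f x)]).
  exact/preim_subgroup/gen_subgroup.
by move=> y Sy /=; apply: sub_gen; exists y.
Qed.

(* [x ^+ k] for an integer exponent, the sign being given by [b] *)
Definition spow (G : groupType) (x : G) (b : bool) (k : nat) : G :=
  if b then x ^- k else x ^+ k.

Lemma gen1P (G : groupType) (x y : G) :
  gen [set x] y <-> exists b k, y = spow x b k.
Proof.
split; last first.
  case=> b [k ->]; have [_ _ gV] := gen_subgroup [set x].
  have gk : gen [set x] (x ^+ k).
    by apply: subgroupX (gen_subgroup _) _; apply: sub_gen.
  by rewrite /spow; case: b => //; apply: gV.
move: y; apply: gen_min => [|y ->]; last by exists false, 1%N.
split=> [|y z [b [k ->]] [c [l ->]]|y [b [k ->]]].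
- by exists false, 0%N.
- rewrite /spow; case: b c => -[].
  + exists true, (l + k)%N; rewrite /spow expgnDr invgM //.
  + case: (leqP k l) => kl.
      exists false, (l - k)%N; rewrite /spow; apply: (@mulgI _ (x ^+ k)).
      by rewrite mulgA mulgV mul1g -expgnDr subnKC.
    exists true, (k - l)%N; rewrite /spow; apply: (@mulgI _ (x ^+ k)).
    by rewrite mulgA mulgV mul1g -{1}(subnKC (ltnW kl)) expgnDr mulgK.
  + case: (leqP l k) => kl.
      exists false, (k - l)%N; rewrite /spow.
      by rewrite -{1}(subnK kl) expgnDr mulgK.
    exists true, (l - k)%N; rewrite /spow.
    by rewrite -{1}(subnK (ltnW kl)) expgnDr invgM mulgA mulgV mul1g.
  + by exists false, (k + l)%N; rewrite /spow expgnDr.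
- by exists (~~ b), k; rewrite /spow; case: b; rewrite ?invgK.
Qed.

Section QuotientUniversal.
Variables (G : groupType) (S : set G).

Lemma quotg_pi_morph : {morph quotg_pi S : x y / x * y}.
Proof. by move=> x y; rewrite -[RHS]/(quotg_mul _ _) quotg_piM. Qed.

Definition quot_hom : {multiplicative G -> G // S} := mk_hom quotg_pi_morph.

Lemma quot_homE x : quot_hom x = quotg_pi S x. Proof. by []. Qed.

Lemma quotg_pi_sur (x : G // S) : exists y, x = quotg_pi S y.
Proof. by exists (repr x); rewrite quotg_reprK. Qed.

Lemma quotg_pi_rel x : S x -> quotg_pi S x = 1.
Proof.
move=> Sx; apply/esym/quotg_piP; rewrite invg1 mul1g.
by move=> N [_]; apply.
Qed.

Variable H : groupType.

Lemma quot_lift (f : {multiplicative G -> H}) :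
  (forall x, S x -> f x = 1) ->
  exists g : {multiplicative G // S -> H}, forall x, g (quotg_pi S x) = f x.
Proof.
move=> fS.
have fpi x y : quotg_pi S x = quotg_pi S y -> f x = f y.
  move/quotg_piP => /(_ [set z | f z = 1]) /=.
  rewrite gmulfM homV => h; apply: (mulgI (f x)^-1); rewrite mulVg.
  apply/esym/h; split=> //; split; first exact: ker_subgroup.
  by move=> a b /= fa; rewrite homJ fa conj1g.
have fM : {morph (fun x : G // S => f (repr x)) : x y / x * y}.
  move=> x y; rewrite -gmulfM; apply: fpi.
  by rewrite quotg_reprK -quot_homE gmulfM !quot_homE !quotg_reprK.
by exists (mk_hom fM) => x; apply: fpi; rewrite quotg_reprK.
Qed.

Lemma quot_ext (f g : {multiplicative G // S -> H}) :
  (forall x, f (quotg_pi S x) = g (quotg_pi S x)) -> f =1 g.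
Proof. by move=> fg x; rewrite -(quotg_reprK x). Qed.

End QuotientUniversal.

Section FreeUniversal.
Variables (T : choiceType) (G : groupType).

Definition letter_eval (f : T -> G) (a : T * bool) : G :=
  if a.2 then (f a.1)^-1 else f a.1.

Definition word_eval (f : T -> G) (w : seq (T * bool)) : G :=
  \prod_(a <- w) letter_eval f a.

Lemma word_eval_cat f u v : word_eval f (u ++ v) = word_eval f u * word_eval f v.
Proof. by rewrite /word_eval big_cat. Qed.

Lemma word_eval_eq f u v : free_eq u v -> word_eval f u = word_eval f v.
Proof.
elim=> [{}u x b {}v|//|{}u {}v _ -> //|{}u {}v w _ -> _ -> //].
rewrite !word_eval_cat; congr (_ * _); rewrite /word_eval !big_cons mulgA.
by rewrite /letter_eval; case: b => /=; rewrite ?mulVg ?mulgV mul1g.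
Qed.

Lemma free_lift_morph f :
  {morph (fun x : free_group T => word_eval f (repr x)) : x y / x * y}.
Proof.
move=> x y; rewrite -word_eval_cat; apply: word_eval_eq.
by apply/word_classP; rewrite word_classK.
Qed.

Fact free_lift_subproof f :
  {g : {multiplicative free_group T -> G} |
    forall w, g (word_class w) = word_eval f w}.
Proof.
exists (mk_hom (free_lift_morph f)) => w.
by apply/word_eval_eq/word_classP; rewrite word_classK.
Qed.

Definition free_lift f : {multiplicative free_group T -> G} :=
  sval (free_lift_subproof f).

Lemma free_lift_class f w : free_lift f (word_class w) = word_eval f w.
Proof. exact: (svalP (free_lift_subproof f)). Qed.

Lemma free_lift_gen f x : free_lift f (free_gen x) = f x.
Proof. by rewrite free_lift_class /word_eval big_seq1. Qed.

End FreeUniversal.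

Lemma word_class_cat (T : choiceType) (u v : seq (T * bool)) :
  word_class (u ++ v) = word_class u * word_class v.
Proof. by rewrite -[RHS]/(free_mul _ _) free_mulE. Qed.

Lemma word_class_inv (T : choiceType) (u : seq (T * bool)) :
  word_class (word_inv u) = (word_class u)^-1.
Proof. by rewrite -[RHS]/(free_inv _) free_invE. Qed.

Lemma free_genV (T : choiceType) (x : T) : word_class [:: (x, true)] = (free_gen x)^-1.
Proof. by rewrite -word_class_inv. Qed.

Lemma free_gen_ind (T : choiceType) (K : set (free_group T)) :
  is_subgroup K -> (forall x, K (free_gen x)) -> forall x, K x.
Proof.
move=> [K1 KM KV] Kg x; rewrite -(word_classK x); elim: (repr x) => // -[y b] w IH.
rewrite (word_class_cat [:: _]); apply: KM => //.
by case: b; rewrite ?free_genV; [apply: KV|]; apply: Kg.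
Qed.

Lemma free_ext (T : choiceType) (G : groupType)
    (f g : {multiplicative free_group T -> G}) :
  (forall x, f (free_gen x) = g (free_gen x)) -> f =1 g.
Proof.
by move=> fg x; move: x; apply: free_gen_ind => //; apply: equalizer_subgroup.
Qed.

Section FreeProductUniversal.
Variables G H : groupType.

Lemma inj_l_morph : {morph @inj_l G H : x y / x * y}.
Proof.
move=> x y; apply: divg1_eq; pose i z : free_group (G + H)%type := free_gen (inl z).
have : quot_hom (@free_prod_rel G H) (i (x * y) / (i x * i y)) = 1.
  by rewrite quot_homE quotg_pi_rel //; left; exists x, y.
by rewrite gmulfM homV gmulfM.
Qed.

Lemma inj_r_morph : {morph @inj_r G H : x y / x * y}.
Proof.
move=> x y; apply: divg1_eq; pose i z : free_group (G + H)%type := free_gen (inr z).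
have : quot_hom (@free_prod_rel G H) (i (x * y) / (i x * i y)) = 1.
  by rewrite quot_homE quotg_pi_rel //; right; exists x, y.
by rewrite gmulfM homV gmulfM.
Qed.

Definition injl_hom : {multiplicative G -> free_prod G H} := mk_hom inj_l_morph.
Definition injr_hom : {multiplicative H -> free_prod G H} := mk_hom inj_r_morph.

Variable K : groupType.

Lemma free_prod_lift (f : {multiplicative G -> K}) (g : {multiplicative H -> K}) :
  exists h : {multiplicative free_prod G H -> K},
    (forall x, h (inj_l H x) = f x) /\ (forall y, h (inj_r G y) = g y).
Proof.
pose k : {multiplicative free_group (G + H)%type -> K} :=
  free_lift (fun u => match u with inl x => f x | inr y => g y end).
have [|h hk] := @quot_lift _ (@free_prod_rel G H) _ k.
  by move=> r [] [x [y ->]]; rewrite gmulfM homV gmulfM !free_lift_gen gmulfM mulgV.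
by exists h; split=> x; rewrite hk free_lift_gen.
Qed.

Lemma free_prod_ext (f g : {multiplicative free_prod G H -> K}) :
  (forall x, f (inj_l H x) = g (inj_l H x)) ->
  (forall y, f (inj_r G y) = g (inj_r G y)) -> f =1 g.
Proof.
move=> fl fr; apply: quot_ext => x.
pose p := quot_hom (@free_prod_rel G H).
have := @free_ext _ _ (f \o p) (g \o p).
by apply=> -[y|y] /=; [apply: fl|apply: fr].
Qed.

End FreeProductUniversal.

Section Isog.
Implicit Types G H K : groupType.

Lemma isogP G H : isog G H <->
  exists (f : {multiplicative G -> H}) (g : {multiplicative H -> G}),
    cancel f g /\ cancel g f.
Proof.
split=> [[f [g fg gf]]|[f [g [fg gf]]]]; last by exists f; exists g.
by exists f, (mk_hom (can2_gmulfM fg gf)).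
Qed.

Lemma isog_refl G : isog G G.
Proof. by apply/isogP; exists idfun, idfun. Qed.

Lemma isog_sym G H : isog G H -> isog H G.
Proof. by move=> /isogP [f [g [fg gf]]]; apply/isogP; exists g, f. Qed.

End Isog.

Section RaagUniversal.
Variable Gamma : sgraph.
Notation A := (raag Gamma).

Definition vtx (v : Gamma) : A := quotg_pi (@raag_rel Gamma) (free_gen v).

Lemma vtx_commute v w : adj v w -> commute (vtx v) (vtx w).
Proof.
move=> vw; apply/commgP/eqP; rewrite /vtx -!quot_homE -homR.
by rewrite quot_homE quotg_pi_rel //; exists v, w.
Qed.

Lemma raag_lift (G : groupType) (f : Gamma -> G) :
  (forall v w, adj v w -> commute (f v) (f w)) ->
  exists g : {multiplicative A -> G}, forall v, g (vtx v) = f v.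
Proof.
move=> fc; have [|g gE] := @quot_lift _ (@raag_rel Gamma) _ (free_lift f).
  move=> r [v [w [vw ->]]]; rewrite homR !free_lift_gen.
  exact/eqP/commgP/fc.
by exists g => v; rewrite gE free_lift_gen.
Qed.

Lemma raag_ind (K : set A) : is_subgroup K -> (forall v, K (vtx v)) -> forall x, K x.
Proof.
move=> sK Kv x; have [y ->] := quotg_pi_sur x.
have := @free_gen_ind _ _ (preim_subgroup (quot_hom (@raag_rel Gamma)) sK).
by apply.
Qed.

Lemma raag_ext (G : groupType) (f g : {multiplicative A -> G}) :
  (forall v, f (vtx v) = g (vtx v)) -> f =1 g.
Proof. by move=> fg x; move: x; apply: raag_ind => //; apply: equalizer_subgroup. Qed.

End RaagUniversal.

(** * Reduced words in free groups *)

Lemma eq_rel_sorted (T : Type) (e e' : rel T) : e =2 e' -> sorted e =1 sorted e'.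
Proof. by move=> ee' [|x s] //=; apply: eq_path. Qed.

Section ReducedWords.
Variable T : choiceType.
Implicit Types (a b : T * bool) (u v w : seq (T * bool)) (x y : free_group T).

Definition inv_letter a := (a.1, ~~ a.2).

Lemma inv_letterK : involutive inv_letter.
Proof. by case=> t b; rewrite /inv_letter /= negbK. Qed.

Lemma inv_letter_neq a : inv_letter a != a.
Proof. by case: a => t [] /=; apply/eqP => -[]. Qed.

Definition no_cancel : rel (T * bool) := fun a b => b != inv_letter a.

Definition reduced w := sorted no_cancel w.

Definition push a w :=
  if w is b :: w' then if b == inv_letter a then w' else a :: w else [:: a].

Definition reduce w := foldr push [::] w.

Lemma reduced_push a w : reduced w -> reduced (push a w).
Proof.
case: w => // b w rw; rewrite /push; case: ifPn => // ab; last by apply/andP.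
exact: path_sorted rw.
Qed.

Lemma reduce_reduced w : reduced (reduce w).
Proof. by elim: w => //= a w; apply: reduced_push. Qed.

Lemma pushK a w : reduced w -> push a (push (inv_letter a) w) = w.
Proof.
case: w => [_|b w rw] /=; first by rewrite eqxx.
rewrite inv_letterK; case: eqP rw => [->|_] /=; last by rewrite eqxx.
case: w => //= c w /andP[]; rewrite /no_cancel => /negPf -> //.
Qed.

Lemma free_eq_reduce w : free_eq w (reduce w).
Proof.
elim: w => [|a w IH]; first exact: FreeRefl.
apply: (@FreeTrans _ _ (a :: reduce w)).
  exact: (@free_eq_cat _ [:: a] [:: a] _ _ (FreeRefl _) IH).
rewrite /=; case: (reduce w) => [|b w'] /=; first exact: FreeRefl.
case: eqP => [->|_]; last exact: FreeRefl.
by case: a => t e; apply: (FreeCancel [::]).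
Qed.

Lemma reduce_eq u v : free_eq u v -> reduce u = reduce v.
Proof.
elim=> [{}u x b {}v|//|{}u {}v _ -> //|{}u {}v w _ -> _ -> //].
rewrite /reduce !foldr_cat /= -/(inv_letter (x, b)) pushK //.
exact: reduce_reduced.
Qed.

Lemma reduce_id w : reduced w -> reduce w = w.
Proof.
elim: w => //= a [|b w] // IH /= /andP[ab rw].
by move: (IH rw) => /= ->; rewrite /= (negPf ab).
Qed.

Definition nf x := reduce (repr x).

Lemma nfK x : word_class (nf x) = x.
Proof.
rewrite -[RHS]word_classK; apply/word_classP/FreeSym/free_eq_reduce.
Qed.

Lemma nf_reduced x : reduced (nf x). Proof. exact: reduce_reduced. Qed.

Lemma nf_class w : reduced w -> nf (word_class w) = w.
Proof.
move=> rw; rewrite -[RHS](reduce_id rw); apply: reduce_eq.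
by apply/word_classP; rewrite word_classK.
Qed.

Lemma nf1 : nf 1 = [::].
Proof. exact: (@nf_class [::]). Qed.

Lemma reduced_cat u v :
  reduced (u ++ v) = [&& reduced u, reduced v &
    if u is a :: u' then if v is b :: _ then no_cancel (last a u') b else true
    else true].
Proof.
rewrite /reduced; case: u => [|a u]; first by rewrite andbT.
case: v => [|b v]; first by rewrite cats0 !andbT.
by rewrite /= cat_path /=; case: (path _ a u) => //=; rewrite andbC.
Qed.

Lemma word_inv_cat u v : word_inv (u ++ v) = word_inv v ++ word_inv u.
Proof. by rewrite /word_inv map_cat rev_cat. Qed.

Lemma size_word_inv u : size (word_inv u) = size u.
Proof. by rewrite /word_inv size_rev size_map. Qed.

(** Cancellation happens only at the seam, whence the induction on [u] from its last letter. *)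
Lemma reduced_cancel u v : reduced u -> reduced v ->
  exists u1 p v1, [/\ u = u1 ++ p, v = word_inv p ++ v1 & reduced (u1 ++ v1)].
Proof.
elim/last_ind: u v => [|u a IH] v ru rv; first by exists [::], [::], v.
case: v rv => [|b v] rv; first by exists (rcons u a), [::], [::]; rewrite !cats0.
have [ab|ab] := boolP (no_cancel a b).
  exists (rcons u a), [::], (b :: v); rewrite cats0; split=> //.
  rewrite reduced_cat ru rv /=; case: u {IH ru} => //= c u.
  by rewrite last_rcons.
have ru' : reduced u by move: ru; rewrite -cats1 reduced_cat => /and3P[].
have [u1 [p [v1 [-> -> r1]]]] := IH v ru' (path_sorted rv).
exists u1, (rcons p a), v1; split=> //; first by rewrite rcons_cat.
move: ab; rewrite negbK => /eqP ->.
by rewrite -cats1 word_inv_cat.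
Qed.

Lemma nf_mul_reduced x y : reduced (nf x ++ nf y) -> nf (x * y) = nf x ++ nf y.
Proof. by move=> r; rewrite -(nf_class r) word_class_cat !nfK. Qed.

Lemma nf_mul x y : exists u1 p v1,
  [/\ nf x = u1 ++ p, nf y = word_inv p ++ v1 & nf (x * y) = u1 ++ v1].
Proof.
have [u1 [p [v1 [xE yE r]]]] := reduced_cancel (nf_reduced x) (nf_reduced y).
exists u1, p, v1; split=> //.
rewrite -{1}(nfK x) -{1}(nfK y) xE yE -(nf_class r); congr nf.
by rewrite !word_class_cat word_class_inv mulgA mulgK.
Qed.

(** In the Cayley tree: left multiplication by [x] maps the path from 1 to [y], beyond its cancelled
    part, onto the end of the path from 1 to [x * y]. *)
Lemma nf_take_mul x y u1 p v1 i : nf x = u1 ++ p -> nf y = word_inv p ++ v1 ->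
  size p <= i ->
  x * word_class (take i (nf y)) = word_class (take (size u1 + (i - size p)) (u1 ++ v1)).
Proof.
move=> xE yE pi; rewrite -{1}(nfK x) xE yE !take_cat size_word_inv ltnNge pi /=.
rewrite ltnNge leq_addr /= addKn !word_class_cat word_class_inv.
by rewrite mulgA mulgK.
Qed.

Lemma nf_gen (t : T) (b : bool) n : nf (word_class (nseq n (t, b))) = nseq n (t, b).
Proof.
apply: nf_class; case: n => //= n; elim: n => //= n ->.
by rewrite andbT /no_cancel eq_sym inv_letter_neq.
Qed.

Lemma free_genX (t : T) n : free_gen t ^+ n = word_class (nseq n (t, false)).
Proof.
by elim: n => // n IH; rewrite expgS IH -word_class_cat.
Qed.

(** Induction on the length of [x]. A letter [t] or its inverse at either end of [x] can be stripped
    off. If there is none, both products with the power of [t] are reduced as they stand, and their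
    first letters differ. *)
Lemma commute_free_gen (t : T) n x : commute x (free_gen t ^+ n.+1) ->
  gen [set free_gen t] x.
Proof.
have [h1 hM hV] := gen_subgroup [set free_gen t].
have ht : gen [set free_gen t] (free_gen t) by apply: sub_gen.
have comt : commute (free_gen t) (free_gen t ^+ n.+1).
  exact/commuteX/commute_refl.
have hl (b : bool) : gen [set free_gen t] (word_class [:: (t, b)]).
  by case: b => //; rewrite free_genV; apply: hV.
have cl (b : bool) : commute (word_class [:: (t, b)]) (free_gen t ^+ n.+1).
  by case: b => //; rewrite free_genV; apply/commute_sym/commuteV/commute_sym.
move: {2}(size (nf x)) (leqnn (size (nf x))) => m; elim: m x => [|m IH] x.
  by rewrite leqn0 size_eq0 => /eqP xE _; rewrite -(nfK x) xE.
move=> sx cx; have rx := nf_reduced x; have xE := nfK x.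
case w0: (nf x) => [|[s b] w]; first by rewrite -xE w0; apply: h1.
case: (eqVneq s t) => [st|st].
  subst s; have xE' : x = word_class [:: (t, b)] * word_class w.
    by rewrite -xE w0 -word_class_cat.
  rewrite xE'; apply: hM => //; apply: IH.
    rewrite nf_class; first by move: sx; rewrite w0.
    by move: rx; rewrite w0 => /path_sorted.
  apply: (mulgI (word_class [:: (t, b)])).
  by rewrite mulgA -xE' cx xE' !mulgA (cl b).
have := rx; case/lastP w1: (nf x) => [|w' [s' b']]; first by rewrite w0 in w1.
move=> rx'; case: (eqVneq s' t) => [st'|st'].
  subst s'; have xE' : x = word_class w' * word_class [:: (t, b')].
    by rewrite -xE w1 -word_class_cat cats1.
  rewrite xE'; apply: hM => //; apply: IH.
    rewrite nf_class; first by move: sx; rewrite w1 size_rcons.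
    by move: rx'; rewrite -cats1 reduced_cat => /and3P[].
  apply: (mulIg (word_class [:: (t, b')])).
  by rewrite -mulgA -(cl b') mulgA -xE' cx xE' !mulgA.
have rn : reduced (nseq n.+1 (t, false)).
  by rewrite -nf_gen nf_reduced.
move: cx; rewrite /commute free_genX -{1 2}xE -!word_class_cat => /(congr1 nf).
rewrite !nf_class.
- by rewrite {1}w0 /= => -[] ts; rewrite ts eqxx in st.
- rewrite reduced_cat rn rx /= w0 /=.
  by rewrite /no_cancel; apply: contra st => /eqP[-> _]; elim: (n) => //=.
- rewrite reduced_cat rn rx /= w1.
  case: (w') => [|c w2] /=; rewrite ?last_rcons /no_cancel.
    by apply: contra st' => /eqP[<- _].
  by apply: contra st' => /eqP[<- _].
Qed.

Definition act_letter (s : T -> T) a := (s a.1, a.2).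

Definition free_map (s : T -> T) : {multiplicative free_group T -> free_group T} :=
  free_lift (fun t => free_gen (s t)).

Lemma free_map_class s w : free_map s (word_class w) = word_class (map (act_letter s) w).
Proof.
elim: w => [|[t b] w IH]; first by rewrite (hom1 (free_map s)).
rewrite [map _ _]/= (word_class_cat [:: (t, b)]) gmulfM IH.
rewrite (word_class_cat [:: act_letter s (t, b)]); congr (_ * _).
by case: b; rewrite ?free_genV ?homV /free_map free_lift_gen.
Qed.

Lemma nf_free_map s x : injective s -> nf (free_map s x) = map (act_letter s) (nf x).
Proof.
move=> sI; rewrite -{1}(nfK x) free_map_class nf_class // /reduced sorted_map.
have -> : sorted (relpre (act_letter s) no_cancel) (nf x) = reduced (nf x).
  apply: eq_rel_sorted => -[t b] [t' b'].
  by rewrite /= /no_cancel /act_letter /inv_letter /= !xpair_eqE (inj_eq sI).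
exact: nf_reduced.
Qed.

End ReducedWords.

Lemma infinite_cyclic_gen_eq1 n : ((1%R : infinite_cyclic) ^+ n = 1) -> n = 0%N.
Proof.
have -> : (1%R : infinite_cyclic) ^+ n = (n%:Z)%R.
  by elim: n => // n IH; rewrite expgS IH -[LHS]/(1 + n%:Z)%R -intS.
by case: n.
Qed.

(** The exponent sum of [s] is invariant under conjugation. *)
Lemma free_gen_conjX (T : choiceType) (s t : T) (x : free_group T) n :
  free_gen s ^+ n.+1 = (free_gen t ^+ n.+1) ^ x -> s = t.
Proof.
move=> /(congr1 (free_lift (fun u => if u == s then 1%R : infinite_cyclic else 1))).
rewrite homJ !homX !free_lift_gen eqxx; case: eqVneq => [-> //|_] /esym.
rewrite expg1n conj1g => /esym /infinite_cyclic_gen_eq1 //.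
Qed.

(** * Semidirect products with a free group *)

Record gaction (K : groupType) (Y : choiceType) := GAction {
  gact :> K -> Y -> Y;
  gact1 : forall t, gact 1 t = t;
  gactM : forall k l t, gact (k * l) t = gact k (gact l t) }.

(* The carrier does not mention the action, which determines the group structure. *)
Definition semidirect (K : groupType) (Y : choiceType) (a : gaction K Y) : Type :=
  (free_group Y * K)%type.

Section SemidirectGroup.
Variables (K : groupType) (Y : choiceType) (a : gaction K Y).

Definition fmap (k : K) : {multiplicative free_group Y -> free_group Y} :=
  free_map (a k).

Lemma fmap_gen k t : fmap k (free_gen t) = free_gen (a k t).
Proof. exact: free_lift_gen. Qed.

Lemma gact_inj k : injective (a k).
Proof. by apply: (@can_inj _ _ _ (a k^-1)) => t; rewrite -gactM mulVg gact1. Qed.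

Lemma fmap1 x : fmap 1 x = x.
Proof.
apply: (free_ext (f := fmap 1) (g := idfun)) => t.
by rewrite fmap_gen gact1.
Qed.

Lemma fmapM k l x : fmap (k * l) x = fmap k (fmap l x).
Proof.
apply: (free_ext (f := fmap (k * l)) (g := fmap k \o fmap l)) => t /=.
by rewrite !fmap_gen gactM.
Qed.

Local Notation semidirect := (semidirect a).

HB.instance Definition _ := Choice.copy semidirect (free_group Y * K)%type.

Definition sd_mul (x y : semidirect) : semidirect := (x.1 * fmap x.2 y.1, x.2 * y.2).
Definition sd_inv (x : semidirect) : semidirect := (fmap x.2^-1 x.1^-1, x.2^-1).
Definition sd_one : semidirect := (1, 1).

Lemma sd_mulA : associative sd_mul.
Proof. by move=> x y z; rewrite /sd_mul /= gmulfM fmapM !mulgA. Qed.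
Lemma sd_mul1g : left_id sd_one sd_mul.
Proof. by move=> [x k]; rewrite /sd_mul /= fmap1 !mul1g. Qed.
Lemma sd_mulg1 : right_id sd_one sd_mul.
Proof. by move=> [x k]; rewrite /sd_mul /= (hom1 (fmap k)) !mulg1. Qed.
Lemma sd_mulVg : left_inverse sd_one sd_inv sd_mul.
Proof. by move=> [x k]; rewrite /sd_mul /= -gmulfM !mulVg hom1. Qed.
Lemma sd_mulgV : right_inverse sd_one sd_inv sd_mul.
Proof. by move=> [x k]; rewrite /sd_mul /= -fmapM !mulgV fmap1 mulgV. Qed.

HB.instance Definition _ := isGroup.Build semidirect
  sd_mulA sd_mul1g sd_mulg1 sd_mulVg sd_mulgV.

Lemma sd_mulE (x y : semidirect) : x * y = (x.1 * fmap x.2 y.1, x.2 * y.2).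
Proof. by []. Qed.

Lemma sd_lift (G : groupType) (f : Y -> G) (g : {multiplicative K -> G}) :
  (forall k t, f (a k t) = g k * f t * (g k)^-1) ->
  exists h : {multiplicative semidirect -> G},
    forall x k, h (x, k) = free_lift f x * g k.
Proof.
move=> fa.
have fmapE k x : free_lift f (fmap k x) = g k * free_lift f x * (g k)^-1.
  have mc : {morph (fun y => g k * y * (g k)^-1) : y z / y * z}.
    by move=> y z; rewrite !mulgA mulgVK.
  apply: (free_ext (f := free_lift f \o fmap k) (g := mk_hom mc \o free_lift f)).
  by move=> t; rewrite /= fmap_gen !free_lift_gen fa.
have hM : {morph (fun x : semidirect => free_lift f x.1 * g x.2) : x y / x * y}.
  by move=> x y; rewrite sd_mulE /= !gmulfM fmapE !mulgA mulgVK.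
by exists (mk_hom hM).
Qed.

(* The action of the semidirect product on the vertices of the Cayley tree of
   the free group. *)
Definition tree_act (x : semidirect) (w : free_group Y) := x.1 * fmap x.2 w.

Lemma tree_actM x y w : tree_act (x * y) w = tree_act x (tree_act y w).
Proof. by rewrite /tree_act /= fmapM gmulfM mulgA. Qed.

Lemma tree_act1 x : tree_act x 1 = x.1.
Proof. by rewrite /tree_act (hom1 (fmap x.2)) mulg1. Qed.

Lemma tree_actVK x w : tree_act x^-1 (tree_act x w) = w.
Proof. by rewrite -tree_actM mulVg /tree_act /= fmap1 mul1g. Qed.

Lemma sd_conj1 (x : semidirect) s :
  (x ^ ((s, 1) : semidirect)).1 = s^-1 * (x.1 * fmap x.2 s).
Proof.
have sV : ((s, 1) : semidirect)^-1 = (s^-1, 1).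
  by rewrite -[LHS]/(sd_inv _) /sd_inv /= invg1 fmap1.
by rewrite conjgE sV sd_mulE /= fmap1.
Qed.

Lemma nf_fmap k x : nf (fmap k x) = map (act_letter (a k)) (nf x).
Proof. exact/nf_free_map/gact_inj. Qed.

(** The path from the origin to its image under [x] continues without backtracking into its own
    translate by [x]; thus [x] is hyperbolic with the origin on its axis. *)
Definition no_fold (x : semidirect) :=
  nf x.1 <> [::] /\ reduced (nf x.1 ++ nf (fmap x.2 x.1)).

(** Cyclic reduction twisted by the action: the seam to be inspected is between [x.1] and its
    translate by [x.2]. *)
Lemma sd_cyclic_reduction (x : semidirect) :
  exists g, (x ^ g).1 = 1 \/ no_fold (x ^ g).
Proof.
move: {2}(size (nf x.1)) (leqnn (size (nf x.1))) => m; elim: m x => [|m IH] x.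
  rewrite leqn0 size_eq0 => /eqP x0; exists 1; left.
  by rewrite conjg1 -(nfK x.1) x0.
move=> sx; case E: (nf x.1) => [|l w].
  by exists 1; left; rewrite conjg1 -(nfK x.1) E.
have rx := nf_reduced x.1.
case rr: (reduced (nf x.1 ++ nf (fmap x.2 x.1))).
  by exists 1; right; rewrite conjg1; split=> //; rewrite E.
move: rr; rewrite reduced_cat rx nf_reduced nf_fmap E /= => /negbT.
(* A one-letter [x.1] cannot cancel against its translate, since the action preserves the signs of
   letters: there are no inversions. *)
case/lastP: w E => [|w m'] E /=.
  rewrite negbK; case: l E => t b E; rewrite /act_letter /inv_letter /=.
  by case: b {E} => /eqP[].
rewrite last_rcons negbK => /eqP lm.
(* Conjugation by the first letter moves its translate to the end of the word, where it cancels the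
   last letter. *)
pose g : semidirect := (word_class [:: l], 1).
have xg : (x ^ g).1 = word_class w.
  have xE : x.1 = word_class [:: l] * (word_class w * word_class [:: m']).
    by rewrite -!word_class_cat cats1 /= -E nfK.
  rewrite sd_conj1 xE -!mulgA mulKg; apply/eqP.
  rewrite -[eqbRHS]mulg1; apply/eqP; congr (_ * _).
  rewrite /fmap free_map_class /= lm -(mulgV (word_class [:: m'])).
  by rewrite -word_class_inv; case: (m').
have [|h hP] := IH (x ^ g).
  rewrite xg nf_class; first by move: sx; rewrite E /= size_rcons => /ltnW.
  by move: rx; rewrite E => /path_sorted; rewrite -cats1 => /cat_sorted2[].
by exists (g * h); move: hP; rewrite -conjgM => hP; exact: hP.
Qed.

Section NoFold.
Variable x : semidirect.
Hypothesis xn : no_fold x.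

Lemma no_foldXS n : nf (x ^+ n.+1).1 = nf x.1 ++ nf (fmap x.2 (x ^+ n).1).
Proof.
have [x0 rx] := xn.
(* All nontrivial powers start with the first letter of [x.1], so each seam is the one that
   [no_fold] controls. *)
have hd : forall n, nf (x ^+ n).1 = [::] \/
    exists l w w', nf x.1 = l :: w /\ nf (x ^+ n).1 = l :: w'.
  elim=> [|m [IH|[l [w [w' [E1 E2]]]]]].
  - by left; rewrite expg0 nf1.
  - right; rewrite expgS /= -(nfK (x ^+ m).1) IH (hom1 (fmap _)) mulg1.
    by case: (nf x.1) x0 => // l w _; exists l, w, w.
  - right; rewrite expgS sd_mulE /= nf_mul_reduced.
      by rewrite E1 /=; exists l, w; eexists; split.
    by move: rx; rewrite !reduced_cat !nf_reduced !nf_fmap E2 E1 /=.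
rewrite expgS sd_mulE /= nf_mul_reduced //.
move: rx; rewrite !reduced_cat !nf_reduced !nf_fmap /=.
have [->|[l [w [w' [-> ->]]]]] := hd n; last by [].
by case: (nf x.1).
Qed.

Lemma size_no_foldX n : n <= size (nf (x ^+ n).1).
Proof.
elim: n => // n IH; rewrite no_foldXS size_cat nf_fmap size_map.
by rewrite -add1n leq_add //; case: xn; case: (nf x.1).
Qed.

(* The prefixes of the normal form of [x ^+ n] run along the axis of [x].  Comparing
   the normal forms of [y * x ^+ n] and [x ^+ n * y] shows that [y] shifts them. *)
Lemma no_fold_shift n y D : commute x y -> size (nf y.1) <= D ->
  let w := nf (x ^+ n).1 in
  exists p q, [/\ p <= D, q <= D & forall i, D <= i -> i + D + D <= size w ->
    tree_act y (word_class (take i w)) = word_class (take (p + (i - q)) w)].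
Proof.
move=> cxy sy w.
have [u1 [q [v1 [uE vE uvE]]]] := nf_mul y.1 (fmap y.2 (x ^+ n).1).
have [a1 [p [b1 [aE bE abE]]]] := nf_mul (x ^+ n).1 (fmap (x ^+ n).2 y.1).
have sq : size q + size u1 <= D by rewrite addnC -size_cat -uE.
have sp : size p <= D.
  apply: leq_trans sy; have := congr1 size bE.
  by rewrite nf_fmap size_map size_cat size_word_inv => ->; rewrite leq_addr.
exists (size u1), (size q); split.
- exact: leq_trans (leq_addl _ _) sq.
- exact: leq_trans (leq_addr _ _) sq.
move=> i Di iw.
have qi : size q <= i by apply: leq_trans Di; apply: leq_trans (leq_addr _ _) sq.
rewrite /tree_act /fmap free_map_class map_take -[map _ w]nf_fmap.
rewrite (nf_take_mul uE vE qi) -uvE.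
have -> : y.1 * fmap y.2 (x ^+ n).1 = (x ^+ n).1 * fmap (x ^+ n).2 y.1.
  have : y * x ^+ n = x ^+ n * y by apply/commuteX/commute_sym.
  by move=> /(congr1 fst).
(* The shifted index stays within [a1], the initial part of [x ^+ n] that survives right
   multiplication by [y]. *)
have j_le : size u1 + (i - size q) <= size a1.
  have : i + D + D <= size a1 + D.
    by apply: leq_trans iw _; rewrite /w aE size_cat leq_add2l.
  rewrite leq_add2r; apply: leq_trans; rewrite addnC leq_add ?leq_subr //.
  exact: leq_trans (leq_addl _ _) sq.
by rewrite abE /w aE !takel_cat.
Qed.

(** Both [y] and [z] shift the middle of the axis, and shifts commute, so the commutator fixes two
    neighbouring vertices there. *)
Lemma no_fold_commutator y z : commute x y -> commute x z ->
  exists g k t, [~ y, z] ^ g = (1, k) /\ a k t = t.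
Proof.
move=> cy cz; pose D := maxn (size (nf y.1)) (size (nf z.1)).
(* The indices [2 * D] and [2 * D + 1] move by at most [D] under the first of two shifts, hence lie
   between [D] and [3 * D + 1] before the second, and [no_fold_shift] asks for [2 * D] more letters
   to the right. *)
pose n := (5 * D + 2)%N; pose w := nf (x ^+ n).1.
have [p [q [pD qD yP]]] := no_fold_shift n cy (leq_maxl _ _ : _ <= D).
have [p' [q' [pD' qD' zP]]] := no_fold_shift n cz (leq_maxr _ _ : _ <= D).
have nw : n <= size w := size_no_foldX n.
have fixw i : 2 * D <= i -> i <= 2 * D + 1 ->
    tree_act [~ y, z] (word_class (take i w)) = word_class (take i w).
  move=> iD iD1.
  have : tree_act (y * z) (word_class (take i w)) =
         tree_act (z * y) (word_class (take i w)).
    rewrite !tree_actM (zP i) 1?(yP i) ?yP ?zP; try (rewrite /n -/w in nw *; lia).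
    by congr (word_class (take _ _)); lia.
  rewrite [y * z]commgC (tree_actM (z * y)).
  by move=> /(congr1 (tree_act (z * y)^-1)); rewrite !tree_actVK.
pose i := (2 * D)%N; have iw : i < size w by apply: leq_trans nw; rewrite /i /n; lia.
(* [g] carries the origin and its neighbour along the letter [t] to the two fixed vertices, so
   conjugation by [g] brings the fixed edge to the origin. *)
pose g : semidirect := (word_class (take i w), 1).
have w1 : tree_act g 1 = word_class (take i w) by rewrite tree_act1.
case w_drop: (drop i w) => [|[t b] w'].
  by move: (congr1 size w_drop); rewrite size_drop /=; lia.
have w2 : tree_act g (word_class [:: (t, b)]) = word_class (take i.+1 w).
  rewrite /tree_act /= fmap1 -word_class_cat; congr word_class.
  rewrite -addn1 takeD w_drop /= ?take0 //.
have c1 : ([~ y, z] ^ g).1 = 1.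
  by rewrite -tree_act1 conjgE (tree_actM g^-1) (tree_actM [~ y, z]) w1 fixw ?leq_addr // -w1 tree_actVK.
have c2 : tree_act ([~ y, z] ^ g) (word_class [:: (t, b)]) = word_class [:: (t, b)].
  rewrite conjgE (tree_actM g^-1) (tree_actM [~ y, z]) w2 fixw; first by rewrite -w2 tree_actVK.
    by rewrite /i; lia.
  by rewrite /i; lia.
exists g, ([~ y, z] ^ g).2, t; split; first by move: c1; case: ([~ y, z] ^ g) => u k /= ->.
move: c2; rewrite /tree_act c1 mul1g => /(congr1 (@nf Y)).
by rewrite nf_fmap !nf_class //= => -[].
Qed.

End NoFold.

(** The first alternative says that [x] fixes the vertex to which [g] moves the origin. Otherwise a
    conjugate of [x] satisfies [no_fold], and the conjugator is absorbed in [g]. *)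
Lemma sd_dichotomy (x : semidirect) :
  (exists g k, x ^ g = (1, k)) \/
  (forall y z, commute x y -> commute x z ->
   exists g k t, [~ y, z] ^ g = (1, k) /\ a k t = t).
Proof.
have [g [x1|xn]] := sd_cyclic_reduction x.
  by left; exists g, (x ^ g).2; move: x1; case: (x ^ g) => u k /= ->.
right=> y z cy cz.
have cJ u : commute x u -> commute (x ^ g) (u ^ g).
  by rewrite /commute -!conjMg => ->.
have [h [k [t [E tk]]]] := no_fold_commutator xn (cJ _ cy) (cJ _ cz).
by exists (g * h), k, t; rewrite conjgM conjRg.
Qed.

End SemidirectGroup.

(** * The action on the left cosets of a subgroup *)

Section Cosets.
Variables (G : groupType) (L : set G) (sL : is_subgroup L).

(* The proof argument lets the canonical equivalence be found for [lcoset_rel sL]. *)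
Definition lcoset_rel (_ : is_subgroup L) : rel G := fun x y => `[< L (x^-1 * y) >].

Lemma lcoset_rel_equiv : equiv_class_of (lcoset_rel sL).
Proof.
have [L1 LM LV] := sL.
split=> [x|x y|y x z].
- by apply/asboolP; rewrite mulVg.
- by apply/asboolP/asboolP => /LV; rewrite invgM invgK.
- move=> /asboolP Lxy /asboolP Lyz; apply/asboolP.
  by have := LM _ _ Lxy Lyz; rewrite mulgA mulgK.
Qed.

Canonical lcoset_equiv := EquivRelPack lcoset_rel_equiv.

Definition lcosets := {eq_quot lcoset_rel sL}.

HB.instance Definition _ := Choice.copy lcosets {eq_quot lcoset_rel sL}.

Definition lcoset_pi (x : G) : lcosets := \pi_lcosets x.

Lemma lcoset_piP x y : lcoset_pi x = lcoset_pi y <-> L (x^-1 * y).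
Proof.
split=> [/eqP|Lxy]; first by rewrite /lcoset_pi eqmodE => /asboolP.
by apply/eqP; rewrite /lcoset_pi eqmodE; apply/asboolP.
Qed.

Lemma lcoset_reprK (t : lcosets) : lcoset_pi (repr t) = t.
Proof. exact: reprK. Qed.

Variables (K : groupType) (r : {multiplicative K -> G}).

Definition lcoset_act (k : K) (t : lcosets) := lcoset_pi (r k * repr t).

Lemma lcoset_actE k x : lcoset_act k (lcoset_pi x) = lcoset_pi (r k * x).
Proof.
apply/lcoset_piP; rewrite invgM -mulgA mulKg.
by apply/lcoset_piP; rewrite lcoset_reprK.
Qed.

Lemma lcoset_act1 t : lcoset_act 1 t = t.
Proof. by rewrite -(lcoset_reprK t) lcoset_actE hom1 mul1g. Qed.

Lemma lcoset_actM k l t : lcoset_act (k * l) t = lcoset_act k (lcoset_act l t).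
Proof. by rewrite -(lcoset_reprK t) !lcoset_actE gmulfM mulgA. Qed.

Definition lcoset_action := GAction lcoset_act1 lcoset_actM.

End Cosets.

(** * Parabolic subgroups and centralizers in RAAGs *)

Section Parabolic.
Variable Gamma : sgraph.
Notation A := (raag Gamma).
Implicit Types (S T : {set Gamma}) (u v w : Gamma) (x y z g : A).

Definition par S : set A := gen [set x | exists2 v, v \in S & x = vtx v].

Definition link v : {set Gamma} := [set u | adj v u].

Lemma par_subgroup S : is_subgroup (par S).
Proof. exact: gen_subgroup. Qed.

Lemma par_vtx S v : v \in S -> par S (vtx v).
Proof. by move=> vS; apply: sub_gen; exists v. Qed.

Lemma par_min S (K : set A) : is_subgroup K -> (forall v, v \in S -> K (vtx v)) ->
  par S `<=` K.
Proof. by move=> sK Kv; apply: gen_min => // x [v vS ->]; apply: Kv. Qed.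

Lemma parS S T x : S \subset T -> par S x -> par T x.
Proof.
move=> /subsetP ST; apply: (par_min (par_subgroup T)) => v /ST; exact: par_vtx.
Qed.

Lemma par_set0 x : par set0 x -> x = 1.
Proof.
apply: (@par_min _ [set x : A | x = 1]); last by move=> v; rewrite inE.
by split=> [|a b -> ->|a ->] /=; rewrite ?mulg1 ?invg1.
Qed.

Lemma par_set1P v x : par [set v] x <-> exists b k, x = spow (vtx v) b k.
Proof.
rewrite -gen1P /par; suff -> : [set x | exists2 u, u \in [set v]%SET & x = vtx u] =
  [set vtx v] by [].
apply/seteqP; split=> [y [u]|y ->]; last by exists v; rewrite ?inE.
by rewrite inE => /eqP ->.
Qed.

Lemma retr_exists S : exists r : {multiplicative A -> A},
  forall v, r (vtx v) = if v \in S then vtx v else 1.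
Proof.
apply: raag_lift => v w vw; case: ifP => _; case: ifP => _.
- exact: vtx_commute.
- exact: commute1.
- exact/commute_sym/commute1.
- exact: commute1.
Qed.

Definition retr S : {multiplicative A -> A} := sval (cid (retr_exists S)).

Lemma retr_vtx S v : retr S (vtx v) = if v \in S then vtx v else 1.
Proof. exact: (svalP (cid (retr_exists S))). Qed.

Lemma retr_par S x : par S (retr S x).
Proof.
move: x; apply: raag_ind; first exact/preim_subgroup/par_subgroup.
move=> v /=; rewrite retr_vtx; case: ifP => vS; first exact: par_vtx.
by have [] := par_subgroup S.
Qed.

Lemma retr_id S x : par S x -> retr S x = x.
Proof.
apply: (gen_hom_ext (g := idfun)) => _ [v vS ->] /=.
by rewrite retr_vtx vS.
Qed.

Lemma retrI S T x : par T x -> par (S :&: T) (retr S x).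
Proof.
apply: (@par_min _ [set x | par (S :&: T) (retr S x)]).
  exact/preim_subgroup/par_subgroup.
move=> v vT /=; rewrite retr_vtx; case: ifP => vS; first by apply: par_vtx; rewrite inE vS.
by have [] := par_subgroup (S :&: T).
Qed.

(** The retraction onto [S] fixes [x], and it kills the generators in [T] that lie outside [S]. *)
Lemma parI S T x : par S x -> par T x -> par (S :&: T) x.
Proof. by move=> Sx Tx; rewrite -(retr_id Sx); apply: retrI. Qed.

Lemma par_setT x : par [set: Gamma] x.
Proof. by move: x; apply: raag_ind (par_subgroup _) _ => v; apply: par_vtx. Qed.

Lemma par_commute S T : (forall u v, u \in S -> v \in T -> commute (vtx u) (vtx v)) ->
  forall x y, par S x -> par T y -> commute x y.
Proof.
move=> ST; apply: gen_commute => x y [u uS ->] [v vT ->]; exact: ST.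
Qed.

Lemma link_commute v x : par (v |: link v) x -> commute (vtx v) x.
Proof.
apply: (@par_commute [set v]); last by apply: par_vtx; rewrite inE.
move=> a b; rewrite !inE => /eqP -> /orP[/eqP ->|]; first exact: commute_refl.
exact: vtx_commute.
Qed.

Definition conj_into S x := exists g, par S (x ^ g).

Lemma conj_intoS S T x : S \subset T -> conj_into S x -> conj_into T x.
Proof. by move=> ST [g Sx]; exists g; apply: parS Sx. Qed.

(** The retraction onto [T] fixes [x ^ h] and sends [x ^ g] into the parabolic subgroup of the
    intersection. Applied to the equation that conjugates [x ^ g] to [x ^ h], it yields the required
    conjugator. *)
Lemma conj_intoI S T x : conj_into S x -> conj_into T x -> conj_into (S :&: T) x.
Proof.
move=> [g gx] [h hx].
have xh : x ^ h = (retr T (x ^ g)) ^ (retr T (g^-1 * h)).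
  by rewrite -homJ -conjgM mulgA mulgV mul1g retr_id.
exists (h * (retr T (g^-1 * h))^-1); rewrite conjgM xh conjgK setIC.
exact: retrI.
Qed.

Lemma conj_into_bigI S x :
  (forall u, u \notin S -> conj_into [set~ u] x) -> conj_into S x.
Proof.
move=> Sx; have -> : S = \bigcap_(u | u \notin S) [set~ u].
  apply/setP => v; apply/idP/finset.bigcapP => [vS u uS|h].
    by rewrite !inE; apply: contraNneq uS => <-.
  by apply/negP => /negP /h; rewrite !inE eqxx.
apply: (big_ind (fun T => conj_into T x)) => //; first by exists 1; rewrite conjg1; apply: par_setT.
by move=> T U; apply: conj_intoI.
Qed.

Lemma conj_into_set0 x : conj_into set0 x -> x = 1.
Proof. by move=> [g /par_set0 /eqP]; rewrite conjg_eq1 => /eqP. Qed.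

Section SplittingAtVertex.
Variable v : Gamma.

Let sL : is_subgroup (par (link v)) := par_subgroup (link v).
Let r := retr [set~ v].
Let Y : choiceType := lcosets sL.
Let a : gaction A Y := lcoset_action sL r.
Let t0 : Y := lcoset_pi sL 1.

(* [Y] is the set of cosets of [A(link v)], on which the group acts through the
   retraction [r] killing [v]; the stable letter [v] is sent to the trivial coset. *)
Lemma raag_to_sd_exists : exists p : {multiplicative A -> semidirect a},
  forall u, p (vtx u) = if u == v then (free_gen t0, 1) else (1, vtx u).
Proof.
have cv u : adj v u -> commute ((free_gen t0, 1) : semidirect a) (1, vtx u).
  move=> vu; rewrite /commute !sd_mulE /= mul1g !mulg1 mul1g fmap_gen.
  rewrite (hom1 (fmap a 1)) mulg1; congr (_, _); congr free_gen; rewrite /t0 /=.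
  rewrite lcoset_actE mulg1; apply/lcoset_piP; rewrite invg1 mul1g.
  rewrite /r retr_vtx !inE; case: eqP => [uv|_] /=.
    by have [] := sL.
  by apply: par_vtx; rewrite inE.
have c2 u w : adj u w -> commute ((1, vtx u) : semidirect a) (1, vtx w).
  move=> uw; rewrite /commute !sd_mulE /= !mul1g !(hom1 (fmap a _)).
  by rewrite vtx_commute.
apply: raag_lift => u w uw; case: eqP => [uv|_]; case: eqP => [wv|_].
- exact: commute_refl.
- by apply: cv; rewrite -uv.
- by apply/commute_sym/cv; rewrite -wv adj_sym.
- exact: c2.
Qed.

Definition raag_to_sd := sval (cid raag_to_sd_exists).
Let p := raag_to_sd.

Lemma raag_to_sd_vtx u :
  p (vtx u) = if u == v then (free_gen t0, 1) else (1, vtx u).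
Proof. exact: (svalP (cid raag_to_sd_exists)). Qed.

Let f (t : Y) : A := repr t * vtx v * (repr t)^-1.

(** [v] commutes with A(link v), so a conjugate of [v] depends only on the coset of the conjugating
    element. *)
Lemma coset_conj_vtx (t : Y) x : t = lcoset_pi sL x -> f t = x * vtx v * x^-1.
Proof.
rewrite -{1}(lcoset_reprK t) => /lcoset_piP.
set y := repr t; set l := _ * _ => Ll; rewrite /f -/y.
have -> : x = y * l by rewrite /l mulgA mulgV mul1g.
rewrite invgM -!mulgA; congr (_ * _); rewrite !mulgA; congr (_ * _).
have c : commute (vtx v) l by apply: link_commute; apply: parS Ll; apply: subsetUr.
by rewrite -c mulgK.
Qed.

(** The acting group is the whole of [A], through [r], instead of the subgroup without [v]. So [p]
    is an embedding rather than an isomorphism, and [q] is a left inverse that brings facts about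
    the tree back to [A]. *)
Lemma sd_to_raag_exists : exists q : {multiplicative semidirect a -> A},
  (forall (s : free_group Y) k, q (s, k) = free_lift f s * r k) /\ cancel p q.
Proof.
have [k t|q qE] := @sd_lift _ _ a _ f r.
  rewrite (@coset_conj_vtx _ (r k * repr t)) // /f invgM !mulgA //.
exists q; split=> // x.
apply: (raag_ext (f := q \o p) (g := idfun)) => u /=.
rewrite raag_to_sd_vtx; case: eqP => [->|/eqP uv].
  rewrite qE free_lift_gen hom1 mulg1 (@coset_conj_vtx _ 1) //.
  by rewrite invg1 mulg1 mul1g.
by rewrite qE hom1 mul1g /r retr_vtx !inE uv.
Qed.

(* Either [x] fixes a vertex of the tree, or it has an axis, along which commutators
   of elements commuting with [x] cannot translate. *)
Lemma raag_dichotomy x : conj_into [set~ v] x \/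
  (forall y z, commute x y -> commute x z -> conj_into (link v) [~ y, z]).
Proof.
have [q [qE pK]] := sd_to_raag_exists.
have [[g [k E]]|h] := sd_dichotomy (p x); [left|right=> y z xy xz].
  exists (q g); have := congr1 q E; rewrite homJ pK qE hom1 mul1g => ->.
  exact: retr_par.
have [g [k [t [E tk]]]] := h _ _ (hom_commute p xy) (hom_commute p xz).
have := congr1 q E; rewrite homJ homR !pK qE hom1 mul1g => E'.
(* [k] fixes the coset [t], so a representative of [t] conjugates [r k] into A(link v). *)
exists (q g * repr t); rewrite conjgM E'.
have [_ _ LV] := sL; rewrite -[r k]invgK conjVg; apply: LV.
move: tk; rewrite -{2}(lcoset_reprK t) /a /= => /lcoset_piP.
by rewrite invgM conjgE -mulgA.
Qed.

(** Write the image of [x] as [(s, k)]. Commutation makes the powers of [t0] and of its translate by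
    [k] conjugate in the free group, so [k] fixes [t0], which puts [r k] into A(link v). Then [s]
    commutes with a power of [t0], hence is itself a power of [t0], and [q] sends it to a power of
    [v]. *)
Lemma commute_vtxX n x : commute x (vtx v ^+ n.+1) -> par (v |: link v) x.
Proof.
move=> cx; have [q [qE pK]] := sd_to_raag_exists.
have := hom_commute p cx; rewrite homX raag_to_sd_vtx eqxx.
have -> : ((free_gen t0, 1) : semidirect a) ^+ n.+1 = (free_gen t0 ^+ n.+1, 1).
  elim: (n) => [|m IH]; first by rewrite !expg1.
  by rewrite expgS IH sd_mulE /= mulg1 fmap1 -expgS.
rewrite -[x in par _ x]pK; case: (p x) => s k; rewrite qE /commute !sd_mulE /=.
rewrite fmap1 => -[E _]; move: E; rewrite homX fmap_gen => E.
have ft : a k t0 = t0.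
  by apply: (@free_gen_conjX _ _ _ s n); rewrite conjgE -E mulKg.
rewrite ft in E.
have [_ KM _] := par_subgroup (v |: link v); apply: KM; last first.
  move: ft; rewrite /t0 /= lcoset_actE mulg1 => /esym /lcoset_piP.
  by rewrite invg1 mul1g; apply: parS; apply: subsetUr.
have := gen_image (f := free_lift f) (commute_free_gen E).
rewrite image_set1 free_lift_gen (@coset_conj_vtx _ 1) // mul1g invg1 mulg1.
apply: gen_min; first exact: par_subgroup.
by move=> _ ->; apply: par_vtx; rewrite !inE eqxx.
Qed.

End SplittingAtVertex.

Lemma cent_vtx v : cent (vtx v) = par (v |: link v).
Proof.
apply/seteqP; split=> x; last by move=> /link_commute xv; apply/centP.
by move=> /centP xv; apply: (@commute_vtxX v 0); rewrite expg1; apply: commute_sym.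
Qed.

End Parabolic.

(** * Elements with nonabelian centralizer *)

Lemma hom_spow (G H : groupType) (f : {multiplicative G -> H}) x b k :
  f (spow x b k) = spow (f x) b k.
Proof. by rewrite /spow; case: b; rewrite ?homV homX. Qed.

Lemma spow1g (G : groupType) b k : spow (1 : G) b k = 1.
Proof. by rewrite /spow expg1n invg1; case: b. Qed.

Lemma commute_spow (G : groupType) (x y : G) b k : commute x y -> commute x (spow y b k).
Proof. by rewrite /spow; case: b => xy; [apply: commuteV|]; apply: commuteX. Qed.

Lemma commuteJ (G : groupType) (x y g : G) : commute x y -> commute (x ^ g) (y ^ g).
Proof. by rewrite /commute -!conjMg => ->. Qed.

Lemma commuteJV (G : groupType) (x y g : G) :
  commute x (y ^ g) -> commute (x ^ g^-1) y.
Proof. by move=> /(commuteJ g^-1); rewrite conjgK. Qed.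

Lemma int_spow (z : int) b k :
  @eq int (spow (z : infinite_cyclic) b k) ((if b then - 1 else 1) * k%:Z * z)%R.
Proof.
have E : @eq int ((z : infinite_cyclic) ^+ k) (k%:Z * z)%R.
  elim: k => [|k IH]; first by rewrite mul0r.
  by rewrite expgS IH -[LHS]/(z + k%:Z * z)%R -addn1 PoszD mulrDl mul1r addrC.
rewrite /spow; case: b; last by rewrite E mul1r.
by rewrite -[LHS]/(- ((z : infinite_cyclic) ^+ k)%g : int)%R E mulN1r mulNr.
Qed.

Lemma spow_spow_gen (b c : bool) k j :
  (1%R : infinite_cyclic) = spow (spow (1%R : infinite_cyclic) b k) c j -> k = 1%N.
Proof.
move=> h; have : @eq int 1%R (spow (spow (1%R : infinite_cyclic) b k) c j) := h.
rewrite !int_spow => /(congr1 absz); rewrite !abszM /=.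
by move=> /esym/eqP; rewrite !muln_eq1 => /andP[_ /andP[/andP[_ /eqP]]].
Qed.

(** The neutral element [1] is [false] and the product is exclusive or, so values in [B2] are read
    as coordinates modulo 2. *)
Definition B2 : groupType := Algebra.to_multiplicative bool.

Lemma B2C (x y : B2) : commute x y.
Proof. exact: addbC. Qed.

Lemma B2J (x y : B2) : x ^ y = x.
Proof. by rewrite conjgE (B2C x) mulgA mulVg mul1g. Qed.

Lemma B2P (x : B2) : x <> 1 -> x = true. Proof. by case: x. Qed.

Lemma intC (x y : infinite_cyclic) : commute x y.
Proof. exact: GRing.addrC. Qed.

Lemma nonabelianP (G : groupType) (S : set G) : ~ abelian_set S ->
  exists y z, [/\ S y, S z & [~ y, z] <> 1].
Proof.
move=> nab; apply: contrapT => h; apply: nab => y z Sy Sz.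
apply/commgP/eqP; apply: contrapT => yz; apply: h; by exists y, z.
Qed.

Section AbelianQuotients.
Variable Gamma : sgraph.
Notation A := (raag Gamma).
Implicit Types (u v w : Gamma) (x y z g : A) (S : {set Gamma}).

Lemma raag_lift_abelian (G : groupType) (f : Gamma -> G) :
  (forall x y : G, commute x y) ->
  exists g : {multiplicative A -> G}, forall v, g (vtx v) = f v.
Proof. by move=> Gab; apply: raag_lift. Qed.

Definition chi v : {multiplicative A -> B2} :=
  sval (cid (raag_lift_abelian (fun u => (u == v) : B2) B2C)).

Lemma chi_vtx v u : chi v (vtx u) = (u == v).
Proof. exact: (svalP (cid (raag_lift_abelian (fun u => (u == v) : B2) B2C))). Qed.

Definition zchi v : {multiplicative A -> infinite_cyclic} :=
  sval (cid (raag_lift_abelian (fun u => (u == v)%:R%R : infinite_cyclic) intC)).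

Lemma zchi_vtx v u : zchi v (vtx u) = (u == v)%:R%R.
Proof.
exact: (svalP (cid (raag_lift_abelian (fun u => (u == v)%:R%R : infinite_cyclic) intC))).
Qed.

Lemma zchi_conj v x g : zchi v (x ^ g) = zchi v x.
Proof. by rewrite homJ conjgE (intC (zchi v x)) mulgA mulVg mul1g. Qed.

(** A power of a single vertex is detected by the exponent sum of that vertex, which vanishes on
    commutators. *)
Lemma commutator_conj_into S y z :
  #|S| <= 1 -> conj_into S [~ y, z] -> [~ y, z] = 1.
Proof.
move=> S1 [g Sg].
have [v SE|S0] := pickP (mem S); last first.
  apply: conj_into_set0; exists g; apply: parS Sg.
  by apply/subsetP => v; rewrite [v \in S]S0.
have : par [set v] ([~ y, z] ^ g).
  apply: parS Sg; apply/subsetP => w wS; rewrite inE.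
  exact/eqP/(card_le1_eqP S1).
move=> /par_set1P [b [k E]].
have : zchi v ([~ y, z] ^ g) = 1.
  by rewrite zchi_conj homR; apply/eqP/commgP/intC.
rewrite E hom_spow zchi_vtx eqxx int_spow => k0.
have k00 : k = 0%N by move: k0; rewrite -[1]/(0%R : int); case: (b); lia.
by move: E; rewrite k00 /spow expg0 invg1 if_same => /eqP; rewrite conjg_eq1 => /eqP.
Qed.

Definition thin := forall v w, v != w -> #|link v :&: link w| <= 1.

(** Since [x] is nontrivial, some [v] cannot be conjugated away from it, so a nontrivial commutator
    in its centralizer is conjugate into the link of [v]. If another [w] could not be removed
    either, the commutator would be conjugate into the intersection of two links, which is too
    small. *)
Lemma nonabelian_cent_vertex x : thin -> x <> 1 -> ~ abelian_set (cent x) ->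
  exists v, conj_into [set v] x /\ 1 < #|link v|.
Proof.
move=> Gthin x1 /nonabelianP [y [z [/centP xy /centP xz c1]]].
have small (S : {set Gamma}) : #|S| <= 1 -> ~ conj_into S [~ y, z].
  by move=> S1 /(commutator_conj_into S1).
have [v nv] : exists v, ~ conj_into [set~ v] x.
  apply: contrapT => h; apply: x1; apply: conj_into_set0.
  by apply: conj_into_bigI => u _; apply: contrapT => nu; apply: h; exists u.
have cv : conj_into (link v) [~ y, z].
  by have [|h] := raag_dichotomy v x; [|apply: h].
exists v; split; last by rewrite ltnNge; apply/negP => /small.
apply: conj_into_bigI => w; rewrite inE eq_sym => vw.
have [//|h] := raag_dichotomy w x.
by case: (small _ (Gthin v w vw)); apply: conj_intoI => //; apply: h.
Qed.

Definition based_at x v := exists g b, x ^ g = spow (vtx v) b 1.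

(** [x] is conjugate to a power of a vertex [v]. The corresponding conjugate of [v] is central in
    the centralizer of [x], hence a power of [x], and this forces the exponent to be 1 or -1. *)
Lemma inner_pearl_vertex x : thin -> inner_pearl x ->
  exists v, based_at x v /\ 1 < #|link v|.
Proof.
move=> Gthin [x1 nab cx].
have [v [[g /par_set1P [b [k E]]] lv]] := nonabelian_cent_vertex Gthin x1 nab.
exists v; split=> //; exists g, b; rewrite E; congr spow.
case: k E => [|k] E.
  by case: x1; apply/eqP; rewrite -(conjg_eq1 x g) E /spow expg0 invg1 if_same.
have cE y : cent x y -> commute (vtx v) (y ^ g).
  move=> /centP xy; apply: link_commute; apply: (@commute_vtxX _ v k).
  have c : commute (y ^ g) (spow (vtx v) b k.+1) by rewrite -E; apply/commute_sym/commuteJ.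
  by move: c; rewrite /spow; case: (b) => // /commuteV; rewrite invgK.
have : center_of (cent x) (vtx v ^ g^-1).
  split=> [|y /cE]; last exact: commuteJV.
  apply/centP/commute_sym/commuteJV; rewrite E.
  by apply: commute_spow; apply: commute_refl.
rewrite -cx => /gen1P [c [j vE]].
have := congr1 (zchi v) vE; rewrite zchi_conj hom_spow -(zchi_conj v x g) E hom_spow.
by rewrite zchi_vtx eqxx; apply: spow_spow_gen.
Qed.

Lemma based_at_chi x v u : based_at x v -> chi u x = (v == u).
Proof.
move=> [g [b E]]; have := congr1 (chi u) E; rewrite homJ B2J => ->.
by rewrite hom_spow chi_vtx /spow expg1; case: (b).
Qed.

Lemma based_at_chi1 x v u : based_at x v -> u != v -> chi u x = 1.
Proof. by move=> xv uv; rewrite (based_at_chi u xv) eq_sym; exact: negPf. Qed.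

Lemma B2_conj (f : {multiplicative A -> B2}) x g : f (x ^ g) = f x.
Proof. by rewrite homJ B2J. Qed.

(** The centralizer of [x] contains conjugates of all vertices in the star of [v], and [f] is blind
    to conjugation. *)
Lemma based_at_cent x v (f : {multiplicative A -> B2}) :
  based_at x v -> (forall y, cent x y -> f y = 1) ->
  forall w, w \in v |: link v -> f (vtx w) = 1.
Proof.
move=> [g [b E]] fc w wv; rewrite -(B2_conj f _ g^-1); apply: fc.
apply/centP/commute_sym/commuteJV; rewrite E.
apply: commute_spow; apply/commute_sym/link_commute.
exact: par_vtx.
Qed.

Definition hom_mul (f g : {multiplicative A -> B2}) : {multiplicative A -> B2}.
Proof.
apply: (@mk_hom _ _ (fun x => f x * g x)) => x y.
by rewrite !gmulfM -!mulgA; congr (_ * _); rewrite !mulgA (B2C (g x)).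
Defined.

(** One linear condition on the span of two coordinates leaves a nonzero solution. This disposes of
    a pearl [x] about which nothing is known. *)
Lemma two_chi u1 u2 x : u1 != u2 -> exists f : {multiplicative A -> B2},
  [/\ f x = 1, forall y, chi u1 y = 1 -> chi u2 y = 1 -> f y = 1 &
   exists2 u, (u == u1) || (u == u2) & f (vtx u) <> 1].
Proof.
move=> u12.
have [h|/B2P h1] := pselect (chi u1 x = 1).
  exists (chi u1); split=> //; exists u1; rewrite ?eqxx //.
  by rewrite chi_vtx eqxx.
have [h|/B2P h2] := pselect (chi u2 x = 1).
  exists (chi u2); split=> //; exists u2; rewrite ?eqxx ?orbT //.
  by rewrite chi_vtx eqxx.
exists (hom_mul (chi u1) (chi u2)); rewrite /hom_mul /=; split.
- by rewrite h1 h2.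
- by move=> y -> ->.
- by exists u1; rewrite ?eqxx //= !chi_vtx eqxx (negPf u12).
Qed.

End AbelianQuotients.

(** On the centralizer of [x], [f] factors through the quotient by [x], which the classes of [y] and
    [z] generate. *)
Lemma inner_triple_ker (G H : groupType) (y x z : G) (f : {multiplicative G -> H}) :
  inner_triple y x z -> f x = 1 -> f y = 1 -> f z = 1 ->
  forall c, cent x c -> f c = 1.
Proof.
move=> [_ _ _ gC] fx fy fz c cx.
have vM : {morph (fun c : cent_group x => f (val c)) : a b / a * b}.
  by move=> a b; rewrite -gmulfM.
have [|g gE] := @quot_lift _ [set c : cent_group x | val c = x] _ (mk_hom vM).
  by move=> d /= ->.
pose c' : cent_group x := Sub c cx.
have -> : f c = g (quotg_pi _ c') by rewrite gE.
have : [set: _] (quotg_pi [set c : cent_group x | val c = x] c') by [].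
rewrite -gC; apply: gen_ker => _ [d dE <-]; rewrite gE /=.
by case: dE => ->.
Qed.

Lemma end_triple_ker (G H : groupType) (x y z : G) (f : {multiplicative G -> H}) :
  end_triple x y z -> f x = 1 -> f y = 1 -> f z = 1 ->
  forall c, cent y c -> f c = 1.
Proof.
move=> [_ -> _] fx fy fz; apply: gen_ker => c /= [[]|] -> //.
Qed.

Section PearlsInThinGraphs.
Variable Gamma : sgraph.
Notation A := (raag Gamma).

(** For any further [u] in the link, the coordinate at [u] would vanish on the three pearls, hence
    on the centralizer of [x], which contains a conjugate of [u]. *)
Lemma inner_triple_link (y x z : A) a v b :
  based_at y a -> based_at x v -> based_at z b -> inner_triple y x z ->
  forall u, u \in link v -> (u == a) || (u == b).
Proof.
move=> ya xv zb T u uv; apply: contraT; rewrite negb_or => /andP[ua ub].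
have uv' : u != v by apply: contraTneq uv => ->; rewrite inE adj_irr.
suff : chi u (vtx u) = 1 by rewrite chi_vtx eqxx.
apply: (based_at_cent xv); last by rewrite in_setU1 uv orbT.
by apply: inner_triple_ker T _ _ _; [apply: based_at_chi1 xv _
  | apply: based_at_chi1 ya _ | apply: based_at_chi1 zb _].
Qed.

(** The end pearl [x] is not known to be based at a vertex. Two link vertices other than [w] give by
    [two_chi] a character that kills [x] along with [y] and [z], but not the whole star of [v]. *)
Lemma end_triple_link (x y z : A) v w : based_at y v -> based_at z w ->
  1 < #|link v| -> end_triple x y z -> w \in link v.
Proof.
move=> yv zw /card_gt1P [u1 [u2 [lu1 lu2 u12]]] T; apply: contraT => wv.
have uv u : u \in link v -> (u != v) && (u != w).
  move=> lu; apply/andP; split; first by apply: contraTneq lu => ->; rewrite inE adj_irr.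
  by apply: contraNneq wv => <-.
have [f [fx fy [u uE fu]]] := two_chi x u12.
case: fu; apply: (based_at_cent yv); last first.
  by rewrite in_setU1; case/orP: uE => /eqP ->; rewrite ?lu1 ?lu2 orbT.
have [/andP[a1 a2] /andP[b1 b2]] := (uv _ lu1, uv _ lu2).
by apply: end_triple_ker T _ _ _ => //; apply: fy;
  by [apply: based_at_chi1 yv _ | apply: based_at_chi1 zw _].
Qed.

End PearlsInThinGraphs.

(** * Pearl chains modulo commutators and squares *)

(* The elements of [s] generate [G] modulo commutators and squares. *)
Definition spans2 (G : groupType) (s : seq G) :=
  forall f : {multiplicative G -> B2}, (forall x, x \in s -> f x = 1) ->
  forall x, f x = 1.

Lemma ordS_val n (i : 'I_n) : i.+1 %% n = if i.+1 == n then 0 else i.+1.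
Proof.
have := ltn_ord i; case: eqP => [->|/eqP ni] lt; first by rewrite modnn.
by rewrite modn_small // ltn_neqAle ni.
Qed.

Lemma cycle_adjE n (i j : ear_graph Cycle n) : 3 <= n ->
  adj i j = [|| i.+1 == j, j.+1 == i, (i == 0 :> nat) && (j.+1 == n) |
                (j == 0 :> nat) && (i.+1 == n)].
Proof.
move=> n3; rewrite /adj /= -!val_eqE /= !ordS_val.
have := ltn_ord i; have := ltn_ord j; move: (nat_of_ord i) (nat_of_ord j) => a b lb la.
by case: ifP => /eqP; case: ifP => /eqP; lia.
Qed.

Lemma path_adjE n (i j : ear_graph Path n) : adj i j = (i.+1 == j) || (j.+1 == i).
Proof. by []. Qed.

Lemma thin_path n : thin (ear_graph Path n).
Proof.
move=> v w; rewrite -val_eqE /= => vw; apply/card_le1_eqP => a b.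
rewrite !inE !path_adjE => /andP[av aw] /andP[bv bw].
by apply: val_inj => /=; move: av aw bv bw vw; lia.
Qed.

Lemma thin_cycle n : 5 <= n -> thin (ear_graph Cycle n).
Proof.
move=> n5 v w; rewrite -val_eqE /= => vw; apply/card_le1_eqP => a b.
have n3 : 3 <= n by lia.
rewrite !inE !cycle_adjE // => /andP[av aw] /andP[bv bw].
apply: val_inj => /=; move: av aw bv bw vw.
have := ltn_ord a; have := ltn_ord b; have := ltn_ord v; have := ltn_ord w.
by move: (nat_of_ord a) (nat_of_ord b) (nat_of_ord v) (nat_of_ord w); lia.
Qed.

Lemma path_link_inner n (v : ear_graph Path n) : 1 < #|link v| -> 0 < v < n.-1.
Proof.
move=> /card_gt1P [a [b [va vb ab]]]; move: va vb ab.
rewrite !inE !path_adjE -val_eqE /=.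
have := ltn_ord a; have := ltn_ord b; have := ltn_ord v.
by move: (nat_of_ord a) (nat_of_ord b) (nat_of_ord v); lia.
Qed.

(* A walk without backtracking on a path is monotone. *)
Lemma path_walk_onto m (s : nat -> nat) :
  (forall i, 0 < i <= m.+2 -> 0 < s i <= m.+2) ->
  s 2 = (s 1%N).+1 \/ s 1%N = (s 2).+1 ->
  (forall i, 1 < i <= m.+1 -> ((s i).+1 = s i.-1 \/ (s i).+1 = s i.+1) /\
                              (s i = (s i.-1).+1 \/ s i = (s i.+1).+1)) ->
  forall v, 0 < v <= m.+2 -> exists2 i, 0 < i <= m.+2 & s i = v.
Proof.
move=> sb [s12|s12] sstep v vb.
- have sE j : j <= m -> s j.+1 = s 1%N + j /\ s j.+2 = s 1%N + j.+1.
    elim: j => [|j IH] jm; first by lia.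
    have [IH1 IH2] := IH (ltnW jm); have /= := sstep j.+2; lia.
  (* An increasing walk through [m.+2] consecutive integers that stays in an interval of [m.+2]
     integers starts at its lower end. *)
  have s1 : s 1%N = 1%N.
    have [_ E] := sE m (leqnn m); have := sb m.+2; have := sb 1%N; lia.
  exists v => //; case: v vb => [|[|j]] vb; [lia|lia|].
  by have [|_ ->] := sE j; lia.
- have sE j : j <= m -> s 1%N = s j.+1 + j /\ s 1%N = s j.+2 + j.+1.
    elim: j => [|j IH] jm; first by lia.
    have [IH1 IH2] := IH (ltnW jm); have /= := sstep j.+2; lia.
  have s1 : s 1%N = m.+2.
    have [_ E] := sE m (leqnn m); have := sb m.+2; have := sb 1%N; lia.
  exists (m.+3 - v); first by lia.
  case: (posnP (m.+2 - v)) => [v0|vm].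
    have -> : v = m.+2 by lia.
    by rewrite subSn // subnn s1.
  have [|_ E] := sE (m.+1 - v); first by lia.
  have -> : m.+3 - v = (m.+1 - v).+2 by lia.
  by lia.
Qed.

(** The inner pearls are based at inner vertices, and the triple conditions force these to form a
    walk without backtracking, so every inner vertex occurs. A map that kills the pearls kills their
    centralizers, hence all stars of inner vertices, and these cover the path with its ends. *)
Lemma long_path_chain_spans m (p : (m.+4).-tuple (raag (ear_graph Path m.+4))) :
  pearl_chain p -> spans2 p.
Proof.
move=> C; have [E1 E2 T] : [/\ end_triple p`_0 p`_1 p`_2,
  end_triple p`_(m.+3) p`_(m.+2) p`_(m.+1) &
  forall i, 2 <= i <= m.+1 -> inner_triple p`_(i - 1) p`_i p`_(i + 1)] := C.
have inner i : 0 < i <= m.+2 -> inner_pearl p`_i.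
  move=> ib; have [i1|[i2|i3]] : i = 1%N \/ i = m.+2 \/ 2 <= i <= m.+1 by lia.
  - by rewrite i1; case: E1 => -[].
  - by rewrite i2; case: E2 => -[].
  - by case: (T _ i3) => _ [].
have [s sP] : {s : nat -> ear_graph Path m.+4 & forall i, 0 < i <= m.+2 ->
    based_at p`_i (s i) /\ 1 < #|link (s i)|}.
  apply: (@choice _ _ (fun i v => 0 < i <= m.+2 -> based_at p`_i v /\ 1 < #|link v|)).
  move=> i; case: (boolP (0 < i <= m.+2)) => [ib|_]; last by exists ord0.
  by have [v vP] := inner_pearl_vertex (@thin_path _) (inner i ib); exists v.
have sb i : 0 < i <= m.+2 -> 0 < s i <= m.+2.
  by move=> /sP [_ /path_link_inner].
have onto := @path_walk_onto m (fun i => s i : nat).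
have {}onto : forall v, 0 < v <= m.+2 -> exists2 i, 0 < i <= m.+2 & s i = v :> nat.
  apply: onto => //.
    have [b1 l1] := sP 1%N isT; have [b2 l2] := sP 2%N isT.
    have := end_triple_link b1 b2 l1 E1; rewrite inE path_adjE => /orP[]/eqP; lia.
  move=> i ib; have [b1 _] := sP i.-1 ltac:(lia).
  have [b2 _] := sP i ltac:(lia); have [b3 _] := sP i.+1 ltac:(lia).
  have := T i ib; rewrite subn1 addn1 => Ti.
  have sib := sb i ltac:(lia).
  have L1 := inner_triple_link b1 b2 b3 Ti.
  have lt1 : (s i).+1 < m.+4 by lia.
  have lt2 : (s i).-1 < m.+4 by lia.
  have := L1 (Ordinal lt1); have := L1 (Ordinal lt2).
  by rewrite !inE !path_adjE -!val_eqE /=; lia.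
move=> f fp; have fP i : i < m.+4 -> f p`_i = 1.
  by move=> im; apply/fp/mem_nth; rewrite size_tuple.
have fcent i : 0 < i <= m.+2 -> forall y, cent p`_i y -> f y = 1.
  move=> ib; have [i1|[i2|i3]] : i = 1%N \/ i = m.+2 \/ 2 <= i <= m.+1 by lia.
  - by move=> y; rewrite i1; apply: (end_triple_ker E1); apply: fP.
  - by move=> y; rewrite i2; apply: (end_triple_ker E2); apply: fP; lia.
  - by move=> y; apply: (inner_triple_ker (T _ i3)); apply: fP; lia.
have fv (v w : ear_graph Path m.+4) : 0 < v <= m.+2 -> w \in v |: link v ->
    f (vtx w) = 1.
  move=> /onto [i ib iv]; have {}iv : s i = v by apply: val_inj.
  rewrite -iv => wv; have [b _] := sP i ib.
  exact: (based_at_cent b (fcent i ib)).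
move=> x; apply: (raag_ext (g := mk_hom (fun _ _ => esym (mulg1 (1 : B2))))) => w.
rewrite /=; have wm := ltn_ord w.
have [w0|[w1|w2]] : w = 0 :> nat \/ w = m.+3 :> nat \/ 0 < w <= m.+2 by lia.
- have lt : 1 < m.+4 by [].
  by apply: (fv (Ordinal lt) w isT); rewrite in_setU1 inE path_adjE /= w0 orbT.
- have lt : m.+2 < m.+4 by lia.
  by apply: (fv (Ordinal lt) w) => /=; rewrite ?leqnn // in_setU1 inE path_adjE /= w1 eqxx orbT.
- by apply: (fv w) => //; rewrite in_setU1 eqxx.
Qed.

(** The set of vertices at which pearls are based is closed under adjacency, so it is the whole
    cycle. *)
Lemma long_cycle_chain_spans m (p : (m.+4.+1).-tuple (raag (ear_graph Cycle m.+4.+1))) :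
  pearl_chain p -> spans2 p.
Proof.
move=> C; have {C} T : forall i : 'I_m.+4.+1,
  inner_triple (tnth p (ord_pred i)) (tnth p i) (tnth p (ordS i)) := C.
have [s sP] : {s : 'I_m.+4.+1 -> ear_graph Cycle m.+4.+1 &
    forall i, based_at (tnth p i) (s i)}.
  apply: (@choice _ _ (fun i v => based_at (tnth p i) v)) => i.
  have [_ [ip _ _] _ _] := T i.
  have [//|v [vP _]] := inner_pearl_vertex _ ip; first exact: thin_cycle.
  by exists v.
have sadj i u : adj (s i) u -> exists j, s j = u.
  move=> su; have := inner_triple_link (sP (ord_pred i)) (sP i) (sP (ordS i)) (T i).
  by move=> /(_ u); rewrite inE => /(_ su) /orP[]/eqP ->; eexists.
have sup k : forall v : ear_graph Cycle m.+4.+1, v = k + s ord0 :> nat -> exists j, s j = v.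
  elim: k => [|k IH] v vE; first by exists ord0; apply: val_inj.
  have lt : k + s ord0 < m.+4.+1 by have := ltn_ord v; lia.
  have [j jE] := IH (Ordinal lt) erefl; apply: (sadj j).
  by rewrite jE cycle_adjE //= vE addSn eqxx.
have sdown k : forall v : ear_graph Cycle m.+4.+1, v + k = s ord0 :> nat -> exists j, s j = v.
  elim: k => [|k IH] v vE; first by exists ord0; apply: val_inj; rewrite /= -[RHS]addn0 vE.
  have lt : v.+1 < m.+4.+1 by have := ltn_ord (s ord0); lia.
  have [|j jE] := IH (Ordinal lt); first by rewrite /= addSnnS.
  by apply: (sadj j); rewrite jE cycle_adjE //= eqxx orbT.
move=> f fp x.
apply: (raag_ext (g := mk_hom (fun _ _ => esym (mulg1 (1 : B2))))) => v /=.
have [j <-] : exists j, s j = v.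
  case: (leqP (s ord0) v) => vs; first by apply: (sup (v - s ord0)); rewrite subnK.
  by apply: (sdown (s ord0 - v)); rewrite subnKC // ltnW.
apply: (based_at_cent (sP j)); last by rewrite in_setU1 eqxx.
by apply: inner_triple_ker (T j) _ _ _; apply/fp/mem_tnth.
Qed.

Lemma raag_complete_abelian (Gamma : sgraph) :
  (forall v w : Gamma, v != w -> adj v w) -> forall x y : raag Gamma, commute x y.
Proof.
move=> full x y; apply: (par_commute (S := setT) (T := setT)); try exact: par_setT.
move=> u v _ _; have [->|/full] := eqVneq u v; first exact: commute_refl.
exact: vtx_commute.
Qed.

(* The set [K] below allows an arbitrary square factor, so it is closed under products. *)
Lemma abelian_modulo_squares (Gamma : sgraph) :
  (forall x y : raag Gamma, commute x y) ->
  forall x : raag Gamma, (forall v, chi v x = 1) -> exists u, x = u ^+ 2.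
Proof.
move=> ab x x1.
have sqM (u w : raag Gamma) : (u * w) ^+ 2 = u ^+ 2 * w ^+ 2.
  by rewrite expgMn.
pose K := [set y : raag Gamma | forall f : Gamma -> bool,
   (forall v, chi v y = f v) -> exists u, y = u ^+ 2 * \prod_v (vtx v) ^+ f v].
have prM (f g : Gamma -> bool) : exists w : raag Gamma,
    (\prod_v (vtx v) ^+ f v) * (\prod_v (vtx v) ^+ g v) =
    w ^+ 2 * \prod_v (vtx v) ^+ (f v (+) g v).
  elim/big_ind3: _ => [|c b a c' b' a' [w E] [w' E']|v _].
  - by exists 1; rewrite expg1n.
  - exists (w * w'); rewrite sqM.
    have -> : a * a' * (b * b') = a * b * (a' * b').
      by rewrite -!mulgA; congr (_ * _); rewrite !mulgA (ab a').
    rewrite E E'; move: (w ^+ 2) (w' ^+ 2) => u u'.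
    by rewrite -!mulgA; congr (_ * _); rewrite !mulgA (ab u').
  - case: (f v); case: (g v); rewrite /= ?mul1g ?mulg1.
    + by exists (vtx v); rewrite mulg1.
    + by exists 1; rewrite expg1n mul1g.
    + by exists 1; rewrite expg1n mul1g.
    + by exists 1; rewrite expg1n mul1g.
have sK : is_subgroup K.
  have K1 : K 1.
    move=> f f1; exists 1; rewrite expg1n mul1g big1 // => v _.
    by rewrite -(f1 v) hom1.
  have KM a b : K a -> K b -> K (a * b).
    move=> Ka Kb f fE.
    have [u {1}->] := Ka (fun v => chi v a) (fun=> erefl).
    have [w {1}->] := Kb (fun v => chi v b) (fun=> erefl).
    have [t tE] := prM (fun v => chi v a) (fun v => chi v b).
    exists (u * w * t); rewrite !sqM.
    set P := \prod_v _ in tE *; set Q := \prod_v _ in tE *.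
    have -> : u ^+ 2 * P * (w ^+ 2 * Q) = u ^+ 2 * w ^+ 2 * (P * Q).
      move: (u ^+ 2) (w ^+ 2) => u' w'.
      by rewrite -!mulgA; congr (_ * _); rewrite !mulgA (ab P).
    rewrite tE mulgA; congr (_ * _); apply: eq_bigr => v _.
    by rewrite -fE gmulfM.
  split=> // a Ka f fE.
  have [u aE] := Ka f (fun v => etrans (esym (homV (chi v) a)) (fE v)).
  exists (a^-1 * u); rewrite sqM -mulgA -aE expg2.
  by rewrite -mulgA mulVg mulg1.
have Kv v : K (vtx v).
  move=> f fE; exists 1; rewrite expg1n mul1g.
  have vE : vtx v = \prod_(u | u == v) vtx u by rewrite big_pred1_eq.
  rewrite [LHS]vE big_mkcond.
  apply: eq_bigr => u _; rewrite -fE chi_vtx eq_sym /=.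
  by case: (v == u).
have [|u ->] := raag_ind sK Kv x (fun=> false); first exact: x1.
by exists u; rewrite big1 ?mulg1.
Qed.

Lemma is_multiple_hom (G H : groupType) (f : {multiplicative G -> H}) p :
  is_multiple p -> is_multiple (f p).
Proof.
move=> [u [k [k2 pE]]]; exists (f u), k; split=> //.
by case: pE => ->; rewrite ?homV homX; [left|right].
Qed.

Lemma path2_adj (v w : ear_graph Path 2) : v != w -> adj v w.
Proof.
rewrite path_adjE -val_eqE /=.
by case: v w => [[|[|v]] lv] [[|[|w]] lw].
Qed.

Lemma cycle3_adj (v w : ear_graph Cycle 3) : v != w -> adj v w.
Proof.
rewrite cycle_adjE // -val_eqE /=.
by case: v w => [[|[|[|v]]] lv] [[|[|[|w]]] lw].
Qed.

(** Modulo 2, [p] and [q] are distinct nonzero vectors of a plane, hence a basis. Indeed an element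
    with zero coordinates is a square, and [p * q] has the same class as [q] modulo [p], so either
    failure would produce a multiple. *)
Lemma unimodular_pair_spans (G : groupType) (p q : G) :
  isog G (raag (ear_graph Path 2)) -> unimodular_pair p q -> spans2 [:: p; q].
Proof.
move=> /isogP [f [g [fK gK]]] [np nq] h hpq.
have {hpq}[hp hq] : h p = 1 /\ h q = 1 by split; apply: hpq; rewrite !inE eqxx ?orbT.
pose v0 : ear_graph Path 2 := ord0; pose v1 : ear_graph Path 2 := ord_max.
have ab := raag_complete_abelian path2_adj.
have sq x : chi v0 (f x) = 1 -> chi v1 (f x) = 1 -> exists u, x = u ^+ 2.
  move=> x0 x1; have [|u E] := abelian_modulo_squares ab (x := f x).
    move=> v; suff [->|->] : v = v0 \/ v = v1 by [].
    case: v => [[|[|v]] lv] //; [left|right]; exact: val_inj.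
  by exists (g u); rewrite -homX -E fK.
have hE x : h x = (h (g (vtx v0)) && chi v0 (f x)) (+) (h (g (vtx v1)) && chi v1 (f x)).
  pose a := h (g (vtx v0)) : bool; pose b := h (g (vtx v1)) : bool.
  have mM : {morph (fun y : raag (ear_graph Path 2) =>
     ((a && chi v0 y) (+) (b && chi v1 y) : B2)) : y z / y * z}.
    move=> y z; rewrite !gmulfM.
    change ((a && (chi v0 y (+) chi v0 z)) (+) (b && (chi v1 y (+) chi v1 z)) =
      ((a && chi v0 y) (+) (b && chi v1 y)) (+) ((a && chi v0 z) (+) (b && chi v1 z))).
    by case: a; case: b; case: (chi v0 y); case: (chi v1 y); case: (chi v0 z);
       case: (chi v1 z).
  have := @raag_ext _ _ (h \o g) (mk_hom mM) _ (f x); rewrite /= fK; apply.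
  move=> v; rewrite !chi_vtx.
  have [->|->] : v = v0 \/ v = v1.
    case: v => [[|[|v]] lv] //; [left|right]; exact: val_inj.
  - by rewrite eqxx andbT /= andbF addbF.
  - by rewrite eqxx andbT /= andbF.
have p_nz : ~ (chi v0 (f p) = 1 /\ chi v1 (f p) = 1).
  move=> [p0 p1]; apply: np; have [u ->] := sq p p0 p1.
  by exists u, 2; split=> //; left.
have q_nz : ~ (chi v0 (f q) = 1 /\ chi v1 (f q) = 1).
  move=> [q0 q1]; apply: nq; have [u ->] := sq q q0 q1.
  exists (quotg_pi _ u), 2; split=> //; left.
  by rewrite -!quot_homE homX.
have pq_nz : ~ (chi v0 (f p) = chi v0 (f q) /\ chi v1 (f p) = chi v1 (f q)).
  move=> [e0 e1]; apply: nq; have [||u E] := sq (p * q).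
  - by rewrite !gmulfM e0; case: (chi v0 _).
  - by rewrite !gmulfM e1; case: (chi v1 _).
  exists (quotg_pi [set p] u), 2; split=> //; left.
  by rewrite -!quot_homE -homX -E gmulfM (quot_homE _ p) quotg_pi_rel // mul1g.
move=> x; rewrite (hE x); move: hp hq; rewrite (hE p) (hE q).
move: p_nz q_nz pq_nz (h (g (vtx v0))) (h (g (vtx v1))).
case: (chi v0 (f p)); case: (chi v1 (f p)); case: (chi v0 (f q)); case: (chi v1 (f q));
  move=> n1 n2 n3 [] [] //=; (try by case: n1); (try by case: n2); by case: n3.
Qed.

Lemma path2_chain_spans (p : 2.-tuple (raag (ear_graph Path 2))) :
  pearl_chain p -> spans2 p.
Proof.
move=> C f fp; apply: (unimodular_pair_spans (isog_refl _) C) => x.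
by rewrite !inE => /orP[]/eqP ->; apply/fp/mem_nth; rewrite size_tuple.
Qed.

Lemma cycle3_chain_spans (p : 3.-tuple (raag (ear_graph Cycle 3))) :
  pearl_chain p -> spans2 p.
Proof.
move=> [iso U] f fp.
have fP i : i < 3 -> f p`_i = 1 by move=> i3; apply/fp/mem_nth; rewrite size_tuple.
have [|g gE] := @quot_lift _ [set p`_2] _ f; first by move=> x ->; apply: fP.
move=> x; rewrite -gE; apply: (unimodular_pair_spans iso U) => y.
by rewrite !inE => /orP[]/eqP ->; rewrite gE fP.
Qed.

(** The middle vertex is central, which excludes that the middle pearl is trivial. So this pearl is
    conjugate to a power of the middle vertex, hence central, and the three generators of its
    centralizer generate the whole group. *)
Lemma path3_chain_spans (p : 3.-tuple (raag (ear_graph Path 3))) :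
  pearl_chain p -> spans2 p.
Proof.
move=> [nab cen cE] f fp.
have fP i : i < 3 -> f p`_i = 1 by move=> i3; apply/fp/mem_nth; rewrite size_tuple.
pose b : ear_graph Path 3 := Ordinal (isT : 1 < 3).
have bC (x : raag (ear_graph Path 3)) : commute (vtx b) x.
  apply: link_commute; apply: parS (par_setT x); apply/subsetP => v _.
  by rewrite in_setU1 inE path_adjE -val_eqE; case: v => [[|[|[|v]]] lv].
have p1 : p`_1 <> 1.
  move=> p1; move: cen; rewrite p1 => /seteqP [_ /(_ (vtx b))].
  have b1 : center_of (cent 1) (vtx b).
    by split=> [|y _]; [apply/centP/commute_sym/commute1|apply: bC].
  move=> /(_ b1) /gen1P [c [k]]; rewrite spow1g => /(congr1 (chi b)).
  by rewrite hom1 chi_vtx eqxx.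
have [v [[g /par_set1P [c [k E]]] /path_link_inner vb]] :=
  nonabelian_cent_vertex (@thin_path 3) p1 nab.
have {vb}vE : v = b by apply: val_inj => /=; lia.
have cT x : cent p`_1 x.
  apply/centP; rewrite -(conjgK g p`_1); apply: commuteJV; rewrite E vE.
  by apply: commute_sym; apply: commute_spow; apply: commute_sym; apply: bC.
move=> x; have := cT x; rewrite cE; move: x; apply: gen_ker.
by move=> x [[->|->]|->]; apply: fP.
Qed.

(** * The cycle of length four, where opposite vertices have equal links *)

Section Cycle4.
Notation C4 := (ear_graph Cycle 4).
Notation A := (raag C4).

Lemma cycle4_adjE (v w : C4) : adj v w = (odd v != odd w).
Proof.
by rewrite cycle_adjE //; case: v w => [[|[|[|[|v]]]] lv] [[|[|[|[|w]]]] lw].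
Qed.

(** The group is the product of two free groups, one for each parity. Vertices of different parity
    have disjoint links, so if [v] cannot be conjugated away from [x], then all vertices of the
    other parity can. *)
Lemma cycle4_side (x : A) : ~ abelian_set (cent x) ->
  exists b : bool, conj_into [set v : C4 | odd v == b] x.
Proof.
move=> /nonabelianP [y [z [/centP xy /centP xz c1]]].
have [h|/existsNP [v nv]] := pselect (forall v : C4, conj_into [set~ v] x).
  exists true; apply: (@conj_intoS _ set0); first exact: sub0set.
  by apply: conj_into_bigI => v _.
exists (odd v); apply: conj_into_bigI => w; rewrite inE => vw.
have [//|h] := raag_dichotomy w x; case: c1.
have [//|h'] := raag_dichotomy v x.
apply: conj_into_set0; apply: conj_intoS (conj_intoI (h' y z xy xz) (h y z xy xz)).
apply/subsetP => u; rewrite !inE !cycle4_adjE.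
by move: vw; case: (odd v); case: (odd w); case: (odd u).
Qed.

Lemma cycle4_side_cent (x : A) (b : bool) (f : {multiplicative A -> B2}) :
  conj_into [set v : C4 | odd v == b] x -> (forall y, cent x y -> f y = 1) ->
  forall v : C4, odd v != b -> f (vtx v) = 1.
Proof.
move=> [g gx] fc v vb; rewrite -(B2_conj f _ g^-1); apply: fc.
apply/centP/commute_sym/commuteJV.
have pv : par [set v] (vtx v) by apply: par_vtx; rewrite inE.
apply: par_commute pv gx => u w; rewrite !inE => /eqP -> /eqP wb.
by apply: vtx_commute; rewrite cycle4_adjE wb.
Qed.

(** If two consecutive pearls lay on the same side, a combination of the two coordinates of the
    other side would kill them and the third generator of the centralizer, which nevertheless
    contains conjugates of the other side. So they lie on different sides, and their centralizers
    cover all vertices. *)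
Lemma cycle4_chain_spans (p : 4.-tuple A) : pearl_chain p -> spans2 p.
Proof.
move=> C; have {C} cE (i : 'I_4) : ~ abelian_set (cent (tnth p i)) /\
   cent (tnth p i) = gen [set tnth p (ord_pred i); tnth p i; tnth p (ordS i)].
  by have [] := C i.
pose i0 : 'I_4 := ord0; pose i1 := ordS i0.
have [n0 c0] := cE i0; have [n1 c1] := cE i1.
have [b0 s0] := cycle4_side n0; have [b1 s1] := cycle4_side n1.
have b01 : b1 = ~~ b0.
  case: (eqVneq b1 (~~ b0)) => // b01.
  have bb : b1 = b0 by move: b01; case: (b0); case: (b1).
  rewrite bb in s1.
  have [u1 [u2 [ou1 ou2 u12]]] : exists u1 u2 : C4,
      [/\ odd u1 != b0, odd u2 != b0 & u1 != u2].
    case: (b0); first by exists (Ordinal (isT : 0 < 4)), (Ordinal (isT : 2 < 4)).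
    by exists (Ordinal (isT : 1 < 4)), (Ordinal (isT : 3 < 4)).
  have chi_side (u : C4) x : odd u != b0 ->
      conj_into [set v : C4 | odd v == b0] x -> chi u x = 1.
    move=> ou [g gx]; rewrite -(B2_conj (chi u) x g); move: gx.
    apply: gen_ker => _ [v + ->]; rewrite inE => /eqP vb.
    by rewrite chi_vtx; case: eqP => // vu; move: ou; rewrite -vu vb eqxx.
  have [f [f3 fy [u uE fu]]] := two_chi (tnth p (ord_pred i0)) u12.
  case: fu; apply: (cycle4_side_cent s0); last by case/orP: uE => /eqP ->.
  move=> y; rewrite c0; apply: gen_ker => _ [[->|->]|->] //; apply: fy; exact: chi_side.
move=> f fp; have fc i : forall y, cent (tnth p i) y -> f y = 1.
  move=> y; have [_ ->] := cE i; apply: gen_ker => _ [[->|->]|->]; apply/fp/mem_tnth.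
move=> x; apply: (raag_ext (g := mk_hom (fun _ _ => esym (mulg1 (1 : B2))))) => v /=.
have [vb|vb] := eqVneq (odd v) b0; last exact: (cycle4_side_cent s0 (fc i0)).
by apply: (cycle4_side_cent s1 (fc i1)); rewrite vb b01; case: (b0).
Qed.

End Cycle4.

Lemma pearl_chain_spans s n (p : n.-tuple (raag (ear_graph s n))) :
  ear_size_ok s n -> pearl_chain p -> spans2 p.
Proof.
case: s p => p /=.
  case: n p => [|[|[|[|n]]]] // p _.
  - exact: path2_chain_spans.
  - exact: path3_chain_spans.
  - exact: long_path_chain_spans.
case: n p => [|[|[|[|[|n]]]]] // p _.
- exact: cycle3_chain_spans.
- exact: cycle4_chain_spans.
- exact: long_cycle_chain_spans.
Qed.

(** * Iterated amalgams *)

(** Adjacency on an ear with an orientation, on plain numbers, so that it serves for vertices of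
    [ear_graph] as well as for positions in a list. *)
Definition follows (s : Defs.shape) (n i j : nat) : bool :=
  ((i.+1 == j) && (j < n)) ||
  (if s is Cycle then (i.+1 == n) && (j == 0) else false).

Lemma ear_adj_follows s n (i j : ear_graph s n) : ear_size_ok s n ->
  adj i j = follows s n i j || follows s n j i.
Proof.
case: s i j => i j n2.
  by rewrite path_adjE /follows !ltn_ord !andbT !orbF.
rewrite cycle_adjE // /follows !ltn_ord !andbT.
by move: (nat_of_ord i) (nat_of_ord j) => a b; lia.
Qed.

Lemma follows_lt s n i j : follows s n i j -> (i < n) && (j < n).
Proof. by rewrite /follows; case: s => /=; lia. Qed.

Lemma cent_genl (G : groupType) (S : set G) (x y : G) :
  cent x = gen S -> S y -> commute x y.
Proof. by move=> E Sy; apply/centP; rewrite E; apply: sub_gen. Qed.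

Lemma pearl_chain_commute s n (p : n.-tuple (raag (ear_graph s n))) :
  ear_size_ok s n -> pearl_chain p ->
  forall i j, follows s n i j -> commute p`_i p`_j.
Proof.
have tn (m : nat) (G : groupType) (q : m.-tuple G) (i : 'I_m) : tnth q i = q`_i.
  exact: tnth_nth.
have wrap (m : nat) (P : nat -> nat -> Prop) : (forall i : 'I_m, P i (ordS i)) ->
    forall i j, follows Cycle m i j -> P i j.
  move=> h i j /[dup] /follows_lt /andP[im jm]; have := h (Ordinal im).
  rewrite /follows /= (ordS_val (Ordinal im)) /=.
  by case: eqP => [-> Pi0|ni Pi] /orP[/andP[/eqP <-]|/andP[/eqP ? /eqP ->]] //;
    rewrite ?ltnn.
case: s p => p /=.
  case: n p => [|[|[|[|n]]]] // p _.
  - by move=> _ i j _; apply: raag_complete_abelian; exact: path2_adj.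
  - move=> [_ _ cE] [|[|i]] j //.
    + rewrite /follows orbF => /andP[/eqP <- _].
      by apply/commute_sym/(cent_genl cE); left; left.
    + rewrite /follows orbF => /andP[/eqP <- _].
      by apply/(cent_genl cE); right.
    + by rewrite /follows orbF; lia.
  - move=> C; have [E1 E2 T] : [/\ end_triple p`_0 p`_1 p`_2,
      end_triple p`_(n.+3) p`_(n.+2) p`_(n.+1) &
      forall i, 2 <= i <= n.+1 -> inner_triple p`_(i - 1) p`_i p`_(i + 1)] := C.
    move=> i j; rewrite /follows orbF => /andP[/eqP <- lin].
    have [i0|[i1|[i2|[i3|i4]]]] : i = 0%N \/ i = 1%N \/ i = n.+1 \/ i = n.+2 \/
      2 <= i <= n.+1 by lia.
    + rewrite i0; case: E1 => _ cE _; apply/commute_sym/(cent_genl cE).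
      by left; left.
    + rewrite i1; case: E1 => _ cE _; apply/(cent_genl cE).
      by right.
    + rewrite i2; case: E2 => _ cE _; apply/commute_sym/(cent_genl cE).
      by right.
    + rewrite i3; case: E2 => _ cE _; apply/(cent_genl cE).
      by left; left.
    + by have := T _ i4; rewrite addn1 => -[_ _ [_ /centP]].
case: n p => [|[|[|[|[|n]]]]] // p _ C.
- by move=> i j _; apply: raag_complete_abelian; exact: cycle3_adj.
- apply: (@wrap _ (fun i j => commute p`_i p`_j)) => i; rewrite -!tn.
  by have [_ cE _ _] := C i; apply: (cent_genl cE); right.
- apply: (@wrap _ (fun i j => commute p`_i p`_j)) => i; rewrite -!tn.
  have T : inner_triple (tnth p (ord_pred i)) (tnth p i) (tnth p (ordS i)) := C i.
  by have [_ _ [_ /centP]] := T.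
Qed.

Section Frames.
Variable G : groupType.

(* As far as maps to [G] are concerned, the ear RAAG is presented by its pearls and
   the commutation of consecutive ones.  This holds for every [G] if the pearls are
   the vertices, and for the group with two elements for all pearl chains. *)
Record free_for (E : decorated_ear) : Prop := FreeFor {
  ear_hom_exists : forall f : nat -> G,
    (forall i j, follows (ear_shape E) (ear_size E) i j -> commute (f i) (f j)) ->
    exists h : {multiplicative ear_raag E -> G},
      forall i, i < ear_size E -> h (pearls E)`_i = f i;
  ear_hom_unique : forall h k : {multiplicative ear_raag E -> G},
    (forall i, i < ear_size E -> h (pearls E)`_i = k (pearls E)`_i) -> h =1 k }.

Notation ear_at es i := (nth (Path, [::]) es i).

Definition position (es : seq (ear (nat * nat)%type)) (a : nat * nat) : bool :=
  (a.1 < size es) && (a.2 < size (ear_at es a.1).2).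

Definition name (es : seq (ear (nat * nat)%type)) (a : nat * nat) : nat * nat :=
  nth a (ear_at es a.1).2 a.2.

Definition efollows (es : seq (ear (nat * nat)%type)) i j k :=
  (i < size es) && follows (ear_at es i).1 (size (ear_at es i).2) j k.

(* The analogue of [free_for] for an amalgam: positions of the ears with the same
   name carry the same pearl, and maps to [G] are given by their values on names. *)
Record amalgam_inv (X : pearled_group) (es : seq (ear (nat * nat)%type)) : Prop :=
  AmalgamInv {
  inv_size : size (pimages X) = size es;
  inv_row_size : forall i, i < size es ->
    size (nth [::] (pimages X) i) = size (ear_at es i).2;
  inv_name : forall a, position es a -> (name es a).1 < size es;
  inv_consistent : forall a b, position es a -> position es b ->
    name es a = name es b -> pearl_at X a = pearl_at X b;
  inv_commute : forall i j k, efollows es i j k ->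
    commute (pearl_at X (i, j)) (pearl_at X (i, k));
  inv_hom_exists : forall f : nat * nat -> G,
    (forall i j k, efollows es i j k ->
      commute (f (name es (i, j))) (f (name es (i, k)))) ->
    exists h : {multiplicative pgroup X -> G},
      forall a, position es a -> h (pearl_at X a) = f (name es a);
  inv_hom_unique : forall h k : {multiplicative pgroup X -> G},
    (forall a, position es a -> h (pearl_at X a) = k (pearl_at X a)) -> h =1 k }.

(** For [Glue2] the last position is tested first because the outer [set_nth] of [glue_vertices]
    acts there. *)
Definition new_name (es : seq (ear (nat * nat)%type)) (n : nat) (g : gluing) (j : nat) :=
  match g with
  | Glue0 => (size es, j)
  | Glue1 a => if j == 0 then name es a else (size es, j)
  | Glue2 a b => if j == n.-1 then name es b
                 else if j == 0 then name es a else (size es, j)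
  end.

Lemma glue_verticesE es (s : Defs.shape) n g : 1 < n ->
  exists vs, [/\ glue_vertices es s n g = rcons es (s, vs), size vs = n &
    forall x j, j < n -> nth x vs j = new_name es n g j].
Proof.
move=> n1; rewrite /glue_vertices; eexists; split; first by [].
  case: g => [|a|a b]; rewrite ?size_set_nth size_map size_iota; lia.
move=> x j jn; have vsE y : nth y [seq (size es, j) | j <- iota 0 n] j = (size es, j).
  by rewrite (nth_map 0) ?size_iota // nth_iota.
case: g => [|a|a b] /=; first exact: vsE.
- rewrite (set_nth_default a) ?size_set_nth ?size_map ?size_iota; last by lia.
  by rewrite nth_set_nth /=; case: (j == 0).
- rewrite (set_nth_default b) ?size_set_nth ?size_map ?size_iota; last by lia.
  rewrite nth_set_nth /=; case: (j == n.-1) => //.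
  rewrite (set_nth_default a) ?size_set_nth ?size_map ?size_iota; last by lia.
  by rewrite nth_set_nth /=; case: (j == 0).
Qed.

Lemma ear_size_gt1 E : 1 < ear_size E.
Proof. by case: E => -[] [|[|[|n]]]. Qed.

Section Amalgamate.
Variables (X : pearled_group) (E : decorated_ear) (g : gluing).
Notation F := (free_prod (pgroup X) (ear_raag E)).

Definition glue_rel : set F :=
  match g with
  | Glue0 => classical_sets.set0
  | Glue1 a => [set inj_r (pgroup X) (pearls E)`_0 / inj_l (ear_raag E) (pearl_at X a)]
  | Glue2 a b =>
      [set inj_r (pgroup X) (pearls E)`_0 / inj_l (ear_raag E) (pearl_at X a);
           inj_r (pgroup X) (pearls E)`_(ear_size E).-1 / inj_l (ear_raag E) (pearl_at X b)]
  end.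

Definition old_hom : {multiplicative pgroup X -> F // glue_rel} :=
  quot_hom glue_rel \o injl_hom (pgroup X) (ear_raag E).
Definition new_hom : {multiplicative ear_raag E -> F // glue_rel} :=
  quot_hom glue_rel \o injr_hom (pgroup X) (ear_raag E).

Lemma amalgamate_pimages : pimages (amalgamate X E g) =
  rcons [seq [seq old_hom x | x <- s] | s <- pimages X] [seq new_hom x | x <- pearls E].
Proof. by []. Qed.

Definition respects_gluing (H : groupType) (h : pgroup X -> H) (k : ear_raag E -> H) :=
  match g with
  | Glue0 => True
  | Glue1 a => k (pearls E)`_0 = h (pearl_at X a)
  | Glue2 a b => k (pearls E)`_0 = h (pearl_at X a) /\
                 k (pearls E)`_(ear_size E).-1 = h (pearl_at X b)
  end.

Lemma amalgamate_respects : respects_gluing old_hom new_hom.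
Proof.
rewrite /respects_gluing; case gE: g => [//|a|a b].
- apply: divg1_eq; rewrite -(homV old_hom) /old_hom /new_hom /= -!quot_homE -gmulfM.
  by rewrite quot_homE quotg_pi_rel // /glue_rel gE -(homV (injl_hom _ _)).
- split; apply: divg1_eq; rewrite -(homV old_hom) /old_hom /new_hom /= -!quot_homE -gmulfM;
  rewrite quot_homE quotg_pi_rel // /glue_rel gE; [left|right];
  exact: (congr1 (mul _) (homV (injl_hom _ _) _)).
Qed.

Lemma amalgamate_lift (H : groupType) (h : {multiplicative pgroup X -> H})
    (k : {multiplicative ear_raag E -> H}) : respects_gluing h k ->
  exists m : {multiplicative F // glue_rel -> H},
    (forall x, m (old_hom x) = h x) /\ (forall x, m (new_hom x) = k x).
Proof.
have [m0 [ml mr]] := free_prod_lift h k => hk.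
have [|m mE] := @quot_lift _ glue_rel _ m0.
  rewrite /glue_rel; move: hk; rewrite /respects_gluing; case: g => [|a|a b] /=.
  - by move=> _ x [].
  - by move=> E1 x ->; rewrite gmulfM homV ml mr E1 mulgV.
  - by move=> [E1 E2] x [->|->]; rewrite gmulfM homV ml mr ?E1 ?E2 mulgV.
by exists m; split=> x; rewrite /old_hom /new_hom /= mE.
Qed.

Lemma amalgamate_ext (H : groupType) (h k : {multiplicative F // glue_rel -> H}) :
  (forall x, h (old_hom x) = k (old_hom x)) ->
  (forall x, h (new_hom x) = k (new_hom x)) -> h =1 k.
Proof.
move=> hl hr; apply: quot_ext => x.
have := @free_prod_ext _ _ _ (h \o quot_hom glue_rel) (k \o quot_hom glue_rel).
by apply=> y /=; [apply: hl|apply: hr].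
Qed.

(** The pushout property stated through two maps only, so that the next proof can generalize over
    the concrete quotient of a free product. *)
Lemma amalgamate_spec : exists (old : {multiplicative pgroup X -> pgroup (amalgamate X E g)})
    (new : {multiplicative ear_raag E -> pgroup (amalgamate X E g)}),
  [/\ pimages (amalgamate X E g) =
        rcons [seq [seq old x | x <- s] | s <- pimages X] [seq new x | x <- pearls E],
      respects_gluing old new,
      forall (h : {multiplicative pgroup X -> G}) (k : {multiplicative ear_raag E -> G}),
        respects_gluing h k ->
        exists m : {multiplicative pgroup (amalgamate X E g) -> G},
          (forall x, m (old x) = h x) /\ (forall x, m (new x) = k x) &
      forall h k : {multiplicative pgroup (amalgamate X E g) -> G},
        (forall x, h (old x) = k (old x)) -> (forall x, h (new x) = k (new x)) -> h =1 k].
Proof.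
exists old_hom, new_hom; split.
- exact: amalgamate_pimages.
- exact: amalgamate_respects.
- by move=> h k; apply: amalgamate_lift.
- by move=> h k; apply: amalgamate_ext.
Qed.

End Amalgamate.

Lemma amalgamate_inv X es E g : amalgam_inv X es -> free_for E ->
  (forall a, a \in glued_to g -> position es a) ->
  amalgam_inv (amalgamate X E g) (glue_vertices es (ear_shape E) (ear_size E) g).
Proof.
move=> I [Eex Euni] gP; have n1 := ear_size_gt1 E.
have [vs [-> szvs vsE]] := glue_verticesE es (ear_shape E) g n1.
set es' := rcons es _; set n := ear_size E in n1 szvs vsE.
have [old [new []]] := amalgamate_spec X E g.
move: (amalgamate X E g) old new => X' old new pimE glue lft ext.
have [Isz Irow Inm Icons Icomm Iex Iuni] := I.
have szp : size (pearls E) = n by rewrite size_tuple.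
have ear_old i : i < size es -> ear_at es' i = ear_at es i by rewrite /es' nth_rcons => ->.
have ear_new : ear_at es' (size es) = (ear_shape E, vs).
  by rewrite /es' nth_rcons ltnn eqxx.
have pos_old a : position es a -> [/\ position es' a, name es' a = name es a &
    pearl_at X' a = old (pearl_at X a)].
  case: a => i j /andP[/= ia ja]; rewrite /position /name /= ear_old // ja.
  rewrite /es' size_rcons ltnS (ltnW ia); split=> //.
  rewrite /pearl_at pimE [(_, _).1]/= [(_, _).2]/= nth_rcons size_map Isz ia.
  by rewrite (nth_map [::]) ?Isz // (nth_map 1) // Irow.
have pos_new j : j < n -> [/\ position es' (size es, j),
    name es' (size es, j) = new_name es n g j &
    pearl_at X' (size es, j) = new (pearls E)`_j].
  move=> jn; rewrite /position /name /= ear_new /= szvs jn /es' size_rcons ltnS leqnn.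
  split=> //; first exact: vsE.
  rewrite /pearl_at pimE [(_, _).1]/= [(_, _).2]/= nth_rcons size_map Isz ltnn eqxx.
  by rewrite (nth_map 1) // szp.
have pos_cases a : position es' a -> position es a \/ exists2 j, j < n & a = (size es, j).
  case: a => i j /andP[/=]; rewrite /es' size_rcons ltnS leq_eqVlt.
  move=> /orP[/eqP ->|ia]; first by rewrite ear_new /= szvs => jn; right; exists j.
  by rewrite ear_old // => ja; left; rewrite /position ia.
have new_nameP j : j < n -> (exists a, [/\ position es a, new_name es n g j = name es a &
    new (pearls E)`_j = old (pearl_at X a)]) \/
    new_name es n g j = (size es, j).
  move=> jn; rewrite /new_name; move: glue gP; rewrite /respects_gluing.
  case: (g) => [|a|a b] gl gp; first by right.
    case: eqP => [->|_]; last by right.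
    by left; exists a; split=> //; apply: gp; rewrite inE.
  case: eqP => [->|_]; first by left; exists b; case: gl; split=> //; apply: gp; rewrite !inE eqxx orbT.
  case: eqP => [->|_]; last by right.
  by left; exists a; case: gl; split=> //; apply: gp; rewrite !inE eqxx.
(* Names of old positions have first component below [size es], so a fresh name never collides with
   one. *)
have cons_on j a : j < n -> position es a -> new_name es n g j = name es a ->
    new (pearls E)`_j = old (pearl_at X a).
  move=> jn pa; have [[b [pb -> ->]]|->] := new_nameP j jn.
    by move=> ba; congr (old _); apply: Icons.
  by move=> E'; have := Inm a pa; rewrite -E' ltnn.
have cons_nn j k : j < n -> k < n -> new_name es n g j = new_name es n g k ->
    new (pearls E)`_j = new (pearls E)`_k.
  move=> jn kn; have [[b [pb -> ->]]|jE] := new_nameP j jn.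
    by move=> /esym /(cons_on k b kn pb) ->.
  have [[b [pb kE ->]]|->] := new_nameP k kn; first by rewrite kE; apply: cons_on.
  by rewrite jE => -[->].
split.
- by rewrite pimE /es' !size_rcons size_map Isz.
- move=> i; rewrite /es' size_rcons ltnS leq_eqVlt => /orP[/eqP ->|ie].
    by rewrite ear_new pimE nth_rcons size_map Isz ltnn eqxx size_map szp szvs.
  rewrite ear_old // pimE nth_rcons size_map Isz ie.
  by rewrite (nth_map [::]) ?Isz // size_map Irow.
- move=> a /pos_cases [pa|[j jn ->]]; rewrite /es' size_rcons ltnS.
    by have [_ -> _] := pos_old a pa; apply/ltnW/Inm.
  have [_ -> _] := pos_new j jn; have [[b [pb -> _]]|-> //] := new_nameP j jn.
  exact/ltnW/Inm.
- move=> a b /pos_cases [pa|[j jn ->]] /pos_cases [pb|[k kn ->]].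
  + have [_ -> ->] := pos_old a pa; have [_ -> ->] := pos_old b pb.
    by move=> ab; congr (old _); apply: Icons.
  + have [_ -> ->] := pos_old a pa; have [_ -> ->] := pos_new k kn.
    by move=> ab; apply/esym/cons_on.
  + have [_ -> ->] := pos_old b pb; have [_ -> ->] := pos_new j jn.
    exact: cons_on.
  + have [_ -> ->] := pos_new j jn; have [_ -> ->] := pos_new k kn.
    exact: cons_nn.
- move=> i j k /andP[]; rewrite /es' size_rcons ltnS leq_eqVlt => /orP[/eqP ->|ie].
    rewrite ear_new /= szvs => f; have /andP[jn kn] := follows_lt f.
    have [_ _ ->] := pos_new j jn; have [_ _ ->] := pos_new k kn.
    apply: hom_commute; apply: pearl_chain_commute f; [exact: ear_sizeP|exact: pearlsP].
  rewrite ear_old // => f; have /andP[jn kn] := follows_lt f.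
  have [|_ _ ->] := pos_old (i, j); first by rewrite /position /= ie.
  have [|_ _ ->] := pos_old (i, k); first by rewrite /position /= ie.
  by apply/hom_commute/Icomm; rewrite /efollows ie.
- move=> f fc.
  have [h hE] : exists h : {multiplicative pgroup X -> G},
      forall a, position es a -> h (pearl_at X a) = f (name es a).
    apply: Iex => i j k /andP[ie fl]; have /andP[jn kn] := follows_lt fl.
    have := fc i j k; rewrite /efollows ear_old // fl andbT /es' size_rcons ltnS ltnW //.
    have [|_ -> _] := pos_old (i, j); first by rewrite /position /= ie.
    have [|_ -> _] := pos_old (i, k); first by rewrite /position /= ie.
    by apply.
  have fn i j : follows (ear_shape E) (ear_size E) i j ->
      commute (f (new_name es n g i)) (f (new_name es n g j)).
    move=> fl; have /andP[jn kn] := follows_lt fl.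
    have := fc (size es) i j.
    rewrite /efollows ear_new /= szvs fl /es' size_rcons ltnS leqnn.
    have [_ -> _] := pos_new i jn; have [_ -> _] := pos_new j kn.
    by apply.
  have [k kE] := Eex _ fn.
  have [|m [mo mn]] := lft h k.
    have n0 : 0 < n by lia.
    have n2 : n.-1 < n by lia.
    move: gP; rewrite /respects_gluing; move: kE; rewrite /new_name; case: (g) => // [a|a b] kE gP.
      by rewrite kE // hE ?gP ?inE ?eqxx.
    rewrite !kE // !eqxx !hE ?gP ?inE ?eqxx ?orbT //.
    by rewrite ifN //; case: (n) n1 => [|[]].
  exists m => a /pos_cases [pa|[j jn ->]].
    by have [_ -> ->] := pos_old a pa; rewrite mo hE.
  by have [_ -> ->] := pos_new j jn; rewrite mn kE.
- move=> h k hk; apply: ext => x.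
    apply: (Iuni (h \o old) (k \o old)) => a pa.
    by have [pa' _ E'] := pos_old a pa; move: (hk a pa'); rewrite E'.
  apply: (Euni (h \o new) (k \o new)) => j jn.
  by have [pa' _ E'] := pos_new j jn; move: (hk _ pa'); rewrite E'.
Qed.

End Frames.

Notation ear_at es i := (nth (Path, [::]) es i).

Definition amalgam_state (E0 : decorated_ear) (L : seq (decorated_ear * gluing)) :=
  foldl (fun X Eg => amalgamate X Eg.1 Eg.2)
    (@PearledGroup (ear_raag E0) [:: val (pearls E0)]) L.

Lemma amalgam_groupE D :
  amalgam_group D = pgroup (amalgam_state (first_ear D) (later_ears D)).
Proof. by []. Qed.

Lemma glued_ears_rcons E0 L E g :
  glued_ears (Amalgam E0 (rcons L (E, g))) =
  glue_vertices (glued_ears (Amalgam E0 L)) (ear_shape E) (ear_size E) g.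
Proof. by rewrite /glued_ears /= foldl_rcons. Qed.

Lemma amalgam_wf_rcons E0 L E g : amalgam_wf (Amalgam E0 (rcons L (E, g))) ->
  amalgam_wf (Amalgam E0 L) /\
  forall a, a \in glued_to g ->
    (a.1 <= size L) && (a.2 < ear_size (nth E0 (E0 :: unzip1 L) a.1)).
Proof.
move=> wf; have nthE i : i <= size L ->
    nth E0 (E0 :: unzip1 (rcons L (E, g))) i = nth E0 (E0 :: unzip1 L) i.
  case: i => [//|i] iL; rewrite /= /unzip1 map_rcons nth_rcons size_map.
  by rewrite iL.
split=> [k a kL ag|a ag]; last first.
  have [||a1 a2] := wf (size L) a; rewrite /= ?size_rcons //.
    by rewrite /unzip2 map_rcons nth_rcons size_map ltnn eqxx.
  by rewrite a1 -nthE.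
have [||a1 a2] := wf k a; rewrite /= ?size_rcons ?ltnS ?(ltnW kL) //.
  by rewrite /unzip2 map_rcons nth_rcons size_map kL.
split=> //; move: a2; rewrite /amalgam_ears /= nthE //.
by apply: leq_trans a1 _; apply: ltnW.
Qed.

Lemma amalgam_inv_state (G : groupType) E0 L :
  amalgam_wf (Amalgam E0 L) ->
  (forall i, i <= size L -> free_for G (nth E0 (E0 :: unzip1 L) i)) ->
  let es := glued_ears (Amalgam E0 L) in
  [/\ amalgam_inv G (amalgam_state E0 L) es, size es = (size L).+1 &
    forall i, i <= size L -> let E := nth E0 (E0 :: unzip1 L) i in
      (ear_at es i).1 = ear_shape E /\ size (ear_at es i).2 = ear_size E].
Proof.
elim/last_ind: L => [|L [E g] IH] wf fr /=.
  have szp : size (pearls E0) = ear_size E0 by rewrite size_tuple.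
  pose vs := [seq (0, j) | j <- iota 0 (ear_size E0)].
  have szvs : size vs = ear_size E0 by rewrite size_map size_iota.
  rewrite -[glued_ears _]/[:: (ear_shape E0, vs)].
  have nm j : j < ear_size E0 -> name [:: (ear_shape E0, vs)] (0, j) = (0, j).
    by move=> jn; rewrite /name /= (nth_map 0) ?size_iota // nth_iota.
  have pos a : position [:: (ear_shape E0, vs)] a -> exists2 j, j < ear_size E0 & a = (0, j).
    by case: a => [[|i] j] // /andP[_]; rewrite /= szvs; exists j.
  have [Eex Euni] := fr 0 isT.
  split=> // [|[|i] // _]; split=> //.
  - by move=> [|i] // _ /=; rewrite szp szvs.
  - by move=> a /pos [j jn ->]; rewrite nm.
  - move=> a b /pos [j jn ->] /pos [k kn ->]; rewrite !nm // => -[->] //.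
  - move=> [|i] // j k; rewrite /efollows /= szvs; apply: pearl_chain_commute.
      exact: ear_sizeP.
    exact: pearlsP.
  - move=> f fc; have [j k fl|h hE] := Eex (fun j => f (0, j)).
      have /andP[jn kn] := follows_lt fl.
      by have := fc 0 j k; rewrite !nm // /efollows /= szvs; apply.
    by exists h => a /pos [j jn ->]; rewrite nm // -hE.
  - move=> h k hk; apply: Euni => i ie.
    by apply: (hk (0, i)); rewrite /position /= szvs.
have [wf' gP] := amalgam_wf_rcons wf.
have nthE i : i <= size L ->
    nth E0 (E0 :: unzip1 (rcons L (E, g))) i = nth E0 (E0 :: unzip1 L) i.
  by case: i => [//|i] iL; rewrite /= /unzip1 map_rcons nth_rcons size_map iL.
have nthE' : nth E0 (E0 :: unzip1 (rcons L (E, g))) (size L).+1 = E.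
  by rewrite /= /unzip1 map_rcons nth_rcons size_map ltnn eqxx.
have [|I sz ears] := IH wf'.
  by move=> i iL; rewrite -nthE //; apply: fr; rewrite size_rcons; apply: leqW.
have frE : free_for G E by rewrite -nthE'; apply: fr; rewrite size_rcons.
have st : amalgam_state E0 (rcons L (E, g)) = amalgamate (amalgam_state E0 L) E g.
  by rewrite /amalgam_state foldl_rcons.
rewrite glued_ears_rcons st.
have [vs [vE szvs _]] :=
  glue_verticesE (glued_ears (Amalgam E0 L)) (ear_shape E) g (ear_size_gt1 E).
split.
- apply: amalgamate_inv => // a /gP /andP[a1 a2]; rewrite /position sz ltnS a1 /=.
  by have [_ ->] := ears _ a1.
- by rewrite vE size_rcons sz size_rcons.
- move=> i; rewrite size_rcons leq_eqVlt ltnS vE nth_rcons sz => /orP[/eqP ->|iL].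
    by rewrite ltnn eqxx; move: nthE'; rewrite /= => ->.
  by rewrite ltnS iL; move: (nthE i iL) => /= ->; apply: ears.
Qed.

Definition raag_lift2 (Gamma : sgraph) (f : Gamma -> bool) :
    {multiplicative raag Gamma -> B2} :=
  sval (cid (raag_lift_abelian (fun u => f u : B2) B2C)).

Lemma raag_lift2_vtx (Gamma : sgraph) (f : Gamma -> bool) v :
  raag_lift2 f (vtx v) = f v.
Proof. exact: (svalP (cid (raag_lift_abelian (fun u => f u : B2) B2C))). Qed.

(** Uniqueness is spanning, applied to the product of the two maps. It makes evaluation on the
    pearls an injective map from the finite set of functions on the vertices to that of functions on
    the pearls; the two sets are equally large, so it is onto, which is existence. *)
Lemma free_for_B2 E : free_for B2 E.
Proof.
have Euni (h k : {multiplicative ear_raag E -> B2}) :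
    (forall i, i < ear_size E -> h (pearls E)`_i = k (pearls E)`_i) -> h =1 k.
  move=> hk x; have := @pearl_chain_spans _ _ (pearls E) (ear_sizeP E) (pearlsP E).
  move=> /(_ (hom_mul h k)) sp.
  have {sp}: h x * k x = 1.
    apply: sp => y /(nthP 1) [i]; rewrite size_tuple => ie <-.
    by rewrite /hom_mul /= hk //; apply: addbb.
  by case: (h x); case: (k x).
split=> // f _.
pose M (F : {ffun 'I_(ear_size E) -> bool}) : {ffun 'I_(ear_size E) -> bool} :=
  [ffun i => raag_lift2 (F : ear_graph _ _ -> bool) (pearls E)`_(i : 'I_(ear_size E))].
have Minj : injective M.
  move=> F F' MF; apply/ffunP => v.
  have := Euni (raag_lift2 (F : ear_graph _ _ -> bool))
    (raag_lift2 (F' : ear_graph _ _ -> bool)).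
  move=> /(_ _ (vtx (v : ear_graph (ear_shape E) (ear_size E)))); rewrite !raag_lift2_vtx; apply => i ie.
  by have := congr1 (fun F : {ffun _} => F (Ordinal ie)) MF; rewrite !ffunE.
have /codomP [F FE] := injF_onto Minj [ffun i : 'I_(ear_size E) => f i : bool].
exists (raag_lift2 (F : ear_graph _ _ -> bool)) => i ie.
by have := congr1 (fun F : {ffun _} => F (Ordinal ie)) FE; rewrite !ffunE.
Qed.

(** * Glued graphs with a vertex removed *)

(* the unitriangular 3 x 3 matrices over the field with two elements, as triples
   (upper left, lower right, corner) of entries above the diagonal *)
Definition heis2 : Type := (bool * bool * bool)%type.

HB.instance Definition _ := Choice.copy heis2 (bool * bool * bool)%type.

Definition heis2_mul (x y : heis2) : heis2 :=
  (x.1.1 (+) y.1.1, x.1.2 (+) y.1.2, x.2 (+) y.2 (+) (x.1.1 && y.1.2)).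
Definition heis2_inv (x : heis2) : heis2 := (x.1.1, x.1.2, x.2 (+) (x.1.1 && x.1.2)).

Lemma heis2_mulA : associative heis2_mul.
Proof. by move=> [[[] []] []] [[[] []] []] [[[] []] []]. Qed.
Lemma heis2_mul1 : left_id (false, false, false) heis2_mul.
Proof. by move=> [[[] []] []]. Qed.
Lemma heis2_1mul : right_id (false, false, false) heis2_mul.
Proof. by move=> [[[] []] []]. Qed.
Lemma heis2_mulV : left_inverse (false, false, false) heis2_inv heis2_mul.
Proof. by move=> [[[] []] []]. Qed.
Lemma heis2_Vmul : right_inverse (false, false, false) heis2_inv heis2_mul.
Proof. by move=> [[[] []] []]. Qed.

HB.instance Definition _ := isGroup.Build heis2
  heis2_mulA heis2_mul1 heis2_1mul heis2_mulV heis2_Vmul.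

(** As [a] and [b] are not adjacent, they may be sent to the two standard generators of [heis2], and
    the other vertices to 1. The commutator of two elements of [heis2] is the determinant of their
    coordinates. *)
Lemma commute_chi (Gamma : sgraph) (a b : Gamma) (g h : raag Gamma) :
  a != b -> ~~ adj a b -> commute g h ->
  (chi a g : bool) && chi b h = (chi a h : bool) && chi b g.
Proof.
move=> ab nab gh.
have [u v uv|f fE] :=
  @raag_lift Gamma heis2 (fun v => (v == a, v == b, false) : heis2).
  rewrite /commute -![_ * _]/(heis2_mul _ _) /heis2_mul /=.
  have h1 : ~~ ((u == a) && (v == b)).
    by apply: contra nab => /andP[/eqP <- /eqP <-].
  have h2 : ~~ ((u == b) && (v == a)).
    by apply: contra nab => /andP[/eqP <- /eqP <-]; rewrite adj_sym.
  by move: h1 h2; case: (u == a); case: (u == b); case: (v == a); case: (v == b).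
have p1 : {morph (fun x : heis2 => x.1.1 : B2) : x y / x * y} by [].
have p2 : {morph (fun x : heis2 => x.1.2 : B2) : x y / x * y} by [].
have Ea x : chi a x = (f x).1.1.
  apply: (raag_ext (f := chi a) (g := mk_hom p1 \o f)) => v.
  by rewrite chi_vtx /= fE.
have Eb x : chi b x = (f x).1.2.
  apply: (raag_ext (f := chi b) (g := mk_hom p2 \o f)) => v.
  by rewrite chi_vtx /= fE.
have := hom_commute f gh; rewrite !Ea !Eb /commute -![_ * _]/(heis2_mul _ _).
case: (f g) (f h) => [[a1 b1] c1] [[a2 b2] c2]; rewrite /heis2_mul /= => -[_ _].
by case: a1; case: b1; case: a2; case: b2; case: c1; case: c2.
Qed.

Lemma hom_B2_chi (Gamma : sgraph) (f : {multiplicative raag Gamma -> B2}) g h :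
  (forall u, chi u g = chi u h) -> f g = f h.
Proof.
have mM : {morph (fun x : raag Gamma => \big[addb/false]_u (f (vtx u) && chi u x) : B2) :
    x y / x * y}.
  move=> x y; rewrite -[RHS]/(addb _ _) -big_split; apply: eq_bigr => u _.
  rewrite gmulfM -[chi u x * _]/(addb _ _).
  by case: (f (vtx u)); case: (chi u x); case: (chi u y).
have E x : f x = \big[addb/false]_u (f (vtx u) && chi u x).
  apply: (raag_ext (f := f) (g := mk_hom mM)) => v /=.
  rewrite (bigD1 v) //= chi_vtx eqxx andbT big1 ?addbF // => u uv.
  by rewrite chi_vtx eq_sym (negPf uv) andbF.
by move=> gh; rewrite !E; apply: eq_bigr => u _; rewrite gh.
Qed.

Lemma stepwise_const (C : Type) (u : nat -> C) a b : a <= b ->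
  (forall t, a <= t < b -> u t = u t.+1) -> u a = u b.
Proof.
move=> ab; rewrite -(subnKC ab); move: (b - a) => k; elim: k => [|k IH] h.
  by rewrite addn0.
rewrite IH => [|t /andP[at1 tk]]; last by apply: h; rewrite at1 addnS leqW.
by rewrite (h (a + k)); [rewrite addnS|lia].
Qed.

Section Unavoidable.
Variables (V : eqType) (C : Type) (cl : V -> C) (bad : option V).
Notation good x := (Some x != bad).

(* Connectivity without the vertex [bad] is expressed by saying that a function
   [cl] which is constant along the remaining edges is constant. *)
Lemma cycle_minus_vertex (s : seq V) : uniq s ->
  (forall x0 j k, follows Cycle (size s) j k -> good (nth x0 s j) -> good (nth x0 s k) ->
     cl (nth x0 s j) = cl (nth x0 s k)) ->
  forall x y, x \in s -> y \in s -> good x -> good y -> cl x = cl y.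
Proof.
move=> us step x y xs ys gx gy.
wlog xy : x y xs ys gx gy / index x s <= index y s => [h|].
  have [le|/ltnW le] := leqP (index x s) (index y s); first exact: h.
  by apply/esym; apply: h.
set a := index x s in xy; set b := index y s in xy.
have an : a < size s by rewrite index_mem.
have bn : b < size s by rewrite index_mem.
have xE : nth x s a = x by apply: nth_index.
have yE : nth x s b = y by apply: nth_index.
(* If the bad vertex lies between the two, go round the other way, through the edge that closes the
   cycle. *)
have [[t /andP[ta tb] bt]|h] := pselect (exists2 t, a < t < b & Some (nth x s t) = bad).
  have gd i : i < size s -> i != t -> good (nth x s i).
    by move=> im it; rewrite -bt; apply: contra it => /eqP [] /eqP; rewrite nth_uniq //; lia.
  have E1 : cl (nth x s 0) = cl x.
    rewrite -[x in RHS]xE; apply: (stepwise_const (u := fun t => cl (nth x s t))) => // i /andP[_ ia].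
    by apply: step; [rewrite /follows; lia|apply: gd; lia|apply: gd; lia].
  have E2 : cl y = cl (nth x s (size s).-1).
    rewrite -[y in LHS]yE; apply: (stepwise_const (u := fun t => cl (nth x s t))); first by lia.
    by move=> i ib; apply: step; [rewrite /follows; lia|apply: gd; lia|apply: gd; lia].
  rewrite E2 -E1; apply/esym; apply: step; [rewrite /follows|apply: gd|apply: gd]; lia.
rewrite -[x in LHS]xE -[y in RHS]yE; apply: (stepwise_const (u := fun t => cl (nth x s t))) => // i iab.
have gd j : a <= j <= b -> good (nth x s j).
  move=> jab; have [ja|ja] := eqVneq j a; first by rewrite ja xE.
  have [jb|jb] := eqVneq j b; first by rewrite jb yE.
  by apply/eqP => E; apply: h; exists j => //; lia.
by apply: step; [rewrite /follows; lia|apply: gd; lia|apply: gd; lia].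
Qed.

(** A single bad vertex blocks at most one of the two directions along the path. *)
Lemma path_minus_vertex (z : V) (s : seq V) : uniq (z :: s) ->
  (forall x0 j k, follows Path (size s).+1 j k -> good (nth x0 (z :: s) j) ->
     good (nth x0 (z :: s) k) -> cl (nth x0 (z :: s) j) = cl (nth x0 (z :: s) k)) ->
  forall x, x \in z :: s -> good x ->
    exists y, [/\ (y == z) || (y == last z s), good y & cl x = cl y].
Proof.
move=> us step x xs gx; set w := z :: s in us step xs.
have szw : size w = (size s).+1 by [].
set a := index x w; have an : a < size w by rewrite index_mem.
have xE : nth x w a = x by apply: nth_index.
have [[t ta bt]|h] := pselect (exists2 t, t < a & Some (nth x w t) = bad).
  have gd i : i < size w -> i != t -> good (nth x w i).
    by move=> im it; rewrite -bt; apply: contra it => /eqP [] /eqP; rewrite nth_uniq //; lia.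
  have lE : nth x w (size s) = last z s by rewrite -[size s]/((size w).-1) nth_last.
  exists (last z s); rewrite eqxx orbT -lE; split=> //; first by apply: gd; lia.
  rewrite -[x in LHS]xE; apply: (stepwise_const (u := fun t => cl (nth x w t))); first by lia.
  by move=> i ib; apply: step; [rewrite /follows; lia|apply: gd; lia|apply: gd; lia].
have gd j : j <= a -> good (nth x w j).
  rewrite leq_eqVlt => /orP[/eqP ->|ja]; first by rewrite xE.
  by apply/eqP => E; apply: h; exists j.
exists z; rewrite eqxx; split=> //; first exact: (gd 0).
rewrite -[x in LHS]xE; apply/esym; apply: (stepwise_const (u := fun t => cl (nth x w t)) (a := 0)) => //.
by move=> i ib; apply: step; [rewrite /follows; lia|apply: gd; lia|apply: gd; lia].
Qed.

(** Induction on the number of ears: a vertex of the last ear slides along it to a good endpoint,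
    which lies on an earlier ear. *)
Lemma ear_decomposition_minus_vertex (es : seq (ear V)) :
  ear_decomposition es -> is_proper es ->
  (forall x0 i j k, i < size es ->
     follows (ear_at es i).1 (size (ear_at es i).2) j k ->
     good (nth x0 (ear_at es i).2 j) -> good (nth x0 (ear_at es i).2 k) ->
     cl (nth x0 (ear_at es i).2 j) = cl (nth x0 (ear_at es i).2 k)) ->
  forall i i' x y, i < size es -> i' < size es -> x \in (ear_at es i).2 ->
    y \in (ear_at es i').2 -> good x -> good y -> cl x = cl y.
Proof.
move=> [[es0 cyc] ears ends] prop step.
have isear i : i < size es -> is_ear (ear_at es i) by move=> ie; apply: (all_nthP _ ears).
suff H m : m <= size es -> forall i i' x y, i < m -> i' < m -> x \in (ear_at es i).2 ->
    y \in (ear_at es i').2 -> good x -> good y -> cl x = cl y.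
  by move=> i i' x y; apply: (H (size es)).
elim: m => // m IH me.
have {}IH := IH (ltnW me).
have [m0|m0] := posnP m.
  rewrite m0 => -[|i] [|i'] // x y _ _; apply: cycle_minus_vertex.
    by have /andP[] := isear 0 es0.
  by move=> x0 j k f; apply: step => //; rewrite cyc.
have new x : x \in (ear_at es m).2 -> good x ->
    exists i y, [/\ i < m, y \in (ear_at es i).2, good y & cl x = cl y].
  have mm : 0 < m < size es by rewrite m0.
  have path := prop m mm; have := ends m; have := isear m me.
  have := step ^~ m; move: path; case: (ear_at es m) => sh [|z s] //= -> st.
  move=> /andP[/= us _] en xs gx.
  have [|y [yE gy xy]] := path_minus_vertex us _ xs gx.
    by move=> x0 j k; apply: st.
  have [|_ [|j jm yj]] := en y mm.
  - by case/orP: yE => /eqP ->; rewrite ?mem_head ?mem_last.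
  - exact: yE.
  by exists j, y.
move=> i i' x y; rewrite !ltnS (leq_eqVlt i) (leq_eqVlt i').
case/orP=> [/eqP ->|im]; case/orP=> [/eqP ->|im'] xi yi gx gy.
- have [j [z [jm zj gz ->]]] := new x xi gx; have [k [t [km tk gt ->]]] := new y yi gy.
  exact: IH jm km _ _ _ _.
- have [j [z [jm zj gz ->]]] := new x xi gx; exact: IH jm im' _ _ _ _.
- have [j [z [jm zj gz ->]]] := new y yi gy; exact: IH im jm _ _ _ _.
- exact: IH im im' _ _ _ _.
Qed.

End Unavoidable.

(** * A proper decomposition forces 2-connectedness *)

Section DecompositionImpliesConnected.
Variables (Gamma : sgraph) (D : amalgam).
Hypothesis decD : proper_raag_ear_decomposition Gamma D.
Notation A := (raag Gamma).
Notation es := (glued_ears D).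

Lemma decomposition_frame : exists elt : nat * nat -> A,
  [/\ forall i j k, efollows es i j k ->
        commute (elt (name es (i, j))) (elt (name es (i, k))),
      forall f : nat * nat -> bool, exists h : {multiplicative A -> B2},
        forall a, position es a -> h (elt (name es a)) = f (name es a) &
      forall h : {multiplicative A -> B2},
        (forall a, position es a -> h (elt (name es a)) = 1) -> forall x, h x = 1].
Proof.
have [[wf /isogP [f [g [fK gK]]] _] _] := decD.
have wf' : amalgam_wf (Amalgam (first_ear D) (later_ears D)) by case: (D) wf.
have [I _ _] := amalgam_inv_state wf' (fun i _ => free_for_B2 _).
have DE : Amalgam (first_ear D) (later_ears D) = D by case: (D).
rewrite DE in I.
set X := amalgam_state _ _ in I; rewrite -/(pgroup X) in f g fK gK.
have [_ _ _ Icons Icomm Iex Iuni] := I.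
(* On names the value does not depend on the position, by [inv_consistent]; elsewhere it is the
   default 1. *)
pose elt x : A := xget 1 [set y | exists a, [/\ position es a, name es a = x &
  y = f (pearl_at X a)]].
have eltE a : position es a -> elt (name es a) = f (pearl_at X a).
  move=> pa; rewrite /elt; case: xgetP => [y _ [b [pb ba ->]]|/(_ (f (pearl_at X a)))].
    by congr (f _); apply: Icons.
  by case; exists a.
exists elt; split.
- move=> i j k fl; have /andP[ie fl'] := fl; have /andP[jn kn] := follows_lt fl'.
  by rewrite !eltE /position ?ie //=; apply: hom_commute; apply: Icomm.
- move=> u; have [|h hE] := Iex (fun x => u x : B2); first by move=> *; apply: B2C.
  exists (h \o g) => a pa; rewrite eltE //= fK hE //.
- move=> h h1 x; rewrite -(gK x).
  apply: (Iuni (h \o f) (mk_hom (fun _ _ => esym (mulg1 (1 : B2))))) => a pa /=.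
  by rewrite -eltE // h1.
Qed.

Lemma glued_ear0 : [/\ 0 < size es, is_ear (ear_at es 0) & (ear_at es 0).1 = Cycle].
Proof.
have [[_ _ [[es0 cyc] ears _]] _] := decD.
by split=> //; apply: (all_nthP _ ears).
Qed.

Lemma name_nth i j : i < size es -> j < size (ear_at es i).2 -> forall x0,
  position es (i, j) /\ name es (i, j) = nth x0 (ear_at es i).2 j.
Proof.
move=> ie je x0; split; first by rewrite /position ie.
exact: set_nth_default.
Qed.

(** The first cycle has three distinct names, on which maps to [B2] can be prescribed freely, while
    such maps are determined by their values on the vertices. So 2 to the power 3 is at most 2 to
    the number of vertices. *)
Lemma decomposition_card : 2 < #|Gamma|.
Proof.
have [elt [_ ext _]] := decomposition_frame.
have [es0 ear0 cyc] := glued_ear0.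
move: ear0; rewrite /is_ear cyc => /andP[us sz].
pose nm (j : 'I_3) := name es (0, j : nat).
have nm_lt (j : 'I_3) : j < size (ear_at es 0).2 by apply: leq_trans sz.
have nmP (j : 'I_3) : position es (0, j : nat) by rewrite /position es0 nm_lt.
have nmI : injective nm.
  move=> i j; have [_ Ei] := name_nth es0 (nm_lt i) (0, 0).
  have [_ Ej] := name_nth es0 (nm_lt j) (0, 0).
  by rewrite /nm Ei Ej => /eqP; rewrite nth_uniq // => /eqP /val_inj.
have [h hE] : {h : {ffun 'I_3 -> bool} -> {multiplicative A -> B2} &
    forall F j, h F (elt (nm j)) = F j}.
  apply: (@choice _ _ (fun (F : {ffun 'I_3 -> bool}) (h : {multiplicative A -> B2}) =>
    forall j, h (elt (nm j)) = F j)) => F.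
  have [h hE] := ext (fun x => [exists j, (nm j == x) && F j]).
  exists h => j; rewrite hE //; apply/existsP/idP => [[k /andP[/eqP /nmI -> //]]|Fj].
  by exists j; rewrite eqxx.
pose M (F : {ffun 'I_3 -> bool}) : {ffun Gamma -> bool} := [ffun v => h F (vtx v)].
have MI : injective M.
  move=> F F' E; have hF : h F =1 h F'.
    apply: raag_ext => v.
    by have := congr1 (fun F : {ffun Gamma -> bool} => F v) E; rewrite !ffunE.
  by apply/ffunP => j; rewrite -!hE hF.
have := leq_card _ MI; rewrite !card_ffun card_bool card_ord.
by rewrite leq_exp2l.
Qed.

Section Cut.
Variables (S : {set Gamma}) (a0 b0 : Gamma).
Hypotheses (S1 : #|S| < 2) (a0S : a0 \notin S) (b0S : b0 \notin S).
Let e := [rel u v | [&& u \notin S, v \notin S & adj u v]].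
Hypothesis nab : ~~ connect e a0 b0.

Let inA u := (u \notin S) && connect e a0 u.
Let inB u := (u \notin S) && ~~ connect e a0 u.

Lemma cut_separates a b : inA a -> inB b -> (a != b) && ~~ adj a b.
Proof.
move=> /andP[aS ca] /andP[bS cb]; apply/andP; split.
  by apply: contraNneq cb => <-.
apply: contra cb => ab; apply: (connect_trans ca); apply: connect1.
by rewrite /e /= aS bS.
Qed.

Lemma cut_contradiction : False.
Proof.
have [elt [comm ext spn]] := decomposition_frame.
have a0A : inA a0 by rewrite /inA a0S connect0.
have b0B : inB b0 by rewrite /inB b0S nab.
(* [al x] and [be x] say that the coordinates of [elt x] in the two parts do not all
   vanish; [bad x] that [elt x] is supported on [S]. *)
pose c u x : bool := chi u (elt x).
pose al x := [exists u, inA u && c u x].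
pose be x := [exists u, inB u && c u x].
have alP x u : inA u -> c u x -> al x by move=> uA cu; apply/existsP; exists u; rewrite uA.
have beP x u : inB u -> c u x -> be x by move=> uB cu; apply/existsP; exists u; rewrite uB.
pose bad x := ~~ al x && ~~ be x.
have bad0 x u : bad x -> u \notin S -> c u x = false.
  move=> /andP[nal nbe] uS; apply: contraNF nal => cu.
  have [ca|ca] := boolP (connect e a0 u); first by apply: (alP _ u); rewrite ?/inA ?uS.
  by case/negP: nbe; apply: (beP _ u); rewrite ?/inB ?uS.
(* Elements supported on [S] are nonzero modulo 2, and as [S] has at most one vertex, they have
   equal coordinates. But distinct names are separated by some map to [B2]. *)
have bad_unique p q : position es p -> position es q -> bad (name es p) ->
    bad (name es q) -> name es p = name es q.
  move=> pp pq bp bq; apply/eqP; apply: contraT => npq.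
  have nz r : position es r -> bad (name es r) -> exists2 s, s \in S & c s (name es r).
    move=> pr br; apply: contrapT => h.
    have [f fE] := ext (fun=> true); have := fE r pr.
    rewrite (@hom_B2_chi _ f _ 1) ?hom1 // => u; rewrite hom1.
    have [uS|uS] := boolP (u \in S); last exact: bad0.
    by case E: (chi u _) => //; case: h; exists u => //; rewrite /c E.
  have [s sS cs] := nz p pp bp; have [t tS ct] := nz q pq bq.
  have ts : t = s by apply: (card_le1_eqP S1).
  have [f fE] := ext (fun x => x == name es p).
  have := fE q pq; rewrite (@hom_B2_chi _ f _ (elt (name es p))).
    by rewrite fE // eqxx eq_sym (negPf npq).
  move=> u; rewrite -[chi u _]/(c u _) -[chi u _]/(c u _).
  have [uS|uS] := boolP (u \in S); last by rewrite !bad0.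
  have -> : u = s by apply: (card_le1_eqP S1).
  by rewrite cs -ts ct.
have edge g h : ~~ bad g -> ~~ bad h -> commute (elt g) (elt h) ->
    [/\ al g -> al h, be g -> be h &
        al g -> be g -> al h -> be h -> c a0 g = c a0 h /\ c b0 g = c b0 h].
  move=> ng nh gh.
  (* The tensor product of the A-part of [g] with the B-part of [h] equals that of the A-part of [h]
     with the B-part of [g]. Over two elements, a nonzero pure tensor determines its factors. *)
  have det a b : inA a -> inB b -> c a g && c b h = c a h && c b g.
    move=> aA bB; have /andP[ab nadj] := cut_separates aA bB.
    exact: commute_chi gh.
  split.
  - move=> /existsP [a /andP[aA ca]]; apply: contraT => nal.
    move: nh; rewrite /bad nal negbK => /existsP [b /andP[bB cb]].
    have := det a b aA bB; rewrite ca cb => /esym /andP[/(alP _ _ aA)].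
    by rewrite (negPf nal).
  - move=> /existsP [b /andP[bB cb]]; apply: contraT => nbe.
    move: nh; rewrite /bad nbe andbT negbK => /existsP [a /andP[aA ca]].
    have := det a b aA bB; rewrite ca cb => /andP[_ /(beP _ _ bB)].
    by rewrite (negPf nbe).
  - move=> /existsP [a /andP[aA ca]] /existsP [b /andP[bB cb]].
    move=> /existsP [a' /andP[aA' ca']] /existsP [b' /andP[bB' cb']].
    split; apply/idP/idP => h0.
    + by have := det a0 b' a0A bB'; rewrite h0 cb' => /esym /andP[].
    + by have := det a0 b a0A bB; rewrite h0 cb => /andP[].
    + by have := det a' b0 aA' b0B; rewrite h0 ca' => /andP[].
    + by have := det a b0 aA b0B; rewrite h0 ca => /esym /andP[].
(* The coordinates at [a0] and [b0] are masked because an edge preserves them only when both parts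
   are nonzero. *)
pose cl x := (al x, be x, al x && be x && c a0 x, al x && be x && c b0 x).
have cl_edge g h : ~~ bad g -> ~~ bad h -> commute (elt g) (elt h) -> cl g = cl h.
  move=> ng nh gh; have [E1 E2 E3] := edge g h ng nh gh.
  have [E1' E2' _] := edge h g nh ng (commute_sym gh).
  have alE : al g = al h by apply/idP/idP.
  have beE : be g = be h by apply/idP/idP.
  rewrite /cl -alE -beE; case gal: (al g) => //; case gbe: (be g) => //.
  by have [||||-> ->] := E3; rewrite -?alE -?beE.
have [t tP] : exists t : option (nat * nat), forall p, position es p ->
    bad (name es p) = (Some (name es p) == t).
  have [[p pp bp]|h] := pselect (exists2 p, position es p & bad (name es p)).
    exists (Some (name es p)) => q pq; apply/idP/eqP => [bq|[->] //].
    by congr Some; apply: bad_unique.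
  by exists None => p pp; apply/negP => bp; apply: h; exists p.
have [[_ _ dec] prop] := decD.
have cl_const p q : position es p -> position es q -> ~~ bad (name es p) ->
    ~~ bad (name es q) -> cl (name es p) = cl (name es q).
  move=> pp pq; rewrite !tP // => np nq.
  have mem r : position es r -> r.1 < size es /\ name es r \in (ear_at es r.1).2.
    by move=> /andP[ie je]; split=> //; apply: mem_nth.
  have [ip mp] := mem p pp; have [iq mq] := mem q pq.
  apply: (ear_decomposition_minus_vertex dec prop _ ip iq mp mq np nq).
  move=> x0 i j k ie fl; have /andP[jn kn] := follows_lt fl.
  have [pj <-] := name_nth ie jn x0; have [pk <-] := name_nth ie kn x0.
  rewrite -!tP // => nj nk; apply: cl_edge => //.
  by apply: comm; rewrite /efollows ie.
have kills u : u \notin S -> exists2 p, position es p & c u (name es p).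
  move=> uS; apply: contrapT => h.
  have := spn (chi u) _ (vtx u); rewrite chi_vtx eqxx => /(_ _) E.
  suff : true = 1 :> B2 by [].
  apply: E => p pp; case E: (chi u _) => //; case: h; exists p => //.
have [p pp cp] := kills a0 a0S; have [q pq cq] := kills b0 b0S.
have alp : al (name es p) := alP _ _ a0A cp.
have beq : be (name es q) := beP _ _ b0B cq.
have np : ~~ bad (name es p) by rewrite /bad alp.
have nq : ~~ bad (name es q) by rewrite /bad beq andbF.
have [E1 E2 _ _] := cl_const p q pp pq np nq.
(* By constancy every element that is not bad has coordinate 1 at both [a0] and [b0], whereas a bad
   one has 0 at both. So the sum of the two coordinates kills all elements, but not the vertex
   [a0]. *)
have := spn (hom_mul (chi a0) (chi b0)) _ (vtx a0).
rewrite /hom_mul /= !chi_vtx eqxx => E.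
suff : (true : B2) * (a0 == b0 : B2) = 1.
  by have /andP[/negPf -> _] := cut_separates a0A b0B.
apply: E => r pr; rewrite -[chi a0 _]/(c a0 _ : B2) -[chi b0 _]/(c b0 _ : B2).
have [br|nr] := boolP (bad (name es r)); first by rewrite !bad0.
have [F1 F2 F3 _] := cl_const p r pp pr np nr.
have [G1 G2 _ G4] := cl_const q r pq pr nq nr.
move: F3 G4; rewrite -F1 -G2 -E1 alp beq E2 beq cp cq /= => <- <-.
by [].
Qed.

End Cut.

Lemma decomposition_connected : vertex_connected 2 Gamma.
Proof.
split; first exact: decomposition_card.
move=> S S1 x y xS yS; apply: contraT => nxy.
by case: (cut_contradiction S1 xS yS nxy).
Qed.

End DecompositionImpliesConnected.

(** * Vertices of an ear as pearls *)

Lemma d_eq (G : groupType) n : generated_by G n ->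
  (forall m, generated_by G m -> n <= m) -> d G = n.
Proof.
move=> Gn nmin; rewrite /d; case: xgetP => [k _ [Gk kmin]|/(_ n)].
  by apply/eqP; rewrite eqn_leq kmin // nmin.
by case; split.
Qed.

Lemma generated_by_isog (G H : groupType) n : isog G H -> generated_by G n -> generated_by H n.
Proof.
move=> /isogP [f [g [fK gK]]] [s sG]; exists (map_tuple f s).
apply/seteqP; split=> // x _; rewrite -(gK x).
have /(gen_image (f := f)) : gen [set` s] (g x) by rewrite sG.
apply: genS => _ [y ys <-] /=; exact: map_f.
Qed.

Lemma d_isog (G H : groupType) : isog G H -> d G = d H.
Proof.
move=> GH; rewrite /d; congr xget; apply/seteqP.
have E n : generated_by G n <-> generated_by H n.
  by split; apply: generated_by_isog => //; apply: isog_sym.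
by split=> n /= [/E Gn h]; split=> // m /E; apply: h.
Qed.

(** For the lower bound, maps to [B2] are determined by their values on any generating tuple, and
    there is one for each function on the vertices. *)
Lemma d_raag (Gamma : sgraph) : d (raag Gamma) = #|Gamma|.
Proof.
apply: d_eq => [|m [t tG]].
  exists (map_tuple (@vtx Gamma) (enum_tuple Gamma)); apply/seteqP; split=> // x _.
  move: x; apply: raag_ind; first exact: gen_subgroup.
  by move=> v; apply: sub_gen => /=; apply: map_f; rewrite mem_enum.
pose M (F : {ffun Gamma -> bool}) : {ffun 'I_m -> bool} :=
  [ffun i => raag_lift2 F (tnth t i)].
have MI : injective M.
  move=> F F' E; apply/ffunP => v.
  rewrite -[LHS](raag_lift2_vtx F) -[RHS](raag_lift2_vtx F').
  have : [set: raag Gamma] (vtx v) by [].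
  rewrite -tG; move: (vtx v).
  apply: (gen_hom_ext (f := raag_lift2 F) (g := raag_lift2 F')) => x /= /tnthP [i ->].
  by have := congr1 (fun F : {ffun 'I_m -> bool} => F i) E; rewrite !ffunE.
have := leq_card _ MI; rewrite !card_ffun card_bool card_ord.
by rewrite leq_exp2l.
Qed.

Lemma raag_quotient_vertex (Gamma Delta : sgraph) (v : Gamma) (i : Delta -> Gamma) :
  injective i -> (forall u, i u != v) -> (forall w, w != v -> exists u, i u = w) ->
  (forall a b, adj (i a) (i b) = adj a b) ->
  isog (raag Gamma // [set vtx v]) (raag Delta).
Proof.
move=> iI iv isur iadj.
pose k u : raag Delta := if [pick a | i a == u] is Some a then vtx a else 1.
have ki a : k (i a) = vtx a.
  by rewrite /k; case: pickP => [b /eqP /iI ->//|/(_ a)]; rewrite eqxx.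
have kv : k v = 1.
  by rewrite /k; case: pickP => // a /eqP E; have := iv a; rewrite E eqxx.
have [a b ab|f fE] := @raag_lift Gamma _ k.
  have [->|/isur [a' a'E]] := eqVneq a v; first by rewrite kv; apply/commute_sym/commute1.
  have [->|/isur [b' b'E]] := eqVneq b v; first by rewrite kv; apply/commute1.
  by rewrite -a'E -b'E !ki; apply: vtx_commute; rewrite -iadj a'E b'E.
have [x ->|f' f'E] := @quot_lift _ [set vtx v] _ f; first by rewrite fE kv.
pose q := quot_hom [set vtx v].
have [a b ab|g gE] := @raag_lift Delta _ (fun a => q (vtx (i a))).
  by apply: hom_commute; apply: vtx_commute; rewrite iadj.
apply/isogP; exists f', g; split=> x.
  apply: (quot_ext (f := g \o f') (g := idfun)) => y /=; rewrite f'E.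
  apply: (raag_ext (f := g \o f) (g := q)) => u /=; rewrite fE.
  have [->|/isur [a <-]] := eqVneq u v; last by rewrite ki gE.
  by rewrite kv hom1; apply/esym/quotg_pi_rel.
apply: (raag_ext (f := f' \o g) (g := idfun)) => a /=.
by rewrite gE /q ?quot_homE f'E fE ki.
Qed.

Section InducedSubgraph.
Variables (Gamma : sgraph) (P : pred Gamma).

Definition sub_adj : rel {u : Gamma | P u} := fun a b => adj (val a) (val b).

Lemma sub_adj_sym : symmetric sub_adj. Proof. by move=> a b; apply: adj_sym. Qed.
Lemma sub_adj_irr : irreflexive sub_adj. Proof. by move=> a; apply: adj_irr. Qed.

Definition induced : sgraph := SGraph sub_adj_sym sub_adj_irr.

End InducedSubgraph.

Definition zpow (G : groupType) (g : G) (z : int) : G :=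
  match z with Posz k => g ^+ k | Negz k => g ^- k.+1 end.

Lemma zpowS (G : groupType) (g : G) (z : int) : zpow g (z + 1)%R = zpow g z * g.
Proof.
case: z => [k|[|k]]; first by rewrite -PoszD addn1 /= expgSr.
  by rewrite /= expg1 mulVg.
have -> : (Negz k.+1 + 1)%R = Negz k by lia.
rewrite /= [in RHS]expgS invgM mulgVK //.
Qed.

Lemma zpow_morph (G : groupType) (g : G) : {morph (zpow g : infinite_cyclic -> G) : x y / x * y}.
Proof.
move=> x y; rewrite -[x * y]/(x + y : int)%R; elim/int_rec: y => [|n IH|n IH].
- by rewrite addr0 mulg1.
- by rewrite -addn1 PoszD addrA !zpowS IH mulgA.
- apply: (@mulIg _ g); rewrite -mulgA -!zpowS -addrA.
  have -> : @eq int (- Posz n.+1 + 1)%R (- Posz n)%R by lia.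
  exact: IH.
Qed.

Lemma infinite_cyclic_ext (G : groupType) (f g : {multiplicative infinite_cyclic -> G}) :
  f (1%R : int) = g (1%R : int) -> f =1 g.
Proof.
move=> fg x; elim/int_rec: x => [|n IH|n IH].
- by rewrite (hom1 f) (hom1 g).
- rewrite -addn1 PoszD -[(_ + _)%R]/((Posz n : infinite_cyclic) * (1%R : int)).
  by rewrite !gmulfM IH fg.
- pose m : int := (- Posz n)%R.
  have -> : @eq int (- Posz n.+1)%R ((m : infinite_cyclic) * (1%R : infinite_cyclic)^-1).
    by rewrite -[RHS]/(m - 1)%R /m; lia.
  rewrite !gmulfM !(homV _ (1%R : infinite_cyclic)) fg.
  exact: (congr1 (fun y => y / _) IH).
Qed.

Lemma raag_quotient_leaf (Gamma : sgraph) (u v : Gamma) : link u = [set v]%SET ->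
  isog (raag Gamma // [set vtx v])
    (free_prod (raag (induced [pred w | (w != u) && (w != v)])) infinite_cyclic).
Proof.
move=> lu; set Delta := induced _; set F := free_prod _ _.
have uv : u != v.
  apply/eqP => uv; have : v \in link u by rewrite lu inE.
  by rewrite inE uv adj_irr.
have adju w : adj u w = (w == v) by have := congr1 (fun S => w \in (S : {set Gamma})) lu; rewrite !inE.
pose k w : F := if w == u then inj_r (raag Delta) (1%R : infinite_cyclic) else
  if insub w is Some a then inj_l infinite_cyclic (vtx (a : Delta)) else 1.
have kv : k v = 1.
  by rewrite /k eq_sym (negPf uv) insubF //= eqxx andbF.
have ku : k u = inj_r _ (1%R : infinite_cyclic) by rewrite /k eqxx.
have ki (a : Delta) : k (val a) = inj_l _ (vtx a).
  by have /andP[au _] := valP a; rewrite /k (negPf au) valK.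
have kC w w' : adj w w' -> commute (k w) (k w').
  have [->|wv] := eqVneq w v; first by rewrite kv => _; apply/commute_sym/commute1.
  have [->|wv'] := eqVneq w' v; first by rewrite kv => _; apply/commute1.
  have [->|wu] := eqVneq w u; first by rewrite adju (negPf wv').
  have [->|wu'] := eqVneq w' u; first by rewrite adj_sym adju (negPf wv).
  have wP : (w != u) && (w != v) by rewrite wu.
  have wP' : (w' != u) && (w' != v) by rewrite wu'.
  move=> ww; rewrite -[w]/(val (Sub w wP : Delta)) -[w']/(val (Sub w' wP' : Delta)) !ki.
  apply: (hom_commute (injl_hom _ _)); exact: vtx_commute.
have [f fE] := raag_lift kC.
have [x ->|f' f'E] := @quot_lift _ [set vtx v] _ f; first by rewrite fE kv.
pose q := quot_hom [set vtx v].
have [a b ab|g1 g1E] := @raag_lift Delta _ (fun a => q (vtx (val a))).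
  by apply: hom_commute; apply: vtx_commute.
have [g [gl gr]] := free_prod_lift g1 (mk_hom (@zpow_morph _ (q (vtx u)))).
apply/isogP; exists f', g; split=> x.
  apply: (quot_ext (f := g \o f') (g := idfun)) => y /=; rewrite f'E.
  apply: (raag_ext (f := g \o f) (g := q)) => w /=; rewrite fE.
  have [->|wv] := eqVneq w v; first by rewrite kv hom1; apply/esym/quotg_pi_rel.
  have [->|wu] := eqVneq w u; first by rewrite ku gr /= expg1.
  have wP : (w != u) && (w != v) by rewrite wu.
  by rewrite -[w]/(val (Sub w wP : Delta)) ki gl g1E.
apply: (free_prod_ext (f := f' \o g) (g := idfun)) => y /=.
  rewrite gl; apply: (raag_ext (f := f' \o g1) (g := injl_hom _ _)) => a /=.
  by rewrite g1E /q ?quot_homE f'E fE ki.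
rewrite gr /=; pose z := mk_hom (@zpow_morph _ (q (vtx u))).
apply: (infinite_cyclic_ext (f := f' \o z) (g := injr_hom _ _)) => /=.
by rewrite expg1 /q ?quot_homE f'E fE ku.
Qed.

Section VertexPearls.
Variable Gamma : sgraph.
Implicit Types (u v w a b : Gamma).

Lemma commute_vtxP a b : a != b -> commute (vtx a) (vtx b) -> adj a b.
Proof.
move=> ab cab; apply: contraT => nab.
have := commute_chi ab nab cab.
by rewrite !chi_vtx !eqxx eq_sym (negPf ab).
Qed.

Lemma cent_vtx2 v a b : link v = [set a; b]%SET ->
  cent (vtx v) = gen [set vtx a; vtx v; vtx b].
Proof.
move=> lv; rewrite cent_vtx /par; congr gen; apply/seteqP; split=> x.
  move=> [u + ->]; rewrite in_setU1 lv !inE.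
  by move=> /or3P[]/eqP ->; [left; right|left; left|right].
by move=> [[->|->]|->]; [exists a|exists v|exists b] => //;
  rewrite in_setU1 lv !inE eqxx ?orbT.
Qed.

Lemma vtx_neq1 v : vtx v <> 1.
Proof. by move=> /(congr1 (chi v)); rewrite hom1 chi_vtx eqxx. Qed.

Section TwoLinks.
Variables (v a b : Gamma).
Hypotheses (lv : link v = [set a; b]%SET) (ab : a != b) (nab : ~~ adj a b).

Lemma cent_vtx_nonabelian : ~ abelian_set (cent (vtx v)).
Proof.
move=> h; have := nab; rewrite (commute_vtxP ab) //.
by apply: h; rewrite cent_vtx; apply: par_vtx; rewrite in_setU1 lv !inE eqxx ?orbT.
Qed.

(** A central element commutes with [a] and [b] too, so it lies in the parabolic subgroup of the
    intersection of three stars. This is [v] alone, as [a] and [b] are distinct and not adjacent. *)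
Lemma center_cent_vtx : gen [set vtx v] = center_of (cent (vtx v)).
Proof.
apply/seteqP; split=> [x /gen1P [c [k ->]]|z [zv zC]].
  have h y : cent (vtx v) y -> commute (spow (vtx v) c k) y.
    by move=> /centP vy; apply/commute_sym/commute_spow/commute_sym.
  split=> //; apply/centP; apply: commute_spow; exact: commute_refl.
rewrite cent_vtx in zv.
have zin w : w \in link v -> par (w |: link w) z.
  move=> wl; rewrite -cent_vtx; apply/centP; apply: commute_sym; apply: zC.
  by rewrite cent_vtx; apply: par_vtx; rewrite in_setU1 wl orbT.
have za := zin a _; have zb := zin b _; rewrite lv !inE !eqxx ?orbT in za zb.
have : par [set v] z.
  apply: parS (parI zv (parI (za isT) (zb isT))); apply/subsetP => u.
  rewrite in_set1 !in_setI !in_setU1 lv in_set2.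
  case: (eqVneq u v) => //= _ /and3P[/orP[]/eqP -> h1 h2].
    by move: h2; rewrite (negPf ab) inE adj_sym (negPf nab).
  by move: h1; rewrite eq_sym (negPf ab) inE (negPf nab).
by move=> /par_set1P h; apply/gen1P.
Qed.

Lemma vtx_inner_pearl : inner_pearl (vtx v).
Proof.
split; [exact: vtx_neq1|exact: cent_vtx_nonabelian|exact: center_cent_vtx].
Qed.

End TwoLinks.

Lemma vtx_end_triple u v w t : link u = [set v]%SET -> link v = [set u; w]%SET ->
  link w = [set v; t]%SET -> u != w -> v != t -> ~~ adj v t ->
  end_triple (vtx u) (vtx v) (vtx w).
Proof.
move=> lu lv lw uw vt nvt.
have nuw : ~~ adj u w.
  have := congr1 (fun S => w \in (S : {set Gamma})) lu; rewrite !inE => ->.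
  apply: contraTneq uw => wv; have : w \in link v by rewrite lv !inE eqxx orbT.
  by rewrite wv inE adj_irr.
split; first split.
- exact: vtx_inner_pearl lv uw nuw.
- exact: vtx_inner_pearl lw vt nvt.
- apply/eqP/commgP; apply: vtx_commute.
  by have : w \in link v by [rewrite lv !inE eqxx orbT]; rewrite inE.
- exists (vtx u); split.
    apply/eqP/commgP; apply: vtx_commute.
    by have : u \in link v by [rewrite lv !inE eqxx]; rewrite inE.
  move=> /eqP /commgP /commute_sym /(commute_vtxP uw).
  by rewrite (negPf nuw).
- exact: cent_vtx2 lv.
exists (raag (induced [pred x | (x != u) && (x != v)])), infinite_cyclic.
by split; [exact: isog_refl|exact: raag_quotient_leaf].
Qed.

End VertexPearls.

(** Generation has to be moved from the subset [cent x] of [G] to the group [cent_group x]. The set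
    [K] of elements of [G] with a lift whose class is generated does this. *)
Lemma cent_quotient_generated (G : groupType) (y x z : G) :
  cent x = gen [set y; x; z] ->
  let C := cent_group x in let X := [set c : C | val c = x] in
  gen [set quotg_pi X c | c in [set c : C | val c = y \/ val c = z]] = classical_sets.setT.
Proof.
move=> cE C X; apply/seteqP; split=> // q _; have [c ->] := quotg_pi_sur q.
set T := gen _; have [T1 TM TV] : is_subgroup T by exact: gen_subgroup.
pose K : set G := [set w | exists c : C, val c = w /\ T (quotg_pi X c)].
have sK : is_subgroup K.
  split.
  - by exists 1; split=> //; rewrite -quot_homE hom1.
  - move=> _ _ [a [<- Ta]] [b [<- Tb]]; exists (a * b); split=> //.
    by rewrite -quot_homE gmulfM; apply: TM.
  - move=> _ [a [<- Ta]]; exists a^-1; split=> //.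
    by rewrite -quot_homE homV; apply: TV.
have cin w : gen [set y; x; z] w -> cent_pred x w by rewrite -cE.
have Kg : gen [set y; x; z] `<=` K.
  apply: gen_min => // w wE; have cw : cent_pred x w by apply: cin; apply: sub_gen.
  have sK' : val (Sub w cw : C) = w by exact: SubK.
  exists (Sub w cw : C); split=> //; case: wE => [[wE|wE]|wE].
  - apply: sub_gen; exists (Sub w cw : C); last by [].
    by left; rewrite sK'; exact: wE.
  - by rewrite quotg_pi_rel // /X /= sK'; exact: wE.
  - apply: sub_gen; exists (Sub w cw : C); last by [].
    by right; rewrite sK'; exact: wE.
have [c' [/val_inj -> //]] : K (val c) by apply: Kg; rewrite -cE; apply: (valP c).
Qed.

Definition std_chain (s : Defs.shape) n : n.-tuple (raag (ear_graph s n)) :=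
  [tuple vtx (i : ear_graph s n) | i < n].

Lemma tnth_std (s : Defs.shape) n (i : 'I_n) :
  tnth (std_chain s n) i = vtx (i : ear_graph s n).
Proof. exact: tnth_mktuple. Qed.

Lemma nth_std (s : Defs.shape) n (i : ear_graph s n) : (std_chain s n)`_i = vtx i.
Proof. by rewrite -[RHS](@tnth_std s n i) (tnth_nth 1). Qed.

Lemma int1_not_multiple : ~ is_multiple (1%R : infinite_cyclic).
Proof.
move=> [u [k [k2 E]]].
have {E} : @eq int 1%R (spow u false k) \/ @eq int 1%R (spow u true k) by [].
rewrite !int_spow => E; suff : k = 1%N by move=> k1; rewrite k1 in k2.
case: E => /(congr1 absz); rewrite !abszM /= mul1n => /esym/eqP;
by rewrite muln_eq1 => /andP[/eqP].
Qed.

(** [f] detects [p], and [g], which passes to the quotient by [p], detects [q]; the integer 1 is not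
    a multiple. *)
Lemma unimodular_pair_intro (G : groupType) (p q : G)
    (f g : {multiplicative G -> infinite_cyclic}) :
  f p = (1%R : int) -> g p = 1 -> g q = (1%R : int) -> unimodular_pair p q.
Proof.
move=> fp gp gq; split; first by move=> /(is_multiple_hom f); rewrite fp; apply: int1_not_multiple.
have [x ->|h hE] := @quot_lift _ [set p] _ g; first exact: gp.
by move=> /(is_multiple_hom h); rewrite hE gq; apply: int1_not_multiple.
Qed.

Lemma std_pearl_chain_path2 : pearl_chain (std_chain Path 2).
Proof.
pose v0 : ear_graph Path 2 := ord0; pose v1 : ear_graph Path 2 := ord_max.
have E0 : (std_chain Path 2)`_0 = vtx v0 by exact: (nth_std v0).
have E1 : (std_chain Path 2)`_1 = vtx v1 by exact: (nth_std v1).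
rewrite /pearl_chain E0 E1.
by apply: (@unimodular_pair_intro _ _ _ (zchi v0) (zchi v1)); rewrite zchi_vtx.
Qed.

Lemma std_pearl_chain_cycle3 : pearl_chain (std_chain Cycle 3).
Proof.
pose v0 : ear_graph Cycle 3 := ord0; pose v1 : ear_graph Cycle 3 := inord 1.
pose v2 : ear_graph Cycle 3 := ord_max.
have v1E : nat_of_ord v1 = 1%N by rewrite inordK.
have E0 : (std_chain Cycle 3)`_0 = vtx v0 by exact: (nth_std v0).
have E1 : (std_chain Cycle 3)`_1 = vtx v1 by rewrite -nth_std v1E.
have E2 : (std_chain Cycle 3)`_2 = vtx v2 by exact: (nth_std v2).
rewrite /pearl_chain E0 E1 E2; split.
  pose w (i : ear_graph Path 2) : ear_graph Cycle 3 := widen_ord (isT : 2 <= 3) i.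
  apply: (@raag_quotient_vertex _ _ v2 w).
  - by move=> i j /(congr1 val) /= /val_inj.
  - by move=> i; rewrite -val_eqE /=; have := ltn_ord i; case: eqP => // ->.
  - move=> u uv; have ul : u < 2.
      by have := ltn_ord u; move: uv; rewrite -val_eqE /=; lia.
    by exists (Ordinal ul); apply: val_inj.
  - move=> a b; rewrite cycle_adjE // path_adjE /=.
    by have := ltn_ord a; have := ltn_ord b; lia.
have [x ->|f fE] := @quot_lift _ [set vtx v2] _ (zchi v0); first by rewrite zchi_vtx.
have [x ->|g gE] := @quot_lift _ [set vtx v2] _ (zchi v1).
  by rewrite zchi_vtx -val_eqE /= v1E.
apply: (@unimodular_pair_intro _ _ _ f g); rewrite ?fE ?gE zchi_vtx ?eqxx //.
by rewrite -val_eqE /= v1E.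
Qed.

Section StdPath.
Variable m : nat.
Notation P := (ear_graph Path m.+1).
Notation pv := (fun i : nat => inord i : P).

Lemma path_link_in i : 0 < i < m -> link (pv i) = [set pv i.-1; pv i.+1]%SET.
Proof.
move=> im; apply/setP => u; rewrite !inE path_adjE -!val_eqE /= !inordK; lia.
Qed.

Lemma path_link_first : 0 < m -> link (pv 0) = [set pv 1%N]%SET.
Proof. by move=> m0; apply/setP => u; rewrite !inE path_adjE -!val_eqE /= !inordK; lia. Qed.

Lemma path_link_last : 0 < m -> link (pv m) = [set pv m.-1]%SET.
Proof.
move=> m0; apply/setP => u; rewrite !inE path_adjE -!val_eqE /= !inordK; last by lia.
  by have := ltn_ord u; lia.
by lia.
Qed.

Lemma pv_eq i j : i <= m -> j <= m -> (pv i == pv j) = (i == j).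
Proof. by move=> im jm; rewrite -val_eqE /= !inordK. Qed.

Lemma pv_adj i j : i <= m -> j <= m -> adj (pv i) (pv j) = (i.+1 == j) || (j.+1 == i).
Proof. by move=> im jm; rewrite path_adjE /= !inordK. Qed.

Lemma nth_std_path i : i <= m -> (std_chain Path m.+1)`_i = vtx (pv i).
Proof. by move=> im; rewrite -nth_std /= inordK. Qed.

Lemma path_inner_pearl i : 0 < i < m -> inner_pearl (vtx (pv i)).
Proof.
move=> im; apply: vtx_inner_pearl (path_link_in im) _ _.
  by rewrite pv_eq; lia.
by rewrite pv_adj; lia.
Qed.

End StdPath.

Lemma std_pearl_chain_path3 : pearl_chain (std_chain Path 3).
Proof.
rewrite /pearl_chain !nth_std_path //.
have lb := @path_link_in 2 1 isT.
have [nz nab cen] := @path_inner_pearl 2 1 isT.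
by split=> //; rewrite (cent_vtx2 lb).
Qed.

Lemma std_pearl_chain_path m : pearl_chain (std_chain Path m.+4).
Proof.
suff : [/\ end_triple (std_chain Path m.+4)`_0 (std_chain Path m.+4)`_1 (std_chain Path m.+4)`_2,
  end_triple (std_chain Path m.+4)`_(m.+3) (std_chain Path m.+4)`_(m.+2) (std_chain Path m.+4)`_(m.+1) &
  forall i, 2 <= i <= m.+1 -> inner_triple (std_chain Path m.+4)`_(i - 1)
    (std_chain Path m.+4)`_i (std_chain Path m.+4)`_(i + 1)] by [].
split.
- rewrite !nth_std_path //; apply: vtx_end_triple.
  + exact: path_link_first.
  + by rewrite path_link_in.
  + by rewrite path_link_in.
  + by rewrite pv_eq.
  + by rewrite pv_eq.
  + by rewrite pv_adj.
- rewrite !nth_std_path; try lia.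
  apply: (@vtx_end_triple (ear_graph Path m.+4) _ _ _ (inord m)).
  + exact: path_link_last.
  + by rewrite (@path_link_in m.+3 m.+2) ?leqnn // finset.setUC.
  + by rewrite (@path_link_in m.+3 m.+1) ?leqnn ?leqnSn // finset.setUC.
  + by rewrite pv_eq; lia.
  + by rewrite pv_eq; lia.
  + by rewrite pv_adj; lia.
- move=> i im; rewrite !nth_std_path; try lia.
  have im' : 0 < i < m.+3 by lia.
  have lk := path_link_in im'; rewrite subn1 addn1; split.
  + rewrite d_raag card_ord; lia.
  + by split; apply: path_inner_pearl; lia.
  + by split; rewrite cent_vtx; apply: par_vtx; rewrite in_setU1 lk !inE eqxx ?orbT.
  + exact: cent_quotient_generated (cent_vtx2 lk).
Qed.

Section StdCycle.
Variable n : nat.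
Hypothesis n4 : 4 <= n.
Notation C := (ear_graph Cycle n).

Lemma ord_pred_val (i : 'I_n) : (i + n).-1 %% n = if i == 0 :> nat then n.-1 else i.-1.
Proof.
have := ltn_ord i; case: (nat_of_ord i) => [|k] kn /=.
  by rewrite add0n modn_small //; lia.
by rewrite modnDr modn_small //; lia.
Qed.

Lemma cycle_link (i : C) : link i = [set (ord_pred i : C); (ordS i : C)]%SET.
Proof.
apply/setP => j; rewrite !inE cycle_adjE; last by lia.
rewrite -!val_eqE /= ordS_val ord_pred_val.
have := ltn_ord i; have := ltn_ord j; move: (nat_of_ord i) (nat_of_ord j) => a b lb la.
by case: ifP => /eqP; case: ifP => /eqP; lia.
Qed.

Lemma cycle_nbrs_neq (i : C) : (ord_pred i : C) != (ordS i : C).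
Proof.
rewrite -!val_eqE /= ordS_val ord_pred_val.
have := ltn_ord i; move: (nat_of_ord i) => a la.
by case: ifP => /eqP; case: ifP => /eqP; lia.
Qed.

Lemma cycle_nbrs_nadj (i : C) : ~~ adj (ord_pred i : C) (ordS i : C).
Proof.
rewrite cycle_adjE /=; last by lia.
rewrite ordS_val ord_pred_val.
have := ltn_ord i; move: (nat_of_ord i) => a la.
by case: ifP => /eqP; case: ifP => /eqP; lia.
Qed.

Lemma cycle_inner_pearl (i : C) : inner_pearl (vtx i).
Proof. exact: vtx_inner_pearl (cycle_link i) (cycle_nbrs_neq i) (cycle_nbrs_nadj i). Qed.

End StdCycle.

Lemma std_pearl_chain_cycle4 : pearl_chain (std_chain Cycle 4).
Proof.
move=> i; have lk := @cycle_link 4 isT i; rewrite !tnth_std.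
have [nz nab _] := @cycle_inner_pearl 4 isT i.
pose Delta := @induced (ear_graph Cycle 4) [pred u | u != i].
have iso : isog (raag (ear_graph Cycle 4) // [set vtx (i : ear_graph Cycle 4)]) (raag Delta).
  apply: (@raag_quotient_vertex (ear_graph Cycle 4) Delta i (fun u : Delta => val u)) => [|u|u ui|//]; first exact: val_inj.
    exact: (valP u).
  by exists (Sub u ui).
split=> //; first by rewrite (cent_vtx2 lk).
  by exists Delta.
rewrite (d_isog iso) !d_raag card_ord card_sig.
by rewrite -[#|_|]/(#|predC1 i|) cardC1 card_ord.
Qed.

Lemma std_pearl_chain_cycle m : pearl_chain (std_chain Cycle m.+4.+1).
Proof.
move=> i; rewrite !tnth_std; have n4 : 4 <= m.+4.+1 by [].
have lk := cycle_link n4 i; split.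
- by rewrite d_raag card_ord.
- by split; apply: cycle_inner_pearl.
- by split; rewrite cent_vtx; apply: par_vtx; rewrite in_setU1 lk !inE eqxx ?orbT.
- exact: cent_quotient_generated (cent_vtx2 lk).
Qed.

Lemma std_pearl_chain s n : ear_size_ok s n -> pearl_chain (std_chain s n).
Proof.
case: s => /=.
  case: n => [|[|[|[|n]]]] // _.
  - exact: std_pearl_chain_path2.
  - exact: std_pearl_chain_path3.
  - exact: std_pearl_chain_path.
case: n => [|[|[|[|[|n]]]]] // _.
- exact: std_pearl_chain_cycle3.
- exact: std_pearl_chain_cycle4.
- exact: std_pearl_chain_cycle.
Qed.

Definition std_ear s n (sn : ear_size_ok s n) : decorated_ear :=
  DecoratedEar sn (std_pearl_chain sn).

Lemma free_for_std (G : groupType) s n (sn : ear_size_ok s n) : free_for G (std_ear sn).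
Proof.
have pE i (lt : i < n) : (std_chain s n)`_i = vtx (Ordinal lt : ear_graph s n).
  by rewrite -nth_std.
split=> /= [f fc|h k hk].
  have [u v uv|h hE] := @raag_lift (ear_graph s n) G (fun i : 'I_n => f i).
    move: uv; rewrite ear_adj_follows // => /orP[/fc //|/fc]; exact: commute_sym.
  by exists h => i lt; rewrite pE hE.
apply: (@raag_ext (ear_graph s n) G h k) => v; have := hk v (ltn_ord v).
by rewrite nth_std.
Qed.

(** * Whitney's ear decomposition *)

Section WhitneyEars.
Variable Gamma : sgraph.
Implicit Types (u v w : Gamma) (es : seq (ear Gamma)).

(** [follows] keeps both indices in range, so the defaults [u] and [v] of [nth] never decide the
    equations. *)
Definition edge_in es u v := exists i j k,
  [/\ i < size es, follows (ear_at es i).1 (size (ear_at es i).2) j k,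
      nth u (ear_at es i).2 j = u & nth v (ear_at es i).2 k = v].

Definition vertex_in es v := exists2 i, i < size es & v \in (ear_at es i).2.

Record ears_of es : Prop := EarsOf {
  ears_dec : ear_decomposition es;
  ears_proper : is_proper es;
  ears_adj : forall u v, edge_in es u v -> adj u v }.

Lemma ear_rcons es e i :
  i < size es -> ear_at (rcons es e) i = ear_at es i.
Proof. by move=> ie; rewrite nth_rcons ie. Qed.

Lemma ear_rcons_last es e : ear_at (rcons es e) (size es) = e.
Proof. by rewrite nth_rcons ltnn eqxx. Qed.

Lemma edge_in_rcons es e u v : edge_in es u v -> edge_in (rcons es e) u v.
Proof.
move=> [i [j [k [ie f ju kv]]]]; exists i, j, k.
by rewrite ear_rcons // size_rcons; split=> //; apply: leqW.
Qed.

Lemma edge_in_vertex es u v : edge_in es u v -> vertex_in es u /\ vertex_in es v.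
Proof.
move=> [i [j [k [ie f ju kv]]]]; have /andP[jn kn] := follows_lt f.
by split; exists i => //; [rewrite -ju|rewrite -kv]; apply: mem_nth.
Qed.

Lemma path_edge_adj (x : Gamma) (s : seq Gamma) u v j k : path (@adj Gamma) x s ->
  follows Path (size s).+1 j k -> nth u (x :: s) j = u -> nth v (x :: s) k = v -> adj u v.
Proof.
move=> /(pathP x) pth; rewrite /follows orbF => /andP[/eqP <- js] <- <-.
rewrite (set_nth_default x) ?(set_nth_default x v) //=; last by rewrite ltnS ltnW.
exact: pth.
Qed.

Lemma add_path_ear es z s :
  ears_of es -> uniq (z :: s) -> 0 < size s -> path (@adj Gamma) z s ->
  vertex_in es z -> vertex_in es (last z s) ->
  (forall v, v \in s -> v != last z s -> ~ vertex_in es v) ->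
  ears_of (rcons es (Path, z :: s)).
Proof.
move=> [[[es0 cyc] ears ends] prop eadj] us s0 pth zin lin inn.
have sz : size (rcons es (Path, z :: s)) = (size es).+1 by rewrite size_rcons.
split; [split; first split|..].
- by rewrite sz.
- by rewrite ear_rcons.
- by rewrite all_rcons ears andbT /is_ear us /= ltnS.
- move=> i v; rewrite sz ltnS => /andP[i0]; rewrite leq_eqVlt => /orP[/eqP ->|ie].
    rewrite ear_rcons_last /= => vs; split.
      move=> [j je]; rewrite ear_rcons // => vj; rewrite /is_endpoint /=.
      move: vs; rewrite inE => /orP[-> //|vs]; apply/orP; right.
      by apply: contraT => vl; case: (inn v vs vl); exists j.
    rewrite /is_endpoint /= => /orP[]/eqP ->; [case: zin|case: lin] => j je vj;
      by exists j; rewrite ?ear_rcons.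
  rewrite ear_rcons // => vi; have i0e : 0 < i < size es by rewrite i0.
  split.
    move=> [j ji]; rewrite ear_rcons ?(ltn_trans ji ie) // => vj.
    by apply/(ends i v i0e vi); exists j.
  move=> /(ends i v i0e vi) [j ji vj]; exists j => //.
  by rewrite ear_rcons // (ltn_trans ji ie).
- move=> i; rewrite sz ltnS => /andP[i0]; rewrite leq_eqVlt => /orP[/eqP ->|ie].
    by rewrite ear_rcons_last.
  by rewrite ear_rcons //; apply: prop; rewrite i0.
- move=> u v [i [j [k [+ f ju kv]]]]; rewrite sz ltnS leq_eqVlt => /orP[/eqP iE|ie].
    move: f ju kv; rewrite iE ear_rcons_last; exact: path_edge_adj.
  apply: eadj; exists i, j, k; move: f ju kv; rewrite ear_rcons //.
Qed.

Lemma connect_step (e : rel Gamma) x y : connect e x y -> x != y -> exists z, e x z.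
Proof.
move=> /connectP [[|z p] /= pth ->]; first by rewrite eqxx.
by move: pth => /andP[xz _] _; exists z.
Qed.

Lemma first_hit (e : rel Gamma) (U : pred Gamma) b p : path e b p -> ~~ U b ->
  U (last b p) -> uniq (b :: p) -> exists s z,
  [/\ path e b (rcons s z), uniq (b :: rcons s z), all (predC U) (b :: s), U z &
      {subset rcons s z <= p}].
Proof.
elim: p b => [|x p IH] b /=; first by move=> _ /negP.
move=> /andP[bx xp] nb ul /andP[bxp uxp].
have [Ux|nx] := boolP (U x).
  exists [::], x; split=> //=; rewrite ?bx ?nb // ?andbT.
    by move: bxp; rewrite inE negb_or => /andP[bx' _]; rewrite inE.
  by move=> y; rewrite !inE => ->.
have [s [z [h1 h2 h3 h4 h5]]] := IH x xp nx ul uxp.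
have sub : {subset x :: rcons s z <= x :: p}.
  by move=> y; rewrite !inE => /orP[-> //|/h5 ->]; rewrite orbT.
exists (x :: s), z; split=> //=.
- by rewrite bx.
- by move: h2 => /= ->; rewrite andbT; apply: contra bxp; apply: sub.
- by rewrite nb.
Qed.

Notation evoid S := [rel u v | [&& u \notin (S : {set Gamma}), v \notin (S : {set Gamma}) & adj u v]].

Lemma path_evoid (S : {set Gamma}) x p : path (evoid S) x p ->
  path (@adj Gamma) x p /\ forall y, y \in p -> y \notin S.
Proof.
elim: p x => //= z p IH x /andP[/and3P[_ zS xz] /IH [zp pS]].
by rewrite xz; split=> // y; rewrite inE => /orP[/eqP -> //|/pS].
Qed.

Hypothesis conn : vertex_connected 2 Gamma.

Lemma other_vertex (S : {set Gamma}) : #|S| <= 2 -> exists u, u \notin S.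
Proof.
move=> S2; apply: contrapT => h; have : (setT : {set Gamma}) \subset S.
  by apply/subsetP => u _; apply: contraT => uS; case: h; exists u.
by move=> /subset_leq_card; rewrite cardsT; have := conn.1; lia.
Qed.

Lemma conn_avoid (S : {set Gamma}) (S1 : #|S| < 2) x y :
  x \notin S -> y \notin S -> connect (evoid S) x y.
Proof. exact: conn.2. Qed.
Arguments conn_avoid [S] S1 x y.

(** A vertex [u] has a neighbour [w], and a second one because removing [w] does not isolate it. A
    path between the two neighbours that avoids [u] closes up to a cycle. *)
Lemma initial_cycle : exists es, [/\ ears_of es & 0 < size es].
Proof.
have [u _] := other_vertex (S := set0) ltac:(by rewrite cards0).
have [t] := other_vertex (S := [set u]) ltac:(by rewrite cards1).
rewrite inE eq_sym => ut.
have S0 : #|(set0 : {set Gamma})| < 2 by rewrite cards0.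
have [w /and3P[_ _ uw]] := connect_step (conn_avoid S0 u t ltac:(by rewrite inE) ltac:(by rewrite inE)) ut.
have uw' : u != w by apply: contraTneq uw => <-; rewrite adj_irr.
have [t'] := other_vertex (S := [set u; w]) ltac:(by rewrite cards2; case: (_ != _)).
rewrite !inE negb_or => /andP[tu tw].
have S1 (x : Gamma) : #|[set x]%SET| < 2 by rewrite cards1.
have [w' /and3P[_ w'S uw2]] := connect_step (conn_avoid (S1 w) u t' ltac:(by rewrite inE)
   ltac:(by rewrite inE)) ltac:(by rewrite eq_sym).
rewrite inE in w'S.
have wu : w \notin [set u]%SET by rewrite inE eq_sym.
have w'u : w' \notin [set u]%SET by rewrite inE; apply: contraTneq uw2 => ->; rewrite adj_irr.
have /connectP [p0 pth0 lst0] := conn_avoid (S1 u) w w' wu w'u.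
case: (shortenP pth0) lst0 => p pth up _ lst.
have [apth pS] := path_evoid pth.
have unu : u \notin w :: p.
  rewrite inE negb_or uw' /=; apply/negP => /pS; by rewrite inE eqxx.
have p0' : 0 < size p by case: (p) lst w'S => //= ->; rewrite eqxx.
exists [:: (Cycle, u :: w :: p)]; split=> //; split; [split; first split|..] => //=.
- by rewrite /is_ear /= unu; move: up => /= ->; rewrite !ltnS p0'.
- by move=> i v; case: i.
- by case.
move=> x y [[|i] [j [k [//= _ f jx ky]]]].
move: f; rewrite /follows => /orP[f|/andP[/eqP jE /eqP k0]].
  apply: (@path_edge_adj u (w :: p) x y j k) => //; first by rewrite /= uw.
  by rewrite /follows orbF.
have jE' : j = (size p).+1 by case: jE.
move: jx ky; rewrite k0 jE' /= => + <-; rewrite -[size p]/((size (w :: p)).-1).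
by rewrite nth_last /= -lst => <-; rewrite adj_sym.
Qed.

Lemma first_ear_large es : ears_of es -> forall a,
  exists2 c, vertex_in es c & c != a.
Proof.
move=> [[[es0 cyc] ears _] _ _] a.
have := all_nthP (Path, [::]) ears 0 es0; rewrite /is_ear cyc.
case E : (ear_at es 0).2 => [|x [|y l]] //= /andP[/andP[+ _] _].
rewrite inE negb_or => /andP[xy _].
have [xa|xa] := eqVneq x a.
  by exists y; [exists 0; rewrite // E !inE eqxx orbT|rewrite -xa eq_sym].
by exists x => //; exists 0; rewrite // E !inE eqxx.
Qed.

(** If all vertices are covered, the missing edge is itself an ear. Otherwise some edge leads from a
    covered [a] to an uncovered [b], and a path from [b] that avoids [a], stopped at the first
    covered vertex, completes the ear. *)
Lemma extend_ears es : ears_of es ->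
  (exists u v, [/\ adj u v, ~ edge_in es u v & ~ edge_in es v u]) ->
  exists e u v, [/\ ears_of (rcons es e), edge_in (rcons es e) u v & ~ edge_in es u v].
Proof.
move=> E [u [v [uv nuv nvu]]].
have [[w nw]|allU] := pselect (exists w, ~ vertex_in es w); last first.
  have uin x : vertex_in es x by apply: contrapT => h; apply: allU; exists x.
  have neq : u != v by apply: contraTneq uv => ->; rewrite adj_irr.
  exists (Path, [:: u; v]), u, v; split=> //.
    apply: add_path_ear => //=; first by rewrite inE neq.
      by rewrite uv.
    by move=> x; rewrite inE => /eqP ->; rewrite eqxx.
  exists (size es), 0, 1%N; rewrite size_rcons ltnSn ear_rcons_last.
  by split.
pose U : pred Gamma := fun x => `[< vertex_in es x >].
have UP x : reflect (vertex_in es x) (U x) by apply: asboolP.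
have [c0 c0U _] := first_ear_large E w.
have S0 : #|(set0 : {set Gamma})| < 2 by rewrite cards0.
have /connectP [p0 pth0 lst0] := conn_avoid S0 w c0 ltac:(by rewrite inE) ltac:(by rewrite inE).
case: (shortenP pth0) lst0 => p pth up _ lst.
have nUw : ~~ U w by apply/negP => /UP.
have Ul : U (last w p) by rewrite -lst; apply/UP.
have [s [a [h1 h2 h3 h4 _]]] := first_hit pth nUw Ul up.
have [bs [b [bE nb ba]]] : exists bs b, [/\ w :: s = rcons bs b, ~~ U b & adj a b].
  case/lastP E1: {-}(w :: s) => [|bs b] //; exists bs, b; split=> //.
    by move: h3; rewrite E1 all_rcons => /andP[].
  move: h1; rewrite rcons_path => /andP[_ /and3P[_ _]].
  by rewrite (_ : last w s = b) 1?adj_sym // -[last w s]/(last w (w :: s)) E1 last_rcons.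
(* The target [c] differs from [a], and so does every vertex of a path avoiding [a]; hence the new
   ear has distinct endpoints. *)
have [c cU ca] := first_ear_large E a.
have aS : #|[set a]%SET| < 2 by rewrite cards1.
have ab : b != a by apply: contraTneq h4 => <-.
have /connectP [q0 qth0 qlst0] := conn_avoid aS b c ltac:(by rewrite inE) ltac:(by rewrite inE).
case: (shortenP qth0) qlst0 => q qth uq _ qlst.
have Uq : U (last b q) by rewrite -qlst; apply/UP.
have [t [z [k1 k2 k3 k4 k5]]] := first_hit qth nb Uq uq.
have [qadj qS] := path_evoid k1.
exists (Path, a :: b :: rcons t z), a, b; split.
- apply: add_path_ear => //.
  + rewrite cons_uniq k2 andbT inE negb_or eq_sym ab /=.
    by apply/negP => /qS; rewrite inE eqxx.
  + by rewrite /= ba.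
  + exact/UP.
  + by rewrite /= last_rcons; apply/UP.
  + move=> x; rewrite /= last_rcons -rcons_cons mem_rcons inE => /orP[/eqP ->|xt].
      by rewrite eqxx.
    by move=> _ /UP xU; have := allP k3 x xt; rewrite /= xU.
- exists (size es), 0, 1%N; rewrite size_rcons ltnSn ear_rcons_last /=.
  by split.
- by move=> /edge_in_vertex [_ /UP]; apply/negP.
Qed.

(** Induction on the number of ordered pairs that are not yet edges of an ear. Covering the edges
    covers the vertices, as each vertex has a neighbour. *)
Lemma whitney : exists es, [/\ ears_of es, 0 < size es,
  forall v, vertex_in es v &
  forall u v, adj u v -> edge_in es u v \/ edge_in es v u].
Proof.
pose cov es := [set p : Gamma * Gamma | `[< edge_in es p.1 p.2 >]]%SET.
have [es0 [E0 n0]] := initial_cycle.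
suff [es [E n h]] : exists es, [/\ ears_of es, 0 < size es &
    forall u v, adj u v -> edge_in es u v \/ edge_in es v u].
  exists es; split=> // v.
  have [t] := other_vertex (S := [set v]) ltac:(by rewrite cards1).
  rewrite inE eq_sym => vt.
  have S0 : #|(set0 : {set Gamma})| < 2 by rewrite cards0.
  have [w /and3P[_ _ vw]] := connect_step (conn_avoid S0 v t ltac:(by rewrite inE) ltac:(by rewrite inE)) vt.
  by have [/edge_in_vertex []|/edge_in_vertex []] := h v w vw.
move: {2}#|~: cov es0| (leqnn #|~: cov es0|) => m; elim: m es0 E0 n0 => [|m IH] es E n.
  rewrite leqn0 cards_eq0 => /eqP c0; exists es; split=> // u v _; left.
  have : (u, v) \notin ~: cov es by rewrite c0 inE.
  by rewrite !inE negbK => /asboolP.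
move=> cm; have [full|] := pselect (forall u v, adj u v -> edge_in es u v \/ edge_in es v u).
  by exists es.
move=> /existsNP [u /existsNP [v /not_implyP [uv /not_orP [nuv nvu]]]].
have [|e [x [y [E' xy nxy]]]] := extend_ears E; first by exists u, v.
apply: (IH (rcons es e)) => //; first by rewrite size_rcons.
rewrite -ltnS; apply: leq_trans cm; apply: proper_card.
apply/properP; split; last by exists (x, y); rewrite !inE ?negbK; apply/asboolP.
rewrite setCS; apply/subsetP => p; rewrite !inE => /asboolP h; apply/asboolP.
exact: edge_in_rcons.
Qed.

End WhitneyEars.

(** * From the ears of a graph to an amalgam *)

Section Naming.
Variable V : eqType.
Implicit Types (es : seq (ear V)) (e : ear V) (v : V).

(** This is the naming rule of [glue_vertices], so that the ears of the amalgam are literally the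
    renamed ears of the graph. *)
Definition first_position es v : nat * nat :=
  let i := find (fun e => v \in e.2) es in (i, index v (ear_at es i).2).

Definition covers es v := has (fun e : ear V => v \in e.2) es.

Lemma coversP es v : reflect (exists2 i, i < size es & v \in (ear_at es i).2) (covers es v).
Proof. exact: (has_nthP (Path, [::])). Qed.

Lemma first_positionP es v : covers es v ->
  (first_position es v).1 < size es /\
  forall x0, nth x0 (ear_at es (first_position es v).1).2 (first_position es v).2 = v.
Proof.
move=> h; rewrite /first_position /= -has_find; split=> // x0; apply: nth_index.
exact: (nth_find (Path, [::]) h).
Qed.

Lemma first_position_inj es u v : covers es u -> covers es v ->
  first_position es u = first_position es v -> u = v.
Proof.
move=> /first_positionP [_ hu] /first_positionP [_ hv] E.
by rewrite -(hu u) E hv.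
Qed.

Lemma first_position_rcons es e v :
  covers es v -> first_position (rcons es e) v = first_position es v.
Proof.
move=> h; rewrite /first_position -cats1 find_cat -/(covers es v) h.
by rewrite nth_cat -has_find -/(covers es v) h.
Qed.

Lemma first_position_new es e v : ~~ covers es v -> v \in e.2 ->
  first_position (rcons es e) v = (size es, index v e.2).
Proof.
move=> h ve; rewrite /first_position -cats1 find_cat -/(covers es v) (negPf h) /= ve addn0.
by rewrite nth_cat ltnn subnn.
Qed.

Definition rename (f : V -> nat * nat) e : ear (nat * nat)%type := (e.1, map f e.2).

Lemma nth_rename f es i : i < size es ->
  ear_at (map (rename f) es) i = rename f (ear_at es i).
Proof. exact: nth_map. Qed.

Lemma ear_decomposition_rename es : ear_decomposition es ->
  ear_decomposition (map (rename (first_position es)) es).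
Proof.
move=> [[es0 cyc] ears ends]; set f := first_position es.
have fI i j : i < size es -> j < size es ->
    {in (ear_at es i).2 & (ear_at es j).2, injective f}.
  move=> ie je u v ui vj; apply: first_position_inj; apply/coversP.
    by exists i.
  by exists j.
have inj_in i : i < size es -> {in (ear_at es i).2 &, injective f} by move=> ie; apply: fI.
have isear i : i < size es -> is_ear (ear_at es i) by move=> ie; apply: (all_nthP _ ears).
have memf i j v : i < size es -> j < size es -> v \in (ear_at es i).2 ->
    (f v \in map f (ear_at es j).2) = (v \in (ear_at es j).2).
  move=> ie je vi; apply/mapP/idP => [[w wj /(fI i j ie je v w vi wj) -> //]|vj].
  by exists v.
split.
- by rewrite size_map nth_rename.
- apply/(all_nthP (Path, [::])) => i; rewrite size_map => ie; rewrite nth_rename //.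
  have := isear i ie; rewrite /is_ear /= size_map => /andP[us ->].
  by rewrite map_inj_in_uniq ?us //; apply: inj_in.
- move=> i x; rewrite size_map => /[dup] i0e /andP[i0 ie]; rewrite nth_rename //=.
  move=> /mapP [v vi ->].
  have -> : is_endpoint (rename f (ear_at es i)) (f v) = is_endpoint (ear_at es i) v.
    have := inj_in i ie; move: vi; rewrite /is_endpoint /rename /=.
    case: (ear_at es i) => sh [|z s] //= vi fi; rewrite last_map.
    have E w : w \in z :: s -> (f v == f w) = (v == w).
      by move=> ws; apply/eqP/eqP => [/fi|->] //; apply.
    by rewrite E ?mem_head // E ?mem_last.
  rewrite -(ends i v i0e vi); split=> [[j ji]|[j ji vj]].
    by rewrite nth_rename ?(ltn_trans ji ie) // (memf i j v ie (ltn_trans ji ie) vi); exists j.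
  by exists j => //; rewrite nth_rename ?(ltn_trans ji ie) // (memf i j v ie (ltn_trans ji ie) vi).
Qed.

Lemma is_proper_rename f es : is_proper es -> is_proper (map (rename f) es).
Proof.
by move=> prop i; rewrite size_map => /[dup] h /andP[_ ie]; rewrite nth_rename //=; apply: prop.
Qed.

Lemma ear_decomposition_prefix es e : 0 < size es ->
  ear_decomposition (rcons es e) -> ear_decomposition es.
Proof.
move=> es0 [[_ cyc] ears ends].
have at_ i : i < size es -> ear_at (rcons es e) i = ear_at es i.
  by move=> ie; rewrite nth_rcons ie.
split.
- by split=> //; rewrite -at_.
- by move: ears; rewrite all_rcons => /andP[].
- move=> i v /andP[i0 ie] vi.
  have := ends i v; rewrite size_rcons i0 ltnS (ltnW ie) at_ // => /(_ isT vi) <-.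
  split=> -[j ji vj]; exists j => //; [rewrite at_|rewrite -at_] => //; exact: ltn_trans ji ie.
Qed.

End Naming.

Lemma amalgam_wf_rconsI E0 L E a b : amalgam_wf (Amalgam E0 L) ->
  (forall x, x \in [:: a; b] ->
    (x.1 <= size L) && (x.2 < ear_size (nth E0 (E0 :: unzip1 L) x.1))) ->
  amalgam_wf (Amalgam E0 (rcons L (E, Glue2 a b))).
Proof.
move=> wf ab k x; rewrite /= size_rcons ltnS leq_eqVlt.
have nthE i : i <= size L ->
    nth E0 (E0 :: unzip1 (rcons L (E, Glue2 a b))) i = nth E0 (E0 :: unzip1 L) i.
  by case: i => [//|i] iL; rewrite /= /unzip1 map_rcons nth_rcons size_map iL.
rewrite /amalgam_ears /= /unzip2 map_rcons nth_rcons size_map => /orP[/eqP ->|kL].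
  by rewrite ltnn eqxx => /ab /andP[x1 x2]; split=> //; move: (nthE _ x1) => /= ->.
rewrite kL => /(wf k x kL) [x1 x2]; split=> //.
by move: (nthE x.1 (leq_trans x1 (ltnW kL))) => /= ->.
Qed.

(** By properness each later ear is a path, glued by [Glue2] at the first positions of its two
    endpoints; its inner vertices have not occurred before and receive fresh names. *)
Lemma amalgam_of_ears (V : eqType) (es : seq (ear V)) :
  ear_decomposition es -> is_proper es ->
  exists D : amalgam, [/\ amalgam_wf D,
    glued_ears D = map (rename (first_position es)) es &
    forall (G : groupType) i, i <= size (later_ears D) ->
      free_for G (nth (first_ear D) (amalgam_ears D) i)].
Proof.
elim/last_ind: es => [|es e IH] dec prop; first by case: dec => -[].
have [[_ cyc] ears ends] := dec.
have ear_e : is_ear e by move: ears; rewrite all_rcons => /andP[].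
have [es0|es0] := posnP (size es).
  move/size0nil: es0 => es0; rewrite es0 /= in dec prop cyc ends ear_e *.
  case: e cyc ear_e {dec prop ends ears} => sh s /= -> /andP[/= us sz].
  exists (Amalgam (std_ear (sz : ear_size_ok Cycle (size s))) [::]); split=> //.
    rewrite -[glued_ears _]/[:: (Cycle, [seq (0, j) | j <- iota 0 (size s)])].
    congr [:: (_, _)]; case: s us sz => // z s us sz; apply: (@eq_from_nth _ (0, 0)).
      by rewrite !size_map size_iota.
    move=> i; rewrite size_map size_iota => ie.
    rewrite (nth_map 0) ?size_iota // nth_iota // (nth_map z) //.
    rewrite (@first_position_new _ [::]) //; last exact: mem_nth.
    by rewrite -[(_, _).2]/(z :: s) index_uniq.
  by move=> G [|i] // _; apply: free_for_std.
have dec1 := ear_decomposition_prefix es0 dec.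
have prop1 : is_proper es.
  move=> i /andP[i0 ie]; have := prop i; rewrite size_rcons i0 nth_rcons ie ltnS ltnW //.
  by apply.
have [[E0 L] [/= wf gE fr]] := IH dec1 prop1.
have lastE : ear_at (rcons es e) (size es) = e by rewrite nth_rcons ltnn eqxx.
have epath : e.1 = Path by rewrite -{1}lastE; apply: prop; rewrite size_rcons es0 /=.
case: e {IH} epath lastE ear_e dec prop cyc ears ends => sh l /= -> lastE /andP[/= ul sl] _ _ _ _ ends.
set e : ear V := (Path, l) in lastE ends *.
have [z [s lE]] : exists z s, l = z :: s by case: (l) sl => // z s; exists z, s.
have ends_l v : v \in l -> covers es v <-> is_endpoint e v.
  move=> vl; have := ends (size es) v; rewrite size_rcons es0 ltnSn lastE => /(_ isT vl) <-.
  split=> [/coversP [j js vj]|[j js vj]]; last first.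
    by apply/coversP; exists j => //; move: vj; rewrite nth_rcons js.
  by exists j => //; rewrite nth_rcons js.
have cz : covers es z.
  by apply/ends_l; rewrite /is_endpoint /e lE ?mem_head //= eqxx.
have cl : covers es (last z s).
  by apply/ends_l; rewrite /is_endpoint /e lE ?mem_last //= eqxx orbT.
pose a := first_position es z; pose b := first_position es (last z s).
have [_ szg earsE] := amalgam_inv_state wf (fr B2).
have pos v : covers es v -> (first_position es v).1 <= size L /\
    (first_position es v).2 < ear_size (nth E0 (E0 :: unzip1 L) (first_position es v).1).
  move=> cv; have [p1 p2] := first_positionP cv.
  have p1L : (first_position es v).1 <= size L by rewrite -ltnS -szg gE size_map.
  split=> //; have [_ <-] := earsE _ p1L; rewrite gE nth_rename //= size_map.
  by rewrite index_mem; apply: (nth_find (Path, [::]) cv).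
exists (Amalgam E0 (rcons L (std_ear (sl : ear_size_ok Path (size l)), Glue2 a b))); split.
- apply: amalgam_wf_rconsI => // x; rewrite !inE => /orP[]/eqP ->.
    by have [-> ->] := pos _ cz.
  by have [-> ->] := pos _ cl.
- rewrite glued_ears_rcons.
  have [vs [-> szvs vsE]] := @glue_verticesE (glued_ears (Amalgam E0 L)) Path (size l)
    (Glue2 a b) sl.
  rewrite map_rcons gE; congr rcons.
    apply: (@eq_from_nth _ (Path, [::])); first by rewrite !size_map.
    move=> i; rewrite size_map => ie; rewrite !nth_rename //; congr (_, _).
    apply/eq_in_map => v vi; rewrite first_position_rcons //; apply/coversP; by exists i.
  congr (_, _); apply: (@eq_from_nth _ (0, 0)); first by rewrite szvs size_map.
  have nm v : covers es v ->
      name (glued_ears (Amalgam E0 L)) (first_position es v) = first_position es v.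
    move=> cv; have [p1 p2] := first_positionP cv.
    rewrite /name gE nth_rename //= (nth_map v).
      by rewrite nth_index //; apply: (nth_find (Path, [::]) cv).
    by rewrite index_mem; apply: (nth_find (Path, [::]) cv).
  move=> j; rewrite szvs => jl; rewrite vsE // (nth_map z) // -[e.2]/l /new_name.
  have lst : nth z l (size l).-1 = last z s by rewrite nth_last lE.
  case: eqP => [->|/eqP jl']; first by rewrite nm // lst first_position_rcons.
  case: eqP => [->|/eqP j0]; first by rewrite nm // lE /= first_position_rcons.
  rewrite first_position_new -?[e.2]/l ?mem_nth ?index_uniq //.
    by rewrite gE size_map.
  apply/negP => /ends_l; rewrite mem_nth // => /(_ isT).
  rewrite /is_endpoint /e /=; move: lst jl jl' j0 ul; rewrite lE /=.
  move=> lst jl jl' j0 ul /orP[/eqP E|/eqP E].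
    by have := @nth_uniq _ z (z :: s) j 0 jl (ltn0Sn (size s)) ul; rewrite /= E eqxx (negPf j0).
  have := @nth_uniq _ z (z :: s) j (size s) jl (ltnSn (size s)) ul.
  by rewrite E -lst /= eqxx (negPf jl').
- move=> G i; rewrite /amalgam_ears /= size_rcons leq_eqVlt => /orP[/eqP ->|iL].
    by rewrite /= /unzip1 map_rcons nth_rcons size_map ltnn eqxx; apply: free_for_std.
  have := fr G i iL; rewrite /amalgam_ears /=; case: i iL => [//|i] iL /=.
  by rewrite /unzip1 map_rcons nth_rcons size_map (iL : i < size L).
Qed.

Lemma connected_decomposition (Gamma : sgraph) : vertex_connected 2 Gamma ->
  exists D : amalgam, proper_raag_ear_decomposition Gamma D.
Proof.
move=> conn; have [es [[dec prop eadj] es0 vin eadj']] := whitney conn.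
have [D [wf gE fr]] := amalgam_of_ears dec prop.
exists D; split; last by rewrite gE; apply: is_proper_rename.
split=> //; last by rewrite gE; apply: ear_decomposition_rename.
case: D wf gE fr => E0 L wf gE fr.
have cov v : covers es v by apply/coversP; apply: vin.
pose f := first_position es.
rewrite amalgam_groupE /=; set X := amalgam_state E0 L.
have inv (G : groupType) : amalgam_inv G X (glued_ears (Amalgam E0 L)).
  by have [] := amalgam_inv_state wf (fr G).
have [v0 _] := (other_vertex conn (S := set0) ltac:(by rewrite cards0)).
pose vx (a : nat * nat) := nth v0 (ear_at es a.1).2 a.2.
have posE a : position (glued_ears (Amalgam E0 L)) a =
    (a.1 < size es) && (a.2 < size (ear_at es a.1).2).
  rewrite /position gE size_map; case: ltnP => //= ie.
  by rewrite nth_rename // size_map.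
have nameE a : position (glued_ears (Amalgam E0 L)) a ->
    name (glued_ears (Amalgam E0 L)) a = f (vx a).
  rewrite posE => /andP[ie je]; rewrite /name gE nth_rename //=.
  by rewrite (nth_map v0).
have vxf v : vx (f v) = v by have [_ h] := first_positionP (cov v); apply: h.
have posf v : position (glued_ears (Amalgam E0 L)) (f v).
  rewrite posE; have [-> _] := first_positionP (cov v).
  by rewrite index_mem; apply: (nth_find (Path, [::]) (cov v)).
have nmf v : name (glued_ears (Amalgam E0 L)) (f v) = f v by rewrite nameE // vxf.
have efE i j k : efollows (glued_ears (Amalgam E0 L)) i j k ->
    [/\ i < size es, j < size (ear_at es i).2, k < size (ear_at es i).2 &
     follows (ear_at es i).1 (size (ear_at es i).2) j k].
  rewrite /efollows gE size_map => /andP[ie]; rewrite nth_rename //= size_map => fl.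
  by have /andP[-> ->] := follows_lt fl.
have [phi phiE] : exists phi : {multiplicative pgroup X -> raag Gamma},
    forall a, position (glued_ears (Amalgam E0 L)) a -> phi (pearl_at X a) = vtx (vx a).
  have [h|phi phiE] := inv_hom_exists (inv (raag Gamma)) (f := fun a => vtx (vx a)).
    move=> j k /efE [ie ji ki fl]; rewrite !nameE ?posE ?ie //= !vxf.
    apply: vtx_commute; apply: eadj; exists h, j, k; split=> //; exact: set_nth_default.
  by exists phi => a pa; rewrite phiE // nameE // vxf.
(* Consistency and commutation do not mention the target group; [B2] is an arbitrary choice. *)
have cons := inv_consistent (inv B2).
have [u v uv|psi psiE] := @raag_lift Gamma (pgroup X) (fun v => pearl_at X (f v)).
  wlog [i [j [k [ie fl ju kv]]]] : u v uv / edge_in es u v => [h|].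
    have [/h|/h h'] := eadj' u v uv; first exact.
    by apply/commute_sym/h'; rewrite adj_sym.
  have /andP[jn kn] := follows_lt fl.
  have pj : position (glued_ears (Amalgam E0 L)) (i, j) by rewrite posE ie jn.
  have pk : position (glued_ears (Amalgam E0 L)) (i, k) by rewrite posE ie kn.
  have -> : pearl_at X (f u) = pearl_at X (i, j).
    by apply: cons => //; rewrite nmf nameE // /vx /= (set_nth_default u) // ju.
  have -> : pearl_at X (f v) = pearl_at X (i, k).
    by apply: cons => //; rewrite nmf nameE // /vx /= (set_nth_default v) // kv.
  apply: (inv_commute (inv B2)).
  by rewrite /efollows gE size_map ie nth_rename //= size_map.
(* Both composites fix the generators; on the amalgam, uniqueness is used with the amalgam itself as
   target. *)
apply/isogP; exists phi, psi; split=> x.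
  apply: (inv_hom_unique (inv (pgroup X)) (h := psi \o phi) (k := idfun)) => a pa /=.
  by rewrite phiE // psiE; apply: cons; rewrite ?nmf ?nameE ?posf.
apply: (raag_ext (f := phi \o psi) (g := idfun)) => v /=.
by rewrite psiE phiE // vxf.
Qed.

Theorem lemma6p13 (Gamma : sgraph) (hd : 2 <= d (raag Gamma)) :
  vertex_connected 2 Gamma <->
  exists D : amalgam, proper_raag_ear_decomposition Gamma D.
Proof.
split; first exact: connected_decomposition.
by move=> [D]; apply: decomposition_connected.
Qed.
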